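(* A collection of numbers $\kappa$ is the complete characteristic of some orientation preserving periodic homeomorphism $f:\mathbb T^2\to\mathbb T^2$ with $\bar B_f\neq\emptyset$ if and only if $\kappa$ coincides with exactly one of the following seven complete characteristics: (1) $\kappa_1$: $n=2$, $p=1$, $n_1=n_2=n_3=n_4=1$, $d_1=d_2=d_3=d_4=1$; (2) $\kappa_2$: $n=3$, $p=1$, $n_1=n_2=n_3=1$, $d_1=d_2=d_3=1$; (3) $\kappa_3$: $n=3$, $p=1$, $n_1=n_2=n_3=1$, $d_1=d_2=d_3=2$; (4) $\kappa_4$: $n=6$, $p=1$, $n_1=3$, $n_2=2$, $n_3=1$, $d_1=d_2=d_3=1$; (5) $\kappa_5$: $n=6$, $p=1$, $n_1=3$, $n_2=2$, $n_3=1$, $d_1=1$, $d_2=2$, $d_3=5$; (6) $\kappa_6$: $n=4$, $p=1$, $n_1=2$, $n_2=n_3=1$, $d_1=d_2=d_3=1$; (7) $\kappa_7$: $n=4$, $p=1$, $n_1=2$, $n_2=n_3=1$, $d_1=1$, $d_2=d_3=3$.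
   Context: $\mathbb T^2=\mathbb R^2/\mathbb Z^2$ is the two-dimensional torus with its standard orientation. A homeomorphism $f$ of a closed connected oriented surface $S$ is periodic of period $n\in\mathbb N$ if $f^n=\mathrm{id}$ and $f^m\neq \mathrm{id}$ for every natural $m<n$. For an orientation preserving periodic homeomorphism $f:S\to S$ of period $n$, $\bar B_f\subset S$ denotes the set of periodic points of $f$ whose period is strictly less than $n$; it is empty or consists of finitely many orbits $\mathcal O_1,\dots,\mathcal O_k$ of $f$. Let $n_i$ be the period of (number of points in) $\mathcal O_i$; it divides $n$, and we put $\lambda_i=n/n_i$. For each $i$ there is a unique $\delta_i\in\{1,\dots,\lambda_i-1\}$ coprime to $\lambda_i$ such that, for a point $\bar x_i\in\mathcal O_i$ and some neighborhood $D_{\bar x_i}$ of it, $f^{n_i}|_{D_{\bar x_i}}$ is topologically conjugate, by an orientation preserving homeomorphism, to the rotation $z\mapsto e^{2\pi \mathbf{i}\,\delta_i/\lambda_i}z$ of the complex plane around the origin (restricted to a disk about $0$, with $\bar x_i$ corresponding to $0$). Let $d_i\in\{1,\dots,\lambda_i-1\}$ be the number with $d_i\delta_i\equiv 1\pmod{\lambda_i}$. The complete characteristic of $f$ is the collection $\kappa=(n,p,n_1,\dots,n_k,d_1,\dots,d_k)$, where $p$ is the genus of $S$ (so $p=1$ for $\mathbb T^2$); the numbering of the orbits is immaterial, i.e. complete characteristics are compared up to simultaneous permutation of the pairs $(n_i,d_i)$. *)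

(* Defs.v *)
From HB Require Import structures.
From mathcomp Require Import all_boot all_order all_algebra generic_quotient.
From mathcomp Require Import all_classical all_reals all_analysis.

Set Implicit Arguments.
Unset Strict Implicit.
Unset Printing Implicit Defensive.

Import Order.TTheory GRing.Theory Num.Theory.
Import numFieldNormedType.Exports.

Local Open Scope classical_set_scope.
Local Open Scope ring_scope.

Definition plane (R : realType) : Type := (R * R)%type.

Section Torus.
Local Open Scope quotient_scope.
Variable R : realType.
Implicit Types u v w : plane R.

Definition lattice_rel : rel (plane R) :=
  fun u v => (u.1 - v.1 \is a Num.int) && (u.2 - v.2 \is a Num.int).

Lemma lattice_rel_refl : reflexive lattice_rel.
Proof. by move=> u; rewrite /lattice_rel !subrr rpred0. Qed.

Lemma lattice_rel_sym : symmetric lattice_rel.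
Proof. by move=> u v; rewrite /lattice_rel -rpredN opprB -[X in _ && X]rpredN opprB. Qed.

Lemma lattice_rel_trans : transitive lattice_rel.
Proof.
move=> v u w /andP[uv1 uv2] /andP[vw1 vw2]; apply/andP; split.
- by rewrite -(subrK v.1 u.1) -addrA rpredD.
- by rewrite -(subrK v.2 u.2) -addrA rpredD.
Qed.

Canonical lattice_equiv :=
  EquivRel lattice_rel lattice_rel_refl lattice_rel_sym lattice_rel_trans.

Definition torus : Type := quotient_topology {eq_quot lattice_equiv}.
HB.instance Definition _ := Topological.on torus.

Definition torus_proj : plane R -> torus := \pi_torus.

End Torus.

Section Orientation.
Variable R : realType.

(* The plane is identified with the complex numbers by (x, y) |-> x + i y;
   cis a is exp (i a), and rotation a is multiplication by exp (i a). *)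
Definition cis (a : R) : plane R := (cos a, sin a).

Definition rotation (a : R) (z : plane R) : plane R :=
  (cos a * z.1 - sin a * z.2, sin a * z.1 + cos a * z.2).

Definition disk (r : R) : set (plane R) :=
  [set z | z.1 ^+ 2 + z.2 ^+ 2 < r ^+ 2].

(* The loop gamma, parametrized by [0, 1], avoids c and has winding number +1
   around c. *)
Definition winds_once (gamma : R -> plane R) (c : plane R) : Prop :=
  exists rho theta : R -> R,
    [/\ {within `[0, 1], continuous theta},
        theta 1 = theta 0 + 2 * pi &
        forall t, t \in `[0, 1] ->
          0 < rho t /\ gamma t = c + rho t *: cis (theta t)].

(* Local degree +1 at u, for F continuous and injective near u. *)
Definition preserves_orientation_at (F : plane R -> plane R) (u : plane R) :
  Prop :=
  \forall r \near 0^'+,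
    winds_once (fun t => F (u + r *: cis (2 * pi * t))) (F u).

(* The standard orientation of the torus is the one for which the local
   inverses of torus_proj are oriented charts: F below is f read in them. *)
Definition orientation_preserving (f : torus R -> torus R) : Prop :=
  forall u : plane R, exists F : plane R -> plane R,
    (\forall v \near u,
       {for v, continuous F} /\ torus_proj (F v) = f (torus_proj v)) /\
    preserves_orientation_at F u.

Definition chart_orientation_preserving (D : set (torus R))
  (h : torus R -> plane R) : Prop :=
  forall u : plane R, D (torus_proj u) ->
    preserves_orientation_at (h \o @torus_proj R) u.

End Orientation.

Definition homeomorphism_on (S T : topologicalType) (A : set S) (B : set T)
  (h : S -> T) : Prop :=
  exists g : T -> S,
    [/\ {within A, continuous h}, {within B, continuous g},
        forall x, A x -> B (h x) /\ g (h x) = x &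
        forall y, B y -> A (g y) /\ h (g y) = y].

Definition homeomorphism (S T : topologicalType) (h : S -> T) : Prop :=
  exists g : T -> S,
    [/\ continuous h, continuous g, cancel h g & cancel g h].

Section Periodic.
Variable T : Type.

Definition periodic_of_period (n : nat) (f : T -> T) : Prop :=
  [/\ (0 < n)%N, iter n f =1 id &
      forall m : nat, (0 < m < n)%N -> ~ iter m f =1 id].

Definition point_period (f : T -> T) (x : T) (m : nat) : Prop :=
  [/\ (0 < m)%N, iter m f x = x &
      forall j : nat, (0 < j < m)%N -> iter j f x <> x].

Definition Bbar (n : nat) (f : T -> T) : set T :=
  [set x | exists2 m : nat, (m < n)%N & point_period f x m].

Definition orbit_of (f : T -> T) (x : T) : set T :=
  [set y | exists j : nat, y = iter j f x].

End Periodic.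

(* orbit_data is the list of the pairs (n_i, d_i). *)
Record characteristic := Characteristic {
  char_period : nat;
  char_genus : nat;
  orbit_data : seq (nat * nat) }.

Definition same_characteristic (k1 k2 : characteristic) : Prop :=
  [/\ char_period k1 = char_period k2, char_genus k1 = char_genus k2 &
      perm_eq (orbit_data k1) (orbit_data k2)].

Section CompleteCharacteristic.
Variable R : realType.
Implicit Types (f : torus R -> torus R) (x : torus R).

Definition locally_rotation f x (m delta lambda : nat) : Prop :=
  exists (D : set (torus R)) (h : torus R -> plane R) (r : R),
    [/\ open_nbhs x D /\ 0 < r,
        homeomorphism_on D (disk r) h,
        chart_orientation_preserving D h,
        h x = 0 &
        forall y, D y -> D (iter m f y) /\
          h (iter m f y) =
            rotation (2 * pi * delta%:R / lambda%:R) (h y)].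

Definition orbit_invariants (n : nat) f x (ni di : nat) : Prop :=
  let lambda := (n %/ ni)%N in
  [/\ point_period f x ni, (0 < di < lambda)%N &
      exists delta : nat,
        [/\ (0 < delta < lambda)%N, coprime delta lambda,
            locally_rotation f x ni delta lambda &
            di * delta = 1 %[mod lambda]]].

(* xs lists one representative of each of the orbits O_1, ..., O_k, so that
   every enumeration of the orbits yields a complete characteristic. *)
Definition complete_characteristic (n : nat) f (kappa : characteristic) :
  Prop :=
  [/\ char_period kappa = n, char_genus kappa = 1%N &
    exists xs : (size (orbit_data kappa)).-tuple (torus R),
      [/\ forall i, Bbar n f (tnth xs i),
          forall y, Bbar n f y -> exists! i, orbit_of f (tnth xs i) y &
          forall i, let nd := tnth (in_tuple (orbit_data kappa)) i in
            orbit_invariants n f (tnth xs i) nd.1 nd.2]].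

End CompleteCharacteristic.

Definition kappas : 7.-tuple characteristic := [tuple
  Characteristic 2 1 [:: (1, 1); (1, 1); (1, 1); (1, 1)];
  Characteristic 3 1 [:: (1, 1); (1, 1); (1, 1)];
  Characteristic 3 1 [:: (1, 2); (1, 2); (1, 2)];
  Characteristic 6 1 [:: (3, 1); (2, 1); (1, 1)];
  Characteristic 6 1 [:: (3, 1); (2, 2); (1, 5)];
  Characteristic 4 1 [:: (2, 1); (1, 1); (1, 1)];
  Characteristic 4 1 [:: (2, 1); (1, 3); (1, 3)]]%N.

(* Main.v *)
Require Import Defs.
From mathcomp Require Import all_boot all_order all_algebra generic_quotient.
From mathcomp Require Import zify ring lra.
From mathcomp Require Import all_classical all_reals all_analysis.

Set Implicit Arguments.
Unset Strict Implicit.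
Unset Printing Implicit Defensive.

Import Order.TTheory GRing.Theory Num.Theory.
Import numFieldNormedType.Exports.

Local Open Scope classical_set_scope.
Local Open Scope ring_scope.

(** Lift f to a homeomorphism F of the plane with F (v + k) = F v + A k for k in
    Z^2; then A is an integer matrix with A^n = 1 and det A = 1, and averaging an
    inner product conjugates it to the rotation by 2 pi c / n for some c.

    Let G be a lift of a power of f fixing a point p, with G^N = 1. Lifted to polar
    coordinates around p, G^N is the translation of the angle by 2 pi k for some
    integer k. Near p the local rotation number of G gives k modulo N. Near infinity
    G is at bounded distance from its linear part B, and averaging B^-j G^j
    conjugates it exactly to a rotation, which gives k modulo N again. Hence all the
    local rotation numbers are dictated by A. In the same way a second fixed point
    of G would force k = 0 modulo N, so a lift of f^j (0 < j < n) has at most one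
    fixed point; it has one since otherwise F^j v - v would have a continuous
    argument on the plane, whereas at infinity it winds like the map A^j - 1.

    So f^j has exactly [Z^2 : (A^j - 1) Z^2] = 2 - tr A^j fixed points. As f itself
    has a fixed point, n is the order of A, that is 2, 3, 4 or 6, and counting the
    fixed points of the powers of f determines all the orbits. Conversely the seven
    characteristics are those of -1, of the companion matrices of orders 3, 4 and 6,
    and of their inverses. *)

(** * Continuity and arguments in the plane *)

(** The proof uses neither derivatives nor the quotient orbifold. Its main topological tool is that
    a continuous integer-valued function on the plane is constant, applied to arguments of nowhere
    vanishing plane maps divided by a full turn. The integer [k] is a bridge because it can be read
    off at either end of the punctured plane, whatever the map does in between. Congruences are
    enough: [c] modulo [n] fixes every delta modulo its lambda, hence every [d_i], so one unit [d0]
    modulo [n] governs a whole characteristic. The counting rests on the displacement [F^j v - v] of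
    a point [v] over a fixed point of [f^j]. It lies in [Z^2], replacing [v] by [v + l] with [l] in
    [Z^2] adds [(A^j - 1) l] to it, and each vector of [Z^2] is the displacement of exactly one [v];
    so fixed points correspond to cosets. In the cases that occur the index is 1, or a prime, or
    that of the matrix -2, and these three are computed by hand. *)

Section Continuity.
Context {R : realType} {T : topologicalType}.
Implicit Types (f g : T -> R) (u : T -> plane R) (x : T).

Lemma cont_cst (V : topologicalType) (c : V) x : {for x, continuous (fun _ : T => c)}.
Proof. exact: cvg_cst. Qed.

Lemma cont_id x : {for x, continuous (fun y : T => y)}.
Proof. exact: cvg_id. Qed.

Lemma contD f g x : {for x, continuous f} -> {for x, continuous g} ->
  {for x, continuous (fun y => f y + g y)}.
Proof. exact: continuousD. Qed.

Lemma contN f x : {for x, continuous f} -> {for x, continuous (fun y => - f y)}.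
Proof. exact: continuousN. Qed.

Lemma contM f g x : {for x, continuous f} -> {for x, continuous g} ->
  {for x, continuous (fun y => f y * g y)}.
Proof. exact: continuousM. Qed.

Lemma contV f x : f x != 0 -> {for x, continuous f} ->
  {for x, continuous (fun y => (f y)^-1)}.
Proof. by move=> fx0 fx; exact: continuousV. Qed.

Lemma cont_fst u x : {for x, continuous u} -> {for x, continuous (fun y => (u y).1)}.
Proof. by move=> ux; apply: (continuous_comp ux); exact: cvg_fst. Qed.

Lemma cont_snd u x : {for x, continuous u} -> {for x, continuous (fun y => (u y).2)}.
Proof. by move=> ux; apply: (continuous_comp ux); exact: cvg_snd. Qed.

Lemma cont_pair f g x : {for x, continuous f} -> {for x, continuous g} ->
  {for x, continuous (fun y => (f y, g y) : plane R)}.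
Proof. by move=> fx gx; exact: (cvg_pair fx gx). Qed.

Lemma cont_cos f x : {for x, continuous f} -> {for x, continuous (fun y => cos (f y))}.
Proof. by move=> fx; apply: (continuous_comp fx); exact: continuous_cos. Qed.

Lemma cont_sin f x : {for x, continuous f} -> {for x, continuous (fun y => sin (f y))}.
Proof. by move=> fx; apply: (continuous_comp fx); exact: continuous_sin. Qed.

Lemma cont_exp f x : {for x, continuous f} -> {for x, continuous (fun y => expR (f y))}.
Proof. by move=> fx; apply: (continuous_comp fx); exact: continuous_expR. Qed.

Lemma cont_sqrt f x : {for x, continuous f} -> {for x, continuous (fun y => Num.sqrt (f y))}.
Proof. by move=> fx; apply: (continuous_comp fx); exact: sqrt_continuous. Qed.

Lemma cont_atan f x : {for x, continuous f} -> {for x, continuous (fun y => atan (f y))}.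
Proof. by move=> fx; apply: (continuous_comp fx); exact: continuous_atan. Qed.

Lemma cont_ln f x : 0 < f x -> {for x, continuous f} -> {for x, continuous (fun y => ln (f y))}.
Proof. by move=> fx0 fx; apply: (continuous_comp fx); exact: continuous_ln. Qed.

Lemma cont_max f g x : {for x, continuous f} -> {for x, continuous g} ->
  {for x, continuous (fun y => Num.max (f y) (g y))}.
Proof. by move=> fx gx; exact: continuous_max. Qed.

Lemma cont_sum (I : Type) (r : seq I) (f : I -> T -> R) x :
  (forall i, {for x, continuous (f i)}) ->
  {for x, continuous (fun y => \sum_(i <- r) f i y)}.
Proof.
move=> fx; elim: r => [|i r IH].
  by rewrite (_ : (fun _ => _) = fun=> 0); [exact: cont_cst|apply/funext => y; rewrite big_nil].
rewrite (_ : (fun _ => _) = fun y => f i y + \sum_(j <- r) f j y); first exact: contD.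
by apply/funext => y; rewrite big_cons.
Qed.

End Continuity.

Lemma cont_comp {S T U : topologicalType} (f : S -> T) (g : T -> U) x :
  {for x, continuous f} -> {for f x, continuous g} ->
  {for x, continuous (fun y => g (f y))}.
Proof. exact: continuous_comp. Qed.

Lemma cont_comp_fst {S T U : topologicalType} (g : S -> U) (p : S * T) :
  {for p.1, continuous g} -> {for p, continuous (fun q : S * T => g q.1)}.
Proof. by move=> gp; apply: continuous_comp gp; exact: cvg_fst. Qed.

Lemma cont_comp_snd {S T U : topologicalType} (g : T -> U) (p : S * T) :
  {for p.2, continuous g} -> {for p, continuous (fun q : S * T => g q.2)}.
Proof. by move=> gp; apply: continuous_comp gp; exact: cvg_snd. Qed.

Lemma cont_plane {R : realType} {T : topologicalType} (u : T -> plane R) x :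
  {for x, continuous (fun y => (u y).1)} -> {for x, continuous (fun y => (u y).2)} ->
  {for x, continuous u}.
Proof.
move=> u1 u2; rewrite (_ : u = fun y => ((u y).1, (u y).2)); first exact: cont_pair.
by apply/funext => y; case: (u y).
Qed.

(* Unifying a topologicalType from the argument of continuous_at fails; it
   succeeds from the type argument of {for _, continuous _}. *)
Ltac cfor := match goal with |- continuous_at ?x ?f => change {for x, continuous f} end.

Ltac cts := repeat (try cfor; lazymatch goal with
  | |- {for _, continuous (fun y => y)} => exact: cont_id
  | |- {for _, continuous (fun _ => ?c)} => exact: cont_cst
  | H : {for ?x, continuous ?f} |- {for ?x, continuous ?f} => exact: H
  | H : continuous ?f |- {for _, continuous ?f} => exact: H
  | |- {for ?x, continuous (fun y => (@?f y + @?g y)%R)} => apply: (@contD _ _ f g x)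
  | |- {for ?x, continuous (fun y => (- @?f y)%R)} => apply: (@contN _ _ f x)
  | |- {for ?x, continuous (fun y => (@?f y * @?g y)%R)} => apply: (@contM _ _ f g x)
  | |- {for ?x, continuous (fun y => cos (@?f y))} => apply: (@cont_cos _ _ f x)
  | |- {for ?x, continuous (fun y => sin (@?f y))} => apply: (@cont_sin _ _ f x)
  | |- {for ?x, continuous (fun y => expR (@?f y))} => apply: (@cont_exp _ _ f x)
  | |- {for ?x, continuous (fun y => atan (@?f y))} => apply: (@cont_atan _ _ f x)
  | |- {for ?x, continuous (fun y => Num.max (@?f y) (@?g y))} => apply: (@cont_max _ _ f g x)
  | |- {for ?x, continuous (fun y => (@?f y, @?g y))} => apply: (@cont_pair _ _ f g x)
  | |- {for ?x, continuous (fun y => (@?f y).1)} => apply: (@cont_fst _ _ f x)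
  | |- {for ?x, continuous (fun y => (@?f y).2)} => apply: (@cont_snd _ _ f x)
  | H : continuous ?f |- {for _, continuous (fun y => ?f (@?h y))} =>
      apply: (@cont_comp _ _ _ h f _ _ (H _))
  end).

Section Plane.
Context {R : realType}.
Implicit Types u v w : plane R.

Lemma plane_eq u v : u.1 = v.1 -> u.2 = v.2 -> u = v.
Proof. by case: u v => [? ?] [? ?] /= -> ->. Qed.

Definition dot u v : R := u.1 * v.1 + u.2 * v.2.
Definition cross u v : R := u.1 * v.2 - u.2 * v.1.
(** The norm of the product space is the maximum of the two coordinates, hence this separate
    Euclidean norm for polar coordinates. *)
Definition enorm u : R := Num.sqrt (dot u u).
(** Every real is an argument of 0, so existence holds without side condition and only uniqueness
    requires a nonzero vector. *)
Definition has_arg u (a : R) : Prop := u = enorm u *: cis a.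

Lemma dot_ge0 u : 0 <= dot u u.
Proof. by rewrite /dot -!expr2 addr_ge0 ?sqr_ge0. Qed.

Lemma enorm_ge0 u : 0 <= enorm u. Proof. exact: sqrtr_ge0. Qed.

Lemma enormE u : enorm u ^+ 2 = dot u u.
Proof. by rewrite sqr_sqrtr // dot_ge0. Qed.

Lemma dot_eq0 u : dot u u = 0 -> u = 0.
Proof.
move=> /eqP; rewrite /dot -!expr2 paddr_eq0 ?sqr_ge0 // !sqrf_eq0 => /andP[/eqP u1 /eqP u2].
exact: plane_eq.
Qed.

Lemma dot_gt0 u : u != 0 -> 0 < dot u u.
Proof. by move=> u0; rewrite lt0r dot_ge0 andbT; apply: contra_neq u0 => /dot_eq0. Qed.

Lemma enorm_gt0 u : u != 0 -> 0 < enorm u.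
Proof. by move=> /dot_gt0; rewrite -sqrtr_gt0. Qed.

Lemma enorm0 : enorm 0 = 0.
Proof. by rewrite /enorm /dot /= !mulr0 addr0 sqrtr0. Qed.

Lemma enorm_cis r (a : R) : 0 <= r -> enorm (r *: cis a) = r.
Proof.
move=> r0; rewrite /enorm /dot /= (_ : _ + _ = r ^+ 2); first by rewrite sqrtr_sqr ger0_norm.
by rewrite -[RHS]mulr1 -(cos2Dsin2 a) /GRing.scale /=; ring.
Qed.

Lemma has_arg_cis r (a : R) : 0 <= r -> has_arg (r *: cis a) a.
Proof. by move=> r0; rewrite /has_arg enorm_cis. Qed.

Lemma has_arg_scale r u (a : R) : 0 <= r -> has_arg u a -> has_arg (r *: u) a.
Proof.
move=> r0 ->; rewrite scalerA; apply: has_arg_cis.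
by rewrite mulr_ge0 // enorm_ge0.
Qed.

Lemma has_argE u (a : R) : has_arg u a -> u.1 = enorm u * cos a /\ u.2 = enorm u * sin a.
Proof. by move=> ua; split; rewrite {1}ua. Qed.

Lemma turn_gt0 : 0 < 2 * pi :> R.
Proof. by rewrite mulr_gt0 // pi_gt0. Qed.

Lemma turn_neq0 : 2 * pi != 0 :> R.
Proof. by rewrite gt_eqF ?turn_gt0. Qed.

Lemma turn_inj (a b : R) : a / (2 * pi) = b / (2 * pi) -> a = b.
Proof. by move/mulIf; apply; rewrite invr_eq0 turn_neq0. Qed.

Lemma cos_eq1_ge0 (x : R) : 0 <= x < 2 * pi -> cos x = 1 -> x = 0.
Proof.
move=> /andP[x0 x2] cx1.
have [xpi|pix] := leP x pi.
  by apply: cos_inj => //; rewrite ?in_itv /= ?x0 ?lexx ?pi_ge0 // cos0.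
have : 2 * pi - x = 0.
  apply: cos_inj; rewrite ?in_itv /= ?lexx ?pi_ge0 //; first by lra.
  by rewrite cosB mulr_natl cos2pi sin2pi mul0r addr0 mul1r cos0.
by lra.
Qed.

Lemma cosDz (a : R) (z : int) : cos (a + 2 * pi * z%:~R) = cos a /\ sin (a + 2 * pi * z%:~R) = sin a.
Proof.
have H (b : R) (k : nat) : cos (b + 2 * pi * k%:R) = cos b /\ sin (b + 2 * pi * k%:R) = sin b.
  rewrite mulr_natl mulr_natr; split; first exact: (periodicn (@cosD2pi R)).
  exact: (periodicn (@sinD2pi R)).
case: z => k; first exact: H.
have [<- <-] := H (a + 2 * pi * (Negz k)%:~R) k.+1.
by rewrite NegzE mulrNz mulrN subrK.
Qed.

Lemma cis_inj (a b : R) : cis a = cis b -> (a - b) / (2 * pi) \is a Num.int.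
Proof.
case=> ca sa; set y := _ / _.
(* Whole turns are removed by [floor], which leaves an angle [x] in [[0, 2 pi)] whose cosine is
   1. *)
pose z := Num.floor y; have := floor_itv y => /andP[zy yz].
pose x := 2 * pi * (y - z%:~R).
have xE : a - b = x + 2 * pi * z%:~R.
  by rewrite /x -mulrDr subrK /y mulrC divfK // turn_neq0.
have : x = 0.
  apply: cos_eq1_ge0.
    apply/andP; split; first by rewrite mulr_ge0 ?(ltW turn_gt0) // subr_ge0.
    by rewrite -[X in _ < X]mulr1 ltr_pM2l ?turn_gt0 // ltrBlDl -intrD1.
  by have [<- _] := cosDz x z; rewrite -xE cosB ca sa -!expr2 cos2Dsin2.
move=> /eqP; rewrite mulf_eq0 (negbTE turn_neq0) /= subr_eq0 => /eqP ->.
exact: intr_int.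
Qed.

Lemma cis_int (a b : R) : (a - b) / (2 * pi) \is a Num.int -> cis a = cis b.
Proof.
move=> /intrP[z zE]; have -> : a = b + 2 * pi * z%:~R.
  by rewrite -zE mulrC divfK ?turn_neq0 // addrC subrK.
by rewrite /cis; have [-> ->] := cosDz b z.
Qed.

Lemma has_arg_uniq u (a b : R) : u != 0 -> has_arg u a -> has_arg u b ->
  (a - b) / (2 * pi) \is a Num.int.
Proof.
move=> u0 ua ub; apply: cis_inj.
have : enorm u *: cis a = enorm u *: cis b by rewrite -ua.
by move=> /scalerI; apply; rewrite gt_eqF ?enorm_gt0.
Qed.

Lemma has_arg_int u (a b : R) : (a - b) / (2 * pi) \is a Num.int -> has_arg u a -> has_arg u b.
Proof. by move=> /cis_int ab; rewrite /has_arg ab. Qed.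

Lemma has_arg_ex u : exists a : R, has_arg u a.
Proof.
have [->|u0] := eqVneq u 0.
  by exists 0; rewrite /has_arg enorm0 scale0r.
have e0 := enorm_gt0 u0; have e2 := enormE u; set e := enorm u in e0 e2 *.
have eN0 : e != 0 by rewrite gt_eqF.
pose x := u.1 / e.
have x2 : x ^+ 2 + (u.2 / e) ^+ 2 = 1.
  rewrite /x !expr_div_n e2 -mulrDl /dot -!expr2 divff //.
  by rewrite !expr2 gt_eqF // dot_gt0.
have x1 : -1 <= x <= 1.
  rewrite -ler_norml -(@ler_pXn2r _ 2) ?nnegrE // expr1n -normrX ger0_norm ?sqr_ge0 //.
  by rewrite -x2 lerDl sqr_ge0.
have sE : sin (acos x) = `|u.2 / e|.
  by rewrite sin_acos // -x2 addrAC subrr add0r sqrtr_sqr.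
have cE : cos (acos x) = x by rewrite acosK // in_itv.
have [y0|y0] := leP 0 (u.2 / e).
  exists (acos x); apply: plane_eq => /=; rewrite -/e /GRing.scale /=.
    by rewrite cE mulrC divfK.
  by rewrite sE ger0_norm // mulrC divfK.
exists (- acos x); apply: plane_eq => /=; rewrite -/e /GRing.scale /=.
  by rewrite cosN cE mulrC divfK.
by rewrite sinN sE ltr0_norm // opprK mulrC divfK.
Qed.

(** The oriented angle from [u] to [v] when [dot u v] is positive: there [atan] gives it
    continuously, with no choice of branch. *)
Definition angle u v : R := atan (cross u v / dot u v).

Lemma dot_neq0 u v : 0 < dot u v -> (u != 0) * (v != 0).
Proof.
move=> uv; split; apply/eqP => uv0; move: uv; rewrite uv0 /dot /=.
  by rewrite !mul0r addr0 ltxx.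
by rewrite !mulr0 addr0 ltxx.
Qed.

Lemma has_arg_angle u v a : 0 < dot u v -> has_arg u a -> has_arg v (a + angle u v).
Proof.
move=> uv ua; have [u0 v0] := dot_neq0 uv.
have [b vb] := has_arg_ex v.
suff : (b - (a + angle u v)) / (2 * pi) \is a Num.int by move/has_arg_int; apply.
have [ue ve] := (enorm_gt0 u0, enorm_gt0 v0).
have [u1 u2] := has_argE ua; have [v1 v2] := has_argE vb.
have dE : dot u v = enorm u * enorm v * cos (b - a).
  by rewrite /dot u1 u2 v1 v2 cosB; ring.
have cE : cross u v = enorm u * enorm v * sin (b - a).
  by rewrite /cross u1 u2 v1 v2 sinB; ring.
have c0 : 0 < cos (b - a).
  by move: uv; rewrite dE pmulr_rgt0 // mulr_gt0.
have -> : angle u v = atan (tan (b - a)).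
  rewrite /angle /tan dE cE; congr atan.
  by rewrite -mulf_div divff ?mul1r // gt_eqF // mulr_gt0.
set x := b - a in c0 *; rewrite opprD addrA -/x.
have ct : 0 < cos (atan (tan x)) by rewrite cos_gt0_pihalf // atan_gtNpi2 atan_ltpi2.
have tt : tan (atan (tan x)) = tan x by exact: atanK.
apply: cis_inj; rewrite /cis.
(* Both angles have a positive cosine and the same tangent, and these determine the cosine and then
   the sine. *)
have s1 (y : R) : 0 < cos y -> cos y = (Num.sqrt (1 + tan y ^+ 2))^-1.
  move=> cy; rewrite -cos2_tan2 ?gt_eqF // -exprVn sqrtr_sqr ger0_norm ?invr_ge0 ?ltW //.
  by rewrite invrK.
have cc : cos x = cos (atan (tan x)) by rewrite (s1 _ c0) (s1 _ ct) tt.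
have st (y : R) : 0 < cos y -> sin y = tan y * cos y.
  by move=> cy; rewrite /tan divfK // gt_eqF.
by congr pair => //; rewrite (st _ c0) (st _ ct) tt cc.
Qed.

Lemma cont_dot {T : topologicalType} (f g : T -> plane R) x :
  {for x, continuous f} -> {for x, continuous g} ->
  {for x, continuous (fun y => dot (f y) (g y))}.
Proof. by move=> fx gx; rewrite /dot; cts. Qed.

Lemma cont_cross {T : topologicalType} (f g : T -> plane R) x :
  {for x, continuous f} -> {for x, continuous g} ->
  {for x, continuous (fun y => cross (f y) (g y))}.
Proof. by move=> fx gx; rewrite /cross; cts. Qed.

Lemma cont_enorm {T : topologicalType} (f : T -> plane R) x :
  {for x, continuous f} -> {for x, continuous (fun y => enorm (f y))}.
Proof. by move=> fx; rewrite /enorm; apply: cont_sqrt; exact: cont_dot. Qed.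

Lemma cont_angle {T : topologicalType} (f g : T -> plane R) x :
  0 < dot (f x) (g x) -> {for x, continuous f} -> {for x, continuous g} ->
  {for x, continuous (fun y => angle (f y) (g y))}.
Proof.
move=> d0 fx gx; rewrite /angle; apply: cont_atan; apply: contM; first exact: cont_cross.
by apply: contV; [rewrite gt_eqF|exact: cont_dot].
Qed.

End Plane.

(** * Lifting angles *)

Section IntegerValued.
Context {R : realType}.

Lemma int_valued_path (phi : R -> R) : {within `[0, 1], continuous phi} ->
  (forall t, t \in `[0, 1] -> phi t \is a Num.int) -> phi 1 = phi 0.
Proof.
move=> phic phiz.
have i0 : 0 \in `[0, 1 : R] by rewrite in_itv /= lexx ler01.
have i1 : 1 \in `[0, 1 : R] by rewrite in_itv /= lexx ler01.
have /intrP[a aE] := phiz _ i0; have /intrP[b bE] := phiz _ i1.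
(* If the end values differed, the intermediate value theorem would produce a half-integer value of
   [phi]. *)
have half (m c : int) : m%:~R + 1 / 2 = c%:~R :> R -> False.
  move=> mc; have : ((2 * m + 1)%:~R = (2 * c)%:~R :> R) by rewrite intrD !intrM -mc; lra.
  by move=> /intr_inj; lia.
rewrite aE bE; congr intmul; apply/eqP; case: ltgtP => // ab.
- have [] := @IVT R phi 0 1 (b%:~R + 1 / 2) ler01 phic.
    rewrite aE bE /Order.min /Order.max !ltr_int ltNge (ltW ab) /=.
    have : b%:~R + 1 <= a%:~R :> R by rewrite -intrD1 ler_int; lia.
    by move=> ?; apply/andP; split; lra.
  by move=> t /phiz /intrP[c ->] /esym /half.
- have [] := @IVT R phi 0 1 (a%:~R + 1 / 2) ler01 phic.
    rewrite aE bE /Order.min /Order.max !ltr_int ab /=.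
    have : a%:~R + 1 <= b%:~R :> R by rewrite -intrD1 ler_int; lia.
    by move=> ?; apply/andP; split; lra.
  by move=> t /phiz /intrP[c ->] /esym /half.
Qed.

Lemma int_valued_segment (phi : plane R -> R) (v w : plane R) :
  (forall t, t \in `[0, 1] -> {for v + t *: (w - v), continuous phi}) ->
  (forall t, t \in `[0, 1] -> phi (v + t *: (w - v)) \is a Num.int) -> phi w = phi v.
Proof.
move=> phic phiz.
have := @int_valued_path (fun t => phi (v + t *: (w - v))).
rewrite scale1r scale0r addr0 [_ + (w - v)]addrC subrK; apply=> //.
apply: continuous_in_subspaceT => t /set_mem /= /phic pc.
apply: (@cont_comp _ _ _ (fun t : R => v + t *: (w - v)) phi t _ pc); apply: cont_plane => /=; rewrite /GRing.scale /=; cts.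
Qed.

Lemma int_valued_plane (phi : plane R -> R) : continuous phi ->
  (forall v, phi v \is a Num.int) -> forall v w, phi v = phi w.
Proof. by move=> phic phiz v w; apply: int_valued_segment => t _; [exact: phic|exact: phiz]. Qed.

Lemma int_valued_line (phi : R -> R) : continuous phi ->
  (forall t, phi t \is a Num.int) -> forall s t, phi s = phi t.
Proof.
move=> phic phiz s t.
have := @int_valued_plane (fun v => phi v.1) _ (fun v => phiz v.1) (s, 0) (t, 0).
by apply => v; cts.
Qed.

End IntegerValued.

Section Lifting.
Context {R : realType}.
Variable g : plane R -> plane R.
Hypothesis gc : continuous g.
Hypothesis g0 : forall v, g v != 0.

Lemma square_compact (M : R) : compact [set v : plane R | `|v.1| <= M /\ `|v.2| <= M].
Proof.
have -> : [set v : plane R | `|v.1| <= M /\ `|v.2| <= M] = `[-M, M] `*` `[-M, M].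
  by apply/seteqP; split=> v /=; rewrite !in_itv /= -!ler_norml.
by apply: compact_setX; exact: segment_compact.
Qed.

Lemma dot_near (v : plane R) : exists2 e : R, 0 < e &
  forall x y, `|v - x| < e -> `|v - y| < e -> 0 < dot (g x) (g y).
Proof.
pose D (p : plane R * plane R) := dot (g p.1) (g p.2).
have Dc : {for (v, v), continuous D}.
  apply: cont_dot.
    exact: (@cont_comp_fst _ _ _ g (v, v) (@gc v)).
  exact: (@cont_comp_snd _ _ _ g (v, v) (@gc v)).
have : \forall p \near (v, v), 0 < D p.
  by apply: (cvgr_gt (D (v, v)) Dc); exact: dot_gt0.
move=> /nbhs_ballP[e /= e0 eD]; exists e => // x y vx vy.
by apply: (eD (x, y)); split; rewrite -ball_normE.
Qed.

(** Compactness of the square yields one step size below which [g] always turns by less than a right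
    angle, so that [angle] applies. *)
Lemma dot_uniform (M : R) : exists2 e : R, 0 < e &
  forall v w, `|v.1| <= M -> `|v.2| <= M -> `|v - w| < e -> 0 < dot (g v) (g w).
Proof.
have /compact_near_coveringP nc := @square_compact M.
have : \forall e \near 0^'+, [set v : plane R | `|v.1| <= M /\ `|v.2| <= M] `<=`
    (fun v => forall w, `|v - w| < e -> 0 < dot (g v) (g w)).
  apply: (nc R 0^'+ (fun e v => forall w, `|v - w| < e -> 0 < dot (g v) (g w))).
  move=> v _; have [e e0 ve] := dot_near v.
  exists (ball v (e / 2), [set x | x < e / 2]) => /=.
    split; first by apply: nbhsx_ballx; rewrite divr_gt0.
    by apply: nbhs_right_lt; rewrite divr_gt0.
  move=> [x r] [/=]; rewrite -ball_normE /= => vx rx y xy; apply: ve.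
    by apply: lt_trans vx _; lra.
  rewrite (_ : v - y = (v - x) + (x - y)); last by rewrite addrA subrK.
  apply: le_lt_trans (ler_normD _ _) _.
  by have := ltrD vx (lt_trans xy rx); rewrite -splitr.
move=> near_e; have [e [/= e0 eP]] := filter_ex (filterI (nbhs_right_gt (0 : R)) near_e).
by exists e => // v w v1 v2; apply: eP.
Qed.

Definition square (M : R) : set (plane R) := [set v | `|v.1| <= M /\ `|v.2| <= M].

Lemma squareZ M v t : t \in `[0, 1] -> square M v -> square M (t *: v).
Proof.
rewrite in_itv /= => /andP[t0 t1] [v1 v2]; split; rewrite /= normrM ger0_norm //.
  by apply: le_trans v1; rewrite ler_piMl.
by apply: le_trans v2; rewrite ler_piMl.
Qed.

Lemma lift_square (a0 M : R) : has_arg (g 0) a0 -> exists theta : plane R -> R,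
  theta 0 = a0 /\ forall v, square M v -> {for v, continuous theta} /\ has_arg (g v) (theta v).
Proof.
move=> ga0; have [e e0 eP] := dot_uniform M.
(* With more than [M / e] steps, consecutive points of the segment from 0 to [v] are closer than
   [e]. The same [N] serves the whole square, which makes the sum of the angles continuous in
   [v]. *)
pose N := (Num.truncn (M / e)).+1.
have N0 : 0 < N%:R :> R by rewrite ltr0n.
have MN : M / N%:R < e.
  by rewrite ltr_pdivrMr // mulrC -ltr_pdivrMr // truncnS_gt.
pose pt (i : nat) (v : plane R) := (i%:R / N%:R) *: v.
pose ang i v := angle (g (pt i v)) (g (pt i.+1 v)).
have dotP i v : (i < N)%N -> square M v -> 0 < dot (g (pt i v)) (g (pt i.+1 v)).
  move=> iN vM; have [p1 p2] : square M (pt i v).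
    apply: squareZ => //; rewrite in_itv /= divr_ge0 ?ler0n //=.
    by rewrite ler_pdivrMr // mul1r ler_nat ltnW.
  apply: eP => //; rewrite /pt -scalerBl -mulrBl -natr1 opprD addNKr mulN1r scaleNr normrN.
  case: vM => v1 v2; apply: le_lt_trans MN.
  have H (x : R) : `|x| <= M -> `|(N%:R)^-1 * x| <= M / N%:R.
    by move=> xM; rewrite normrM ger0_norm ?invr_ge0 ?ler0n // mulrC ler_pM2r ?invr_gt0.
  by rewrite /Num.norm /= ge_max; apply/andP; split; apply: H.
exists (fun v => a0 + \sum_(i < N) ang i v); split.
  rewrite big1 ?addr0 // => i _; by rewrite /ang /pt !scaler0 /angle /cross [X in X - _]mulrC subrr mul0r atan0.
move=> v vM; split.
  apply: contD; first exact: cont_cst.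
  have H (r : seq 'I_N) : {for v, continuous (fun u => \sum_(i <- r) ang i u)}.
    apply: cont_sum => i; apply: cont_angle; first exact: dotP.
      apply: (@cont_comp _ _ _ (pt i) g v _ (@gc _)).
      by apply: cont_plane; rewrite /pt /= /GRing.scale /=; cts.
    apply: (@cont_comp _ _ _ (pt i.+1) g v _ (@gc _)).
    by apply: cont_plane; rewrite /pt /= /GRing.scale /=; cts.
  exact: H.
have H k : (k <= N)%N -> has_arg (g (pt k v)) (a0 + \sum_(i < k) ang i v).
  elim: k => [|k IH] kN; first by rewrite big_ord0 addr0 /pt mul0r scale0r.
  by rewrite big_ord_recr /= addrA; apply: has_arg_angle; [exact: dotP|apply: IH; exact: ltnW].
by have := H _ (leqnn N); rewrite /pt divff ?scale1r // gt_eqF.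
Qed.

Theorem lift_plane : exists theta : plane R -> R,
  continuous theta /\ forall v, has_arg (g v) (theta v).
Proof.
have [a0 ga0] := has_arg_ex (g 0).
have /choice[th thP] : forall M : R, exists theta : plane R -> R, theta 0 = a0 /\
    forall v, square M v -> {for v, continuous theta} /\ has_arg (g v) (theta v).
  by move=> M; exact: lift_square.
have agree M M' v : square M v -> square M' v -> th M v = th M' v.
  move=> vM vM'; have [th0 thM] := thP M; have [th0' thM'] := thP M'.
  (* Both lifts start from [a0] at 0 and differ by whole turns along the segment from 0 to [v]. *)
  have := @int_valued_segment R (fun v => (th M v - th M' v) / (2 * pi)) 0 v.
  rewrite th0 th0' subrr mul0r => H.
  suff /eqP : (th M v - th M' v) / (2 * pi) = 0.
    by rewrite mulf_eq0 invr_eq0 (negbTE turn_neq0) orbF subr_eq0 => /eqP.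
  apply: H => t t01; rewrite add0r subr0;
    have [c1 a1] := thM _ (squareZ t01 vM); have [c2 a2] := thM' _ (squareZ t01 vM').
    by cts.
  exact: has_arg_uniq a1 a2.
have sq (v : plane R) : square `|v| v.
  by split=> /=; rewrite [leRHS]/Num.norm /= le_max lexx ?orbT.
(* Each point uses the square of its own norm; continuity comes from the square of radius one more,
   since near [v] the two choices agree. *)
exists (fun v => th `|v| v); split=> [v|v]; last by have [_ /(_ v (sq v))[]] := thP `|v|.
have : {for v, continuous (th (`|v| + 1))}.
  have [_ /(_ v)[]//] := thP (`|v| + 1).
  by have [v1 v2] := sq v; split; [apply: le_trans v1 _|apply: le_trans v2 _]; rewrite lerDl.
have near_eq : \forall w \near v, th (`|v| + 1) w = th `|w| w.
  apply/nbhs_ballP; exists 1 => //= w; rewrite -ball_normE /= => vw.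
  apply: agree => //.
  have : `|w| <= `|v| + 1.
    rewrite -[w](subrK v) addrC; apply: le_trans (ler_normD _ _) _.
    by rewrite lerD2l distrC ltW.
  by have [w1 w2] := sq w; move=> wv; split; [apply: le_trans w1 wv|apply: le_trans w2 wv].
rewrite /prop_for /continuous_at => H.
rewrite -(nbhs_singleton near_eq).
exact: cvg_trans (near_eq_cvg near_eq) H.
Qed.

End Lifting.

(** * Winding numbers *)

Section Winding.
Context {R : realType}.
Implicit Types (x y : R -> plane R) (w : R).

Lemma lift_line x : continuous x -> (forall t, x t != 0) ->
  exists theta : R -> R, continuous theta /\ forall t, has_arg (x t) (theta t).
Proof.
move=> xc x0.
have [|theta [thc tha]] := @lift_plane R (fun v => x v.1) _ (fun v => x0 v.1).
  by move=> v; cts.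
by exists (fun t => theta (t, 0)); split=> [t|t]; [cts|exact: (tha (t, 0))].
Qed.

(** Loops and arguments live on the whole real line, which avoids subspace topologies; [w] is an
    angle, not a number of turns. *)
Definition winding x w := exists theta : R -> R,
  [/\ continuous theta, forall t, has_arg (x t) (theta t) & theta (2 * pi) = theta 0 + w].

Lemma winding_uniq x w w' : (forall t, x t != 0) -> winding x w -> winding x w' -> w = w'.
Proof.
move=> x0 [b [bc bx bw]] [c [cc cx cw]].
have H : (b (2 * pi) - c (2 * pi)) / (2 * pi) = (b 0 - c 0) / (2 * pi).
  apply: (@int_valued_line R (fun t => (b t - c t) / (2 * pi))) => [t|t]; first by cts.
  exact: has_arg_uniq (bx t) (cx t).
by move/turn_inj: H; rewrite bw cw; lra.
Qed.

(** The principle of Rouche: the angle from [x t] to [y t] never reaches a right angle, and it is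
    the same at both ends of the loop. *)
Lemma winding_dot x y w : continuous x -> continuous y ->
  x (2 * pi) = x 0 -> y (2 * pi) = y 0 -> (forall t, 0 < dot (x t) (y t)) ->
  winding x w -> winding y w.
Proof.
move=> xc yc x2 y2 xy [b [bc bx bw]]; exists (fun t => b t + angle (x t) (y t)); split.
- by move=> t; cfor; apply: contD; [exact: bc|apply: cont_angle => //; [exact: xc|exact: yc]].
- by move=> t; apply: has_arg_angle.
- by rewrite x2 y2 bw; ring.
Qed.

(** An argument lifted over the whole [(s, t)] plane makes the increment over a turn a continuous
    function of [s] with values in whole turns. *)
Lemma winding_homotopy (g : plane R -> plane R) s s' w : continuous g ->
  (forall v, g v != 0) -> (forall s, g (s, 2 * pi) = g (s, 0)) ->
  winding (fun t => g (s, t)) w -> winding (fun t => g (s', t)) w.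
Proof.
move=> gc g0 g2 gw; have [th [thc tha]] := lift_plane gc g0.
pose dl s := th (s, 2 * pi) - th (s, 0).
have gwd s0 : winding (fun t => g (s0, t)) (dl s0).
  exists (fun t => th (s0, t)); split=> [t|t|]; [by cts|exact: tha|].
  by rewrite /dl addrC subrK.
have -> : w = dl s by apply: winding_uniq gw (gwd s).
suff -> : dl s = dl s' by exact: gwd.
apply: turn_inj; apply: (@int_valued_line R (fun s => dl s / (2 * pi))) => [t|t].
  by rewrite /dl; cts.
by apply: (has_arg_uniq (g0 (t, 2 * pi))) => //; rewrite g2.
Qed.

Lemma cis_neq0 (a : R) : cis a != 0.
Proof.
apply/eqP => -[c0 s0]; have := cos2Dsin2 a; rewrite c0 s0 expr0n /= addr0 => /eqP.
by rewrite eq_sym oner_eq0.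
Qed.

Lemma cis_cont : continuous (@cis R).
Proof. by move=> t; rewrite /cis; cts. Qed.

Lemma cis2pi : cis (2 * pi) = cis 0 :> plane R.
Proof. by rewrite /cis mulr_natl cos2pi sin2pi cos0 sin0. Qed.

Lemma winding_cis : winding (@cis R) (2 * pi).
Proof.
exists (fun t => t); split=> [t|t|]; [by cts| |by rewrite add0r].
by rewrite -[cis t]scale1r; exact: has_arg_cis.
Qed.

Lemma rotation_arg (a b : R) v : has_arg v a -> has_arg (rotation b v) (a + b).
Proof.
move=> va; rewrite (_ : rotation b v = enorm v *: cis (a + b)); first exact/has_arg_cis/enorm_ge0.
have [v1 v2] := has_argE va.
by apply: plane_eq; rewrite /= v1 v2 ?cosD ?sinD /GRing.scale /=; ring.
Qed.

Lemma winding_rotation x w (a : R) : winding x w -> winding (fun t => rotation a (x t)) w.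
Proof.
move=> [b [bc bx bw]]; exists (fun t => b t + a); split=> [t|t|]; first by cts.
  exact: rotation_arg.
by rewrite bw; ring.
Qed.

Definition lin (M : 'M[R]_2) (v : plane R) : plane R :=
  (M 0 0 * v.1 + M 0 1 * v.2, M 1 0 * v.1 + M 1 1 * v.2).

Lemma lin_cont M : continuous (lin M).
Proof. by move=> v; rewrite /lin; cts. Qed.

Lemma ord2P (P : 'I_2 -> Prop) : P 0 -> P 1 -> forall i, P i.
Proof.
by move=> P0 P1 [[|[|//]] H]; [rewrite (_ : Ordinal H = 0)|rewrite (_ : Ordinal H = 1)] => //; apply/val_inj.
Qed.

Lemma sum2 (V : nmodType) (F : 'I_2 -> V) : \sum_i F i = F 0 + F 1.
Proof. by rewrite !big_ord_recl big_ord0 addr0; congr (_ + F _); apply/val_inj. Qed.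

Lemma det2 (K : comNzRingType) (M : 'M[K]_2) : \det M = M 0 0 * M 1 1 - M 0 1 * M 1 0.
Proof.
rewrite (expand_det_row _ 0) sum2 /cofactor !det_mx11 !mxE /= expr0 expr1 mul1r mulN1r mulrN.
by congr (_ * M _ _ - _ * M _ _); apply/val_inj.
Qed.

Lemma lin_mul M N v : lin (M *m N) v = lin M (lin N v).
Proof. by apply: plane_eq; rewrite /= !mxE !sum2; ring. Qed.

Lemma lin1 v : lin 1%:M v = v.
Proof. by apply: plane_eq; rewrite /= !mxE /=; ring. Qed.

Lemma linD M u v : lin M (u + v) = lin M u + lin M v.
Proof. by apply: plane_eq; rewrite /=; ring. Qed.

Lemma linN M u : lin M (- u) = - lin M u.
Proof. by apply: plane_eq; rewrite /=; ring. Qed.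

Lemma linB M u v : lin M (u - v) = lin M u - lin M v.
Proof. by rewrite linD linN. Qed.

Lemma linZ M r u : lin M (r *: u) = r *: lin M u.
Proof. by apply: plane_eq; rewrite /= /GRing.scale /=; ring. Qed.

Lemma lin0 M : lin M 0 = 0.
Proof. by apply: plane_eq; rewrite /= !mulr0 addr0. Qed.

Lemma lin_subM M N v : lin (M - N) v = lin M v - lin N v.
Proof. by apply: plane_eq; rewrite /= !mxE; ring. Qed.

Lemma linK M v : \det M != 0 -> lin (invmx M) (lin M v) = v.
Proof. by move=> M0; rewrite -lin_mul mulVmx ?lin1 // unitmxE unitfE. Qed.

Lemma linKV M v : \det M != 0 -> lin M (lin (invmx M) v) = v.
Proof. by move=> M0; rewrite -lin_mul mulmxV ?lin1 // unitmxE unitfE. Qed.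

Lemma lin_neq0 M v : \det M != 0 -> v != 0 -> lin M v != 0.
Proof. by move=> M0; apply: contra_neq => Mv; rewrite -(linK v M0) Mv lin0. Qed.

(* As a real-linear map of the complex plane, M is z |-> alpha z + beta z^*, and
   |alpha|^2 - |beta|^2 = det M; so M z never points opposite to alpha z. *)
Lemma winding_lin M : 0 < \det M -> winding (fun t => lin M (cis t)) (2 * pi).
Proof.
rewrite det2 => M0.
pose al : plane R := (M 0 0 + M 1 1, M 1 0 - M 0 1).
have [a alE] := has_arg_ex al.
apply: (@winding_dot (fun t => enorm al *: rotation a (cis t))).
- move=> t; cfor; apply: cont_plane; rewrite /= /GRing.scale /=; cts; exact: cis_cont.
- by move=> t; rewrite /lin; cts; exact: cis_cont.
- by rewrite cis2pi.
- by rewrite cis2pi.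
- move=> t; have [a1 a2] := has_argE alE.
  rewrite /dot /= /GRing.scale /=.
  have [ec es] : (enorm al * cos a = M 0 0 + M 1 1) /\ (enorm al * sin a = M 1 0 - M 0 1) by split.
  rewrite !mulrBr !mulrDr !mulrA ec es.
  have := cos2Dsin2 t; set c := cos t; set s := sin t => cs1.
  set A := M 0 0 in M0 *; set B := M 0 1 in M0 *; set C := M 1 0 in M0 *; set D := M 1 1 in M0 *.
  have : 0 < (A * D - B * C) * (c ^+ 2 + s ^+ 2) by rewrite cs1 mulr1.
  have := sqr_ge0 (A * c + B * s); have := sqr_ge0 (C * c + D * s).
  by nra.
- have /winding_rotation : winding (@cis R) (2 * pi) := winding_cis.
  move=> /(_ a)[b [bc bx bw]]; exists b; split => // t; apply: has_arg_scale => //.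
  exact: enorm_ge0.
Qed.

(** Reflecting the circle replaces [M] by [N], of positive determinant, and reverses the time of the
    loop. *)
Lemma winding_lin_neg M : \det M < 0 -> winding (fun t => lin M (cis t)) (- (2 * pi)).
Proof.
move=> M0; pose N := \matrix_(i, j) (if j == 0 then M i j else - M i j) : 'M[R]_2.
have [|b [bc bx bw]] := @winding_lin N.
  by move: M0; rewrite !det2 !mxE /= => M0; rewrite mulrN mulNr opprK; lra.
have [c [cc cx cw]] : exists c, [/\ continuous c, forall t, has_arg (lin M (cis t)) (c t) &
   c (- (2 * pi)) = c 0 + 2 * pi].
  exists (fun t => b (- t)); split=> [t|t|]; first by cts.
    rewrite (_ : lin M (cis t) = lin N (cis (- t))) //.
    by apply: plane_eq; rewrite /= !mxE /= cosN sinN; ring.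
  by rewrite opprK bw oppr0.
exists c; split=> //.
(* The argument of a periodic curve grows by the same amount over every period, here [[- 2 pi, 0]]
   and [[0, 2 pi]]. *)
have H : (c (2 * pi) - c 0) / (2 * pi) = (c 0 - c (- (2 * pi))) / (2 * pi).
  pose d t := (c (t + 2 * pi) - c t) / (2 * pi).
  have := @int_valued_line R d _ _ 0 (- (2 * pi)).
  rewrite /d add0r addNr; apply=> t; first by cts.
  have M0' : \det M != 0 by rewrite lt_eqF.
  apply: (has_arg_uniq (lin_neq0 M0' (cis_neq0 t))) => //.
  rewrite -(_ : cis (t + 2 * pi) = cis t) //.
  by apply: cis_int; rewrite addrAC subrr add0r divff ?turn_neq0.
by move/turn_inj: H; rewrite cw; lra.
Qed.

(** [winds_once] provides an argument on [[0, 1]] only; there it differs from a global argument by a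
    constant number of whole turns. *)
Lemma winds_once_winding x c : continuous x -> (forall t, x t != c) ->
  winds_once (fun t => x (2 * pi * t)) c -> winding (fun t => x t - c) (2 * pi).
Proof.
move=> xc xc0 [rho [theta [thc th1 thx]]].
have yc : continuous (fun t => x t - c).
  by move=> t; cfor; apply: cont_plane => /=; cts.
have y0 t : x t - c != 0 by rewrite subr_eq0.
have [b [bc bx]] := lift_line yc y0.
exists b; split => //.
have := @int_valued_path R (fun t => (theta t - b (2 * pi * t)) / (2 * pi)).
rewrite mulr1 mulr0 th1 => H.
have : (theta 0 + 2 * pi - b (2 * pi)) / (2 * pi) = (theta 0 - b 0) / (2 * pi).
  apply: H => [|t t01].
    have sc : {within `[0, 1], continuous (fun s => b (2 * pi * s))}.
      by apply: continuous_subspaceT => s; cts.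
    move=> s; refine (@contM R (subspace `[0 : R, 1]) (fun s => theta s - b (2 * pi * s)) _ s _ (@cont_cst _ _ _ s)).
    exact: (@contD R (subspace `[0 : R, 1]) theta _ s (thc s) (contN (sc s))).
  have [r0 xE] := thx t t01.
  apply: (has_arg_uniq (y0 (2 * pi * t))) => //.
  by rewrite xE addrC addKr; apply: has_arg_cis; exact: ltW.
by move=> /turn_inj; lra.
Qed.

Lemma winding_winds_once x c : (forall t, x t != c) ->
  winding (fun t => x t - c) (2 * pi) -> winds_once (fun t => x (2 * pi * t)) c.
Proof.
move=> xc [b [bc bx bw]].
exists (fun t => enorm (x (2 * pi * t) - c)), (fun t => b (2 * pi * t)); split.
- by apply: continuous_subspaceT => t; cts.
- by rewrite mulr1 mulr0.
- move=> t _; split; first by rewrite enorm_gt0 // subr_eq0.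
  by rewrite -bx addrC subrK.
Qed.

End Winding.

(** * Lifts to polar coordinates *)

Section Polar.
Context {R : realType}.
Implicit Types (G H : plane R -> plane R) (p u v w : plane R).

(** The universal covering of the plane minus [p]: the exponential makes every real an admissible
    [w.1], with [p] at minus infinity, and adding 2 pi to [w.2] is the deck transformation. *)
Definition polar p w : plane R := p + expR w.1 *: cis w.2.

Lemma polar_cont p : continuous (polar p).
Proof.
move=> w; cfor; apply: cont_plane; rewrite /polar /= /GRing.scale /=; cts.
Qed.

Lemma enorm_polar p w : enorm (polar p w - p) = expR w.1.
Proof. by rewrite /polar addrC addKr enorm_cis // ltW // expR_gt0. Qed.

Lemma polar_neq p w : polar p w != p.
Proof.
apply/eqP => wp; have := enorm_polar p w.
by rewrite wp subrr enorm0 => /esym/eqP; rewrite gt_eqF // expR_gt0.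
Qed.

Lemma polarK p v : v != p -> exists w, polar p w = v.
Proof.
move=> vp; have [a va] := has_arg_ex (v - p).
exists (ln (enorm (v - p)), a); rewrite /polar /= lnK; first by rewrite -va addrC subrK.
by rewrite posrE enorm_gt0 // subr_eq0.
Qed.

Lemma has_arg_polar p w : has_arg (polar p w - p) w.2.
Proof. by rewrite /polar addrC addKr; apply: has_arg_cis; rewrite ltW ?expR_gt0. Qed.

Lemma polar_inj p w w' : polar p w = polar p w' ->
  w.1 = w'.1 /\ (w.2 - w'.2) / (2 * pi) \is a Num.int.
Proof.
move=> ww; split.
  by apply: expR_inj; rewrite -!(enorm_polar p) ww.
have := has_arg_polar p w'; rewrite -ww => /(has_arg_uniq _ (has_arg_polar p w)).
by apply; rewrite subr_eq0 polar_neq.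
Qed.

Lemma polar_turn p s t (z : int) : polar p (s, t + 2 * pi * z%:~R) = polar p (s, t).
Proof. by rewrite /polar /= /cis; have [-> ->] := cosDz t z. Qed.

Definition polar_lift p G Gh :=
  continuous Gh /\ forall w, polar p (Gh w) = G (polar p w).

Lemma polar_lift_ex p G : continuous G -> (forall v, v != p -> G v != p) ->
  exists Gh, polar_lift p G Gh.
Proof.
move=> Gc Gp; pose g w := G (polar p w) - p.
have pc := @polar_cont p.
have gc : continuous g.
  by move=> w; cfor; apply: cont_plane; rewrite /g /=; cts.
have g0 w : g w != 0 by rewrite subr_eq0 Gp // polar_neq.
have [th [thc tha]] := lift_plane gc g0.
exists (fun w => (ln (enorm (g w)), th w)); split=> w.
  cfor; apply: cont_pair; last exact: thc.
  by apply: cont_ln; [exact: enorm_gt0|apply: cont_enorm; exact: gc].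
rewrite /polar /= lnK; last by rewrite posrE enorm_gt0.
by rewrite -tha /g addrC subrK.
Qed.

Lemma polar_lift_iter p G Gh j : polar_lift p G Gh -> polar_lift p (iter j G) (iter j Gh).
Proof.
move=> [Ghc GhE]; split.
  elim: j => [|j IH] w; first exact: cont_id.
  by apply: (@cont_comp _ _ _ (iter j Gh) Gh w (@IH w)); exact: Ghc.
by elim: j => [//|j IH] w /=; rewrite GhE IH.
Qed.

Lemma polar_lift_id p Gh : polar_lift p id Gh ->
  exists k : int, forall w, Gh w = (w.1, w.2 + 2 * pi * k%:~R).
Proof.
move=> [Ghc GhE].
have H w : (Gh w).1 = w.1 /\ ((Gh w).2 - w.2) / (2 * pi) \is a Num.int.
  exact: polar_inj (GhE w).
have /intrP[k kE] := (H 0).2; exists k => w.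
have cst : ((Gh w).2 - w.2) / (2 * pi) = k%:~R.
  rewrite -kE; apply: (@int_valued_plane R (fun w => ((Gh w).2 - w.2) / (2 * pi))) => v.
    by cts.
  by have [] := H v.
apply: plane_eq => /=; first by have [] := H w.
by rewrite -cst mulrC divfK ?turn_neq0 // addrC subrK.
Qed.

(** The increment of [eta] over one turn is continuous in the base point with values in whole turns,
    so the circle [s] determines it everywhere. *)
Lemma polar_turn_arg (eta : plane R -> R) H :
  continuous eta -> (forall w, H w != 0) -> (forall s t, H (s, t + 2 * pi) = H (s, t)) ->
  (forall w, has_arg (H w) (eta w)) ->
  forall s w, winding (fun t => H (s, t)) (2 * pi) -> forall z : int,
  eta (w.1, w.2 + 2 * pi * z%:~R) = eta w + 2 * pi * z%:~R.
Proof.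
move=> etac H0 H2 etaH s w wH z.
have step v : eta (v.1, v.2 + 2 * pi) = eta v + 2 * pi.
  pose d v := (eta (v.1, v.2 + 2 * pi) - eta v) / (2 * pi).
  have d1 : d (s, 0) = 1.
    rewrite /d /= add0r (_ : eta (s, 2 * pi) = eta (s, 0) + 2 * pi).
      by rewrite addrAC subrr add0r divff ?turn_neq0.
    suff : eta (s, 2 * pi) - eta (s, 0) = 2 * pi by move/eqP; rewrite subr_eq [X in _ == X]addrC => /eqP.
    apply: (winding_uniq _ _ wH) => //; exists (fun t => eta (s, t)); split=> [t|t|]; first by cts.
      exact: etaH.
    by rewrite addrC subrK.
  have : d v = d (s, 0).
    apply: int_valued_plane => u; first by rewrite /d; cts.
    apply: (has_arg_uniq (H0 u)) => //; rewrite [X in has_arg (H X)](surjective_pairing u) -H2.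
    exact: etaH.
  rewrite d1 /d => /(congr1 (fun x => x * (2 * pi))).
  by rewrite divfK ?turn_neq0 // mul1r => /eqP; rewrite subr_eq [X in _ == X]addrC => /eqP.
have pos (n : nat) v : eta (v.1, v.2 + 2 * pi * n%:R) = eta v + 2 * pi * n%:R.
  elim: n => [|n IH]; first by rewrite mulr0 !addr0 -surjective_pairing.
  have -> : 2 * pi * n.+1%:R = 2 * pi * n%:R + 2 * pi :> R by rewrite -[n.+1%:R]natr1 mulrDr mulr1.
  by rewrite !addrA -IH; exact: (step (v.1, _)).
case: z => n; first exact: pos.
have := pos n.+1 (w.1, w.2 + 2 * pi * (Negz n)%:~R); rewrite /=.
have -> : w.2 + 2 * pi * (Negz n)%:~R + 2 * pi * n.+1%:R = w.2.
  by rewrite NegzE mulrNz mulrN subrK.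
by rewrite -surjective_pairing => ->; rewrite NegzE mulrNz mulrN addrK.
Qed.

(* One end of the punctured plane: [sg = -1] is a punctured neighbourhood of p
   and [sg = 1] a neighbourhood of infinity. If H conjugates G to a rotation
   there, the total angle swept by the orbits of G is known modulo [N] turns. *)
Lemma polar_lift_end p G Gh (N : nat) (k c : int) H (sg s0 : R) :
  (0 < N)%N -> polar_lift p G Gh ->
  (forall w, iter N Gh w = (w.1, w.2 + 2 * pi * k%:~R)) ->
  sg ^+ 2 = 1 ->
  (forall w, s0 <= sg * w.1 -> [/\ {for polar p w, continuous H}, H (polar p w) != 0 &
     H (G (polar p w)) = rotation (2 * pi * c%:~R / N%:R) (H (polar p w))]) ->
  (forall a, exists b, forall w, b <= sg * w.1 -> a <= sg * (Gh w).1) ->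
  (exists2 s, s0 <= sg * s & winding (fun t => H (polar p (s, t))) (2 * pi)) ->
  exists m : int, k = c + N%:Z * m.
Proof.
move=> N0 [Ghc GhE] Ghk sg1 Hs esc [s s0s wH].
set psi := 2 * pi * c%:~R / N%:R in Hs.
have [s1 s01 s1P] : exists2 s1, s0 <= s1 & forall w, s1 <= sg * w.1 -> s0 <= sg * (Gh w).1.
  have [b bP] := esc s0; exists (Num.max s0 b); first by rewrite le_max lexx.
  by move=> w; rewrite ge_max => /andP[_ /bP].
(* [cl a] retracts the plane onto the end [a <= sg * w.1]. Composed with it, [H] becomes continuous
   and nowhere zero on the whole plane, so that [lift_plane] applies. *)
pose cl a (w : plane R) : plane R := (sg * Num.max (sg * w.1) a, w.2).
have clc a : continuous (cl a) by move=> w; rewrite /cl; cts.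
have sgcl a w : sg * (cl a w).1 = Num.max (sg * w.1) a.
  by rewrite /= mulrA -expr2 sg1 mul1r.
have cl_ge a w : a <= sg * (cl a w).1 by rewrite sgcl le_max lexx orbT.
have cl_id a w : a <= sg * w.1 -> cl a w = w.
  by move=> aw; apply: plane_eq => //=; rewrite max_l // mulrA -expr2 sg1 mul1r.
pose K w := H (polar p (cl s0 w)).
have Kc : continuous K.
  move=> w; have [Hc _ _] := Hs _ (cl_ge s0 w).
  apply: (@cont_comp _ _ _ (fun w => polar p (cl s0 w)) H w _ Hc).
  apply: (@cont_comp _ _ _ (cl s0) (polar p) w (@clc s0 w)); exact: polar_cont.
have K0 w : K w != 0 by have [] := Hs _ (cl_ge s0 w).
have [eta [etac etaK]] := lift_plane Kc K0.
have turn := @polar_turn_arg eta K etac K0 _ etaK.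
have {}turn w : eta (w.1, w.2 + 2 * pi * k%:~R) = eta w + 2 * pi * k%:~R.
  apply: (turn _ s).
    by move=> s' t; rewrite /K /cl /=; rewrite -[X in t + X]mulr1 (polar_turn _ _ _ 1).
  by rewrite /K; under eq_fun do rewrite cl_id //.
(* [eta] is the angle in which [G] acts as the rotation by [psi]; [mu] counts the extra whole turns
   made by one step of [Gh]. *)
pose mu w := (eta (Gh (cl s1 w)) - eta (cl s1 w) - psi) / (2 * pi).
have muc : continuous mu.
  by have c1 := @clc s1; move=> w; rewrite /mu; cts.
have cl10 w : cl s0 (cl s1 w) = cl s1 w.
  by apply: cl_id; apply: le_trans (cl_ge _ _).
have muz w : mu w \is a Num.int.
  rewrite /mu; rewrite -addrA -opprD.
  apply: (has_arg_uniq (K0 (Gh (cl s1 w)))); first exact: etaK.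
  have -> : K (Gh (cl s1 w)) = rotation psi (K (cl s1 w)).
    rewrite /K cl_id; last by apply: s1P; exact: cl_ge.
    by rewrite GhE cl10; have [_ _] := Hs (cl s1 w) (le_trans s01 (cl_ge _ _)).
  by apply: rotation_arg; exact: etaK.
have /intrP[m mE] := muz 0; exists m.
have muE w : s1 <= sg * w.1 -> eta (Gh w) = eta w + (psi + 2 * pi * m%:~R).
  move=> ws; have := @int_valued_plane R mu muc muz w 0.
  rewrite mE /mu cl_id // => /(congr1 (fun x => x * (2 * pi))).
  by rewrite divfK ?turn_neq0 // => e; rewrite [2 * pi * _]mulrC -e; ring.
(* Starting far enough into the end, all [N] steps stay where [muE] is valid. *)
have [b bP] : exists b, forall j, (j <= N)%N -> forall w, b <= sg * w.1 -> s1 <= sg * (iter j Gh w).1.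
  elim: (N) => [|J [b bP]]; first by exists s1 => j; rewrite leqn0 => /eqP ->.
  have [b' b'P] := esc b; exists (Num.max b b') => j jJ w; rewrite ge_max => /andP[bw b'w].
  case: j jJ => [|j] jJ; first exact: bP.
  by rewrite iterSr; apply: bP => //; exact: b'P.
pose w0 : plane R := (sg * b, 0).
have w0b : b <= sg * w0.1 by rewrite /= mulrA -expr2 sg1 mul1r.
have itE j : (j <= N)%N -> eta (iter j Gh w0) = eta w0 + j%:R * (psi + 2 * pi * m%:~R).
  elim: j => [|j IH] jN; first by rewrite mul0r addr0.
  by rewrite iterS muE ?IH ?(ltnW jN) //; [rewrite -[j.+1%:R]natr1; ring|apply: bP => //; exact: ltnW].
(* Summing the [N] steps gives [2 pi k = N (psi + 2 pi m)], where [N psi = 2 pi c]. *)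
have := itE N (leqnn N); rewrite Ghk turn => /addrI.
have NR : N%:R != 0 :> R by rewrite pnatr_eq0 -lt0n.
move=> e; have : k%:~R = c%:~R + N%:R * m%:~R :> R.
  by apply: (mulfI turn_neq0); rewrite e /psi; field.
by rewrite -[N%:R]/(N%:Z%:~R) -intrM -intrD => /intr_inj.
Qed.

End Polar.

(** * Maps at bounded distance from a linear map *)

Section NearLinear.
Context {R : realType}.
Implicit Types (G H : plane R -> plane R) (M P B : 'M[R]_2) (p u v : plane R).

Lemma norm_plane u : `|u| = Num.max `|u.1| `|u.2|.
Proof. by []. Qed.

Lemma norm_fst u : `|u.1| <= `|u|.
Proof. by rewrite norm_plane le_max lexx. Qed.

Lemma norm_snd u : `|u.2| <= `|u|.
Proof. by rewrite norm_plane le_max lexx orbT. Qed.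

Lemma norm_le u (C : R) : (`|u| <= C) = (`|u.1| <= C) && (`|u.2| <= C).
Proof. by rewrite norm_plane ge_max. Qed.

Lemma enorm_le u : enorm u <= 2 * `|u|.
Proof.
rewrite -(@ler_pXn2r _ 2) ?nnegrE ?enorm_ge0 ?mulr_ge0 ?normr_ge0 // enormE /dot.
have u1 := norm_fst u; have u2 := norm_snd u.
rewrite -!expr2 -(real_normK (num_real u.1)) -(real_normK (num_real u.2)).
have := normr_ge0 u.1; have := normr_ge0 u.2; nra.
Qed.

Lemma norm_le_enorm u : `|u| <= enorm u.
Proof.
have := enormE u; rewrite /dot -!expr2 => e2.
rewrite norm_le -!(@ler_pXn2r _ 2 _ `|_|) ?nnegrE ?enorm_ge0 ?normr_ge0 //.
rewrite !real_normK ?num_real // e2.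
by rewrite lerDl lerDr !sqr_ge0.
Qed.

(** With [d = v - u], [dot u u] is at least the square of the sup norm of [u], while [dot u d] is
    bounded by twice the product of the sup norms; hence the factor 2. *)
Lemma dot_close u v : 2 * `|v - u| < `|u| -> 0 < dot u v.
Proof.
move=> uv; pose d := v - u; have vE : v = u + d by rewrite addrC subrK.
have d1 := norm_fst d; have d2 := norm_snd d; have u1 := norm_fst u; have u2 := norm_snd u.
have -> : dot u v = dot u u + (u.1 * d.1 + u.2 * d.2) by rewrite vE /dot /=; ring.
have Hm (x y : R) : `|x| <= `|u| -> `|y| <= `|d| -> - (`|u| * `|d|) <= x * y.
  move=> xu yd; rewrite lerNl -mulNr; apply: le_trans (ler_norm _) _.
  by rewrite normrM normrN ler_pM.
have e1 := Hm _ _ u1 d1; have e2 := Hm _ _ u2 d2.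
have uu : `|u| ^+ 2 <= dot u u.
  by rewrite -enormE ler_pXn2r ?nnegrE ?enorm_ge0 ?normr_ge0 // norm_le_enorm.
rewrite -/d in uv; have d0 := normr_ge0 d.
by move: uu; rewrite expr2; nra.
Qed.

Lemma lin_bound M : exists2 K : R, 0 < K & forall v, `|lin M v| <= K * `|v|.
Proof.
exists (`|M 0 0| + `|M 0 1| + `|M 1 0| + `|M 1 1| + 1).
  by rewrite ltr_wpDl // !addr_ge0.
move=> v; have v1 := norm_fst v; have v2 := norm_snd v.
have Hm (a b : R) : `|a * v.1 + b * v.2| <= (`|a| + `|b|) * `|v|.
  apply: le_trans (ler_normD _ _) _; rewrite !normrM mulrDl lerD //.
    by rewrite ler_wpM2l.
  by rewrite ler_wpM2l.
rewrite norm_le; apply/andP; split; apply: le_trans (Hm _ _) _; rewrite ler_wpM2r //.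
  by have := normr_ge0 (M 1 0); have := normr_ge0 (M 1 1); lra.
have := normr_ge0 (M 0 0); have := normr_ge0 (M 0 1); lra.
Qed.

Definition bounded_map (f : plane R -> plane R) := exists C : R, forall v, `|f v| <= C.

Lemma bounded_map_add f g : bounded_map f -> bounded_map g -> bounded_map (fun v => f v + g v).
Proof.
move=> [C fC] [D gD]; exists (C + D) => v.
by apply: le_trans (ler_normD _ _) _; rewrite lerD.
Qed.

Lemma bounded_map_cst u : bounded_map (fun=> u).
Proof. by exists `|u|. Qed.

Lemma bounded_map_sum n (f : 'I_n -> plane R -> plane R) :
  (forall i, bounded_map (f i)) -> bounded_map (fun v => \sum_i f i v).
Proof.
move=> /choice[C fC]; exists (\sum_i C i) => v.
by apply: le_trans (ler_norm_sum _ _ _) _; exact: ler_sum.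
Qed.

Lemma bounded_map_lin M f : bounded_map f -> bounded_map (fun v => lin M (f v)).
Proof.
have [K K0 MK] := lin_bound M; move=> [C fC]; exists (K * C) => v.
by apply: le_trans (MK _) _; rewrite ler_pM2l.
Qed.

Lemma bounded_map_comp f (h : plane R -> plane R) : bounded_map f -> bounded_map (fun v => f (h v)).
Proof. by move=> [C fC]; exists C => v. Qed.

Lemma bounded_map_eq f g : f =1 g -> bounded_map f -> bounded_map g.
Proof. by move=> fg [C fC]; exists C => v; rewrite -fg. Qed.

Definition near_lin G M := bounded_map (fun v => G v - lin M v).

Lemma near_lin_iter G M j : near_lin G M -> near_lin (iter j G) (M ^+ j).
Proof.
move=> GM; elim: j => [|j IH].
  by apply: bounded_map_eq (bounded_map_cst 0) => v /=; rewrite expr0 lin1 subrr.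
apply: bounded_map_eq (bounded_map_add (bounded_map_comp (iter j G) GM) (bounded_map_lin M IH)) => v /=.
by rewrite linB addrA subrK exprS -mulmxE lin_mul.
Qed.

Lemma winding_scale (x : R -> plane R) (r w : R) : 0 < r -> winding x w ->
  winding (fun t => r *: x t) w.
Proof.
by move=> r0 [b [bc bx bw]]; exists b; split=> // t; apply: has_arg_scale => //; exact: ltW.
Qed.

Lemma polar2pi p s : polar p (s, 2 * pi) = polar p (s, 0) :> plane R.
Proof. by rewrite /polar /= cis2pi. Qed.

(** On a large circle the linear part outgrows the bounded error because [M] is invertible, and
    [winding_dot] compares the two loops. *)
Lemma winding_far H M p w : continuous H -> near_lin H M -> \det M != 0 ->
  winding (fun t => lin M (cis t)) w ->
  exists s0, forall s, s0 <= s -> (forall t, H (polar p (s, t)) != 0) /\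
    winding (fun t => H (polar p (s, t))) w.
Proof.
move=> Hc HM M0 Mw; have [K K0 MK] := lin_bound (invmx M).
have [C CP] := bounded_map_add HM (bounded_map_cst (lin M p)).
have C0 : 0 <= C by apply: le_trans (CP 0).
(* On the circle of radius [r] the linear part [X] satisfies [r <= 2 K |X|], so [4 K C + 1 <= r]
   forces [2 C < |X|], as [dot_close] requires for an error of at most [C]. *)
exists (ln (4 * K * C + 1)) => s s0.
have es : 4 * K * C + 1 <= expR s.
  rewrite -[X in X <= _]lnK; first by rewrite ler_expR.
  by rewrite posrE ltr_wpDl // !mulr_ge0 // ltW.
pose X t := expR s *: lin M (cis t).
have dotX t : 0 < dot (X t) (H (polar p (s, t))).
  apply: dot_close.
  have -> : H (polar p (s, t)) - X t = H (polar p (s, t)) - lin M (polar p (s, t)) + lin M p.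
    by rewrite /X /polar linD linZ /= opprD addrA addrAC subrK.
  apply: (@le_lt_trans _ _ (2 * C)); first by rewrite ler_pM2l // CP.
  have XE : lin (invmx M) (X t) = expR s *: cis t by rewrite /X linZ linK.
  have := MK (X t); rewrite XE => XK.
  have := enorm_le (expR s *: cis t); rewrite enorm_cis ?expR_ge0 // => e2.
  have : 4 * K * C + 1 <= 2 * (K * `|X t|) by apply: le_trans es (le_trans e2 _); rewrite ler_pM2l.
  by rewrite -(ltr_pM2l K0); nra.
split=> [t|]; first by have [] := dot_neq0 (dotX t).
have pc := @polar_cont R p; have cc := @cis_cont R; have lc := @lin_cont R M.
apply: (winding_dot _ _ _ _ dotX).
- move=> t; cfor; apply: cont_plane; rewrite /X /GRing.scale /= /GRing.scale /=; cts.
- by move=> t; cfor; cts.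
- by rewrite /X cis2pi.
- by rewrite polar2pi.
- by apply: winding_scale => //; exact: expR_gt0.
Qed.

(** [v] is the image of [G v] under [G^(N-1)], which is near a linear map; so if [G v] stays
    bounded, then [v] does too. *)
Lemma escape G M N p (T : R) : near_lin G M -> (0 < N)%N -> iter N G =1 id ->
  exists T' : R, forall v, T' <= enorm (v - p) -> T <= enorm (G v - p).
Proof.
case: N => // N /(near_lin_iter N)[C CP] _ GN.
have [K K0 MK] := lin_bound (M ^+ N).
exists (2 * (C + K * (`|T| + `|p|) + `|p|) + 1) => v Tv; rewrite leNgt; apply/negP => GT.
have vE : iter N G (G v) = v by rewrite -iterSr.
have G1 : `|G v| <= `|T| + `|p|.
  rewrite -[G v](subrK p); apply: le_trans (ler_normD _ _) _; rewrite lerD2r.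
  by apply: le_trans (norm_le_enorm _) _; apply: le_trans (ltW GT) (ler_norm _).
have v1 : `|v| <= C + K * (`|T| + `|p|).
  have := CP (G v); rewrite vE => v2.
  rewrite -[X in `|X|](subrK (lin (M ^+ N) (G v))); apply: le_trans (ler_normD _ _) _.
  by apply: lerD => //; apply: le_trans (MK _) _; rewrite ler_pM2l.
have := le_trans Tv (enorm_le _); apply/negP; rewrite -ltNge.
have : `|v - p| <= `|v| + `|p| by rewrite -[`|p|]normrN; exact: ler_normD.
lra.
Qed.

Lemma rotationD (a b : R) v : rotation a (rotation b v) = rotation (a + b) v.
Proof. by apply: plane_eq; rewrite /= cosD sinD; ring. Qed.

Lemma rotation_int (z : int) v : rotation (2 * pi * z%:~R) v = v.
Proof.
have [c s] := @cosDz R 0 z; rewrite !add0r cos0 sin0 in c s.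
by apply: plane_eq; rewrite /= c s; ring.
Qed.

Lemma rotation0 v : rotation 0 v = v.
Proof. by have := rotation_int 0 v; rewrite mulr0. Qed.

Definition rotmx (a : R) : 'M[R]_2 :=
  \matrix_(i, j) if i == 0 then (if j == 0 then cos a else - sin a)
                 else (if j == 0 then sin a else cos a).

Lemma rotationE (a : R) v : rotation a v = lin (rotmx a) v.
Proof. by apply: plane_eq; rewrite /= !mxE /=; ring. Qed.

Lemma lin_cont_comp M (f : plane R -> plane R) : continuous f -> continuous (fun v => lin M (f v)).
Proof. by move=> fc v; have lc := @lin_cont R M; cfor; cts. Qed.

Lemma iter_cont G j : continuous G -> continuous (iter j G).
Proof.
move=> Gc; elim: j => [|j IH] v; first exact: cont_id.
by apply: (@cont_comp _ _ _ (iter j G) G v (@IH v)); exact: Gc.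
Qed.

Lemma sum_cont n (f : 'I_n -> plane R -> plane R) :
  (forall i, continuous (f i)) -> continuous (fun v => \sum_i f i v).
Proof.
move=> fc; elim: n f fc => [|n IH] f fc v.
  by rewrite (_ : (fun _ => _) = fun=> 0); [exact: cont_cst|apply/funext => u; rewrite big_ord0].
rewrite (_ : (fun _ => _) = fun u => f ord0 u + \sum_i f (lift ord0 i) u); last first.
  by apply/funext => u; rewrite big_ord_recl.
have c1 := IH (fun i => f (lift ord0 i)) (fun i => @fc _); have c2 := @fc ord0.
by cfor; apply: cont_plane => /=; cts.
Qed.

Lemma lin_sum M n (f : 'I_n -> plane R) : lin M (\sum_i f i) = \sum_i lin M (f i).
Proof. by apply: (big_morph (lin M)); [exact: linD|exact: lin0]. Qed.

Lemma linZM M (a : R) v : lin (a *: M) v = a *: lin M v.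
Proof. by apply: plane_eq; rewrite /= !mxE /GRing.scale /=; ring. Qed.

Lemma cyclic_sum (V : zmodType) n (T : nat -> V) : T n = T 0%N ->
  \sum_(j < n) T j.+1 = \sum_(j < n) T j.
Proof.
move=> Tn; apply: (addrI (T 0%N)).
transitivity (\sum_(j < n.+1) T j); first by rewrite big_ord_recl.
by rewrite big_ord_recr /= Tn addrC.
Qed.

(* Averaging [rotation^-j \o P \o G^j] gives a map at bounded distance from a
   multiple of P which conjugates G to the rotation exactly. *)
Lemma average_conj G B P (N : nat) (c : int) :
  continuous G -> (0 < N)%N -> iter N G =1 id -> near_lin G B ->
  (forall v, lin P (lin B v) = rotation (2 * pi * c%:~R / N%:R) (lin P v)) ->
  exists H, [/\ continuous H, near_lin H (N%:R *: P) &
    forall v, H (G v) = rotation (2 * pi * c%:~R / N%:R) (H v)].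
Proof.
move=> Gc N0 GN GB PB; set psi := _ / _ in PB *.
have NR : N%:R != 0 :> R by rewrite pnatr_eq0 -lt0n.
pose T (j : nat) v := rotation (- (j%:R * psi)) (lin P (iter j G v)).
exists (fun v => \sum_(j < N) T j v); split.
- apply: sum_cont => j; rewrite /T; under eq_fun do rewrite rotationE.
  by apply: lin_cont_comp; apply: lin_cont_comp; exact: iter_cont.
- have PBj j v : lin P (lin (B ^+ j) v) = rotation (j%:R * psi) (lin P v).
    elim: j => [|j IH]; first by rewrite expr0 lin1 mul0r rotation0.
    rewrite exprS -mulmxE lin_mul PB IH rotationD -[j.+1%:R]natr1; by rewrite mulrDl mul1r addrC.
  have TB (j : 'I_N) : bounded_map (fun v => T j v - lin P v).
    have := bounded_map_lin (rotmx (- (j%:R * psi))) (bounded_map_lin P (near_lin_iter j GB)).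
    by apply: bounded_map_eq => v; rewrite linB PBj linB -!rotationE rotationD addNr rotation0.
  apply: bounded_map_eq (bounded_map_sum TB) => v; rewrite big_split /= sumrN sumr_const card_ord.
  by rewrite linZM scaler_nat.
- move=> v; rewrite rotationE lin_sum.
  have TG j : T j (G v) = lin (rotmx psi) (T j.+1 v).
    rewrite /T -iterSr -rotationE rotationD; congr (rotation _ _); by rewrite -[j.+1%:R]natr1 mulrDl mul1r opprD addrC subrK.
  under eq_bigr do rewrite TG.
  have TN : T N v = T 0%N v.
    rewrite /T GN /= mul0r oppr0.
    have -> : - (N%:R * psi) = 2 * pi * (- c)%:~R by rewrite mulrNz /psi; field.
    by rewrite rotation_int rotation0.
  by rewrite -!lin_sum; congr lin; exact: (@cyclic_sum _ N (fun j => T j v)).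
Qed.

End NearLinear.

(** * Periodic homeomorphisms of the plane *)

Section PlaneMaps.
Context {R : realType}.
Implicit Types (F G H K : plane R -> plane R) (A B M P : 'M[R]_2) (p u v w : plane R).

Lemma plane_sub_cont G p : continuous G -> continuous (fun v => G v - p).
Proof. by move=> Gc v; cfor; apply: cont_plane => /=; cts. Qed.

Lemma near_lin_sub G M p : near_lin G M -> near_lin (fun v => G v - p) M.
Proof.
move=> GM; have := bounded_map_add GM (bounded_map_cst (- p)).
by apply: bounded_map_eq => v; rewrite addrAC.
Qed.

Lemma near_lin_zero K M : continuous K -> near_lin K M -> 0 < \det M -> exists v, K v = 0.
Proof.
move=> Kc KM M0; apply/not_existsP => K0.
have K0' v : K v != 0 by apply/eqP; exact: K0.
have [th [thc tha]] := lift_plane Kc K0'.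
have [s0 /(_ s0 (lexx _))[_ w]] := winding_far 0 Kc KM (lt0r_neq0 M0) (winding_lin M0).
have : winding (fun t => K (polar 0 (s0, t))) 0.
  exists (fun t => th (polar 0 (s0, t))); split=> [t|t|]; last by rewrite addr0 polar2pi.
    by have pc := @polar_cont R 0; cts.
  exact: tha.
move=> /(winding_uniq (fun t => K0' (polar 0 (s0, t))) w) /eqP.
by rewrite (negbTE turn_neq0).
Qed.

(** Extracts from the germ condition [preserves_orientation_at] a single circle, of logarithmic
    radius [s], inside the domain where [H] is controlled. *)
Lemma small_circle H p (e : R) : 0 < e ->
  (forall v, v != p -> enorm (v - p) < e -> {for v, continuous H} /\ H v != H p) ->
  preserves_orientation_at H p ->
  exists2 s, expR s < e & winding (fun t => H (polar p (s, t)) - H p) (2 * pi).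
Proof.
move=> e0 He Hp; have [r [[r0 re] rw]] :=
  filter_ex (filterI (filterI (nbhs_right_gt (0 : R)) (nbhs_right_lt e0)) Hp).
have rs : expR (ln r) = r by rewrite lnK // posrE.
exists (ln r); first by rewrite rs.
have pe t : enorm (polar p (ln r, t) - p) < e by rewrite enorm_polar rs.
apply: winds_once_winding.
- move=> t; have [Hc _] := He _ (polar_neq p _) (pe t).
  apply: (@cont_comp _ _ _ (fun t => polar p (ln r, t)) H t _ Hc).
  by have pc := @polar_cont R p; cts.
- by move=> t; have [] := He _ (polar_neq p _) (pe t).
- by rewrite /polar /= rs.
Qed.

(** By injectivity [F v - F u] has no zero off [u], so it winds equally on small and large circles:
    once positively near [u], and once negatively at infinity if the determinant were negative. *)
Lemma orientation_det F A u : continuous F -> injective F -> near_lin F A -> \det A != 0 ->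
  preserves_orientation_at F u -> 0 < \det A.
Proof.
move=> Fc Fi FA A0 Fu; rewrite lt0r A0 leNgt; apply/negP => An.
have [s _ ws] : exists2 s, expR s < 1 & winding (fun t => F (polar u (s, t)) - F u) (2 * pi).
  apply: small_circle => // v vu _; split; first exact: Fc.
  by apply: contra_neq vu => /Fi.
have [s0 /(_ s0 (lexx _))[_ w0]] :=
  winding_far u (@plane_sub_cont F (F u) Fc) (@near_lin_sub F A (F u) FA) A0 (winding_lin_neg An).
pose g w := F (polar u w) - F u.
have pc := @polar_cont R u.
have gc : continuous g by move=> w; cfor; apply: cont_plane; rewrite /g /=; cts.
have g0 w : g w != 0.
  by rewrite subr_eq0; apply/eqP => /Fi/eqP; rewrite (negbTE (polar_neq _ _)).
have ws0 := @winding_homotopy R g s s0 _ gc g0 (fun s => congr1 (fun v => F v - F u) (polar2pi u s)) ws.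
have := winding_uniq (fun t => g0 (s0, t)) ws0 w0.
by have := @turn_gt0 R; lra.
Qed.

Section PeriodicMap.
Variables (G : plane R -> plane R) (B P : 'M[R]_2) (p : plane R) (N : nat) (c : int).
Hypotheses (Gc : continuous G) (Gp : G p = p) (N0 : (0 < N)%N) (GN : iter N G =1 id).
Hypotheses (GB : near_lin G B) (P0 : 0 < \det P).
Hypothesis PB : forall v, lin P (lin B v) = rotation (2 * pi * c%:~R / N%:R) (lin P v).

Lemma periodic_inj : injective G.
Proof.
by move=> u v uv; rewrite -(GN u) -(GN v) -(prednK N0) !iterSr uv.
Qed.

Lemma periodic_polar_lift : exists Gh (k : int), polar_lift p G Gh /\
  forall w, iter N Gh w = (w.1, w.2 + 2 * pi * k%:~R).
Proof.
have [|Gh GhE] := @polar_lift_ex R p G (@Gc).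
  by move=> v; apply: contra_neq; rewrite -[X in _ = X]Gp => /periodic_inj.
have := polar_lift_iter N GhE; rewrite (_ : iter N G = id); last exact/funext.
by move=> /polar_lift_id[k kE]; exists Gh, k.
Qed.

Variables (Gh : plane R -> plane R) (k : int).
Hypotheses (GhE : polar_lift p G Gh)
  (Ghk : forall w, iter N Gh w = (w.1, w.2 + 2 * pi * k%:~R)).

Lemma polar_lift_norm w : expR (Gh w).1 = enorm (G (polar p w) - p).
Proof. by rewrite -(proj2 GhE) enorm_polar. Qed.

(** The end [sg = 1]: [average_conj] supplies the exact conjugacy and [escape] keeps the orbits near
    infinity. *)
Lemma turn_infinity : exists m : int, k = c + N%:Z * m.
Proof.
have [H [Hc HP HG]] := average_conj (@Gc) N0 GN GB PB.
have NP0 : 0 < \det (N%:R *: P) by rewrite detZ mulr_gt0 // exprn_gt0 // ltr0n.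
have [s0 s0P] := winding_far p Hc HP (lt0r_neq0 NP0) (winding_lin NP0).
apply: (@polar_lift_end R p G Gh N k c H 1 s0) => //.
- by rewrite expr1n.
- move=> w; rewrite mul1r => /s0P[/(_ w.2)]; rewrite -surjective_pairing => Hw _.
  by split=> //; exact: Hc.
- move=> a; have [b bP] := escape p (expR a) GB N0 GN; exists (ln (Num.max b 1)) => w.
  rewrite !mul1r => ww; have : Num.max b 1 <= expR w.1.
    by rewrite -[X in X <= _]lnK ?ler_expR // posrE lt_max ltr01 orbT.
  rewrite ge_max => /andP[bw _]; rewrite -ler_expR polar_lift_norm.
  by apply: bP; rewrite enorm_polar.
- by exists s0; [rewrite mul1r|have [] := s0P s0 (lexx _)].
Qed.

(** The end [sg = -1]: continuity of [G] at its fixed point [p] keeps short orbits inside the domain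
    of [H]. *)
Lemma turn_local H (d : int) (e : R) : 0 < e -> H p = 0 ->
  (forall v, v != p -> enorm (v - p) < e -> [/\ {for v, continuous H}, H v != 0 &
     H (G v) = rotation (2 * pi * d%:~R / N%:R) (H v)]) ->
  preserves_orientation_at H p -> exists m : int, k = d + N%:Z * m.
Proof.
move=> e0 Hp He Ho.
have [|s se ws] := @small_circle H p e e0 _ Ho.
  by move=> v vp ve; rewrite Hp; have [] := He v vp ve.
apply: (@polar_lift_end R p G Gh N k d H (-1) (- s)) => //.
- by rewrite sqrrN expr1n.
- move=> w; rewrite mulN1r lerN2 => ws'; apply: He; first exact: polar_neq.
  by rewrite enorm_polar; apply: le_lt_trans se; rewrite ler_expR.
- move=> a; have : {for p, continuous (fun v => enorm (G v - p))}.
    by apply: cont_enorm; exact: (@plane_sub_cont G p (@Gc)).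
  rewrite /prop_for /continuous_at /= Gp subrr enorm0 => /cvgr_lt/(_ (expR (- a)) (expR_gt0 _)).
  move=> /nbhs_ballP[d' /= d0 dP]; exists (- ln (d' / 2)) => w.
  have d2 : 0 < d' / 2 by rewrite divr_gt0.
  rewrite !mulN1r lerN2 => ww; have wd : expR w.1 <= d' / 2.
    by rewrite -[X in _ <= X]lnK ?ler_expR // posrE.
  rewrite lerNr -ler_expR polar_lift_norm ltW //; apply: dP.
  rewrite -ball_normE /= distrC; apply: le_lt_trans (norm_le_enorm _) _.
  by rewrite enorm_polar; apply: le_lt_trans wd _; lra.
- exists s; first by rewrite mulN1r.
  by under eq_fun do rewrite -[H _]subr0 -Hp.
Qed.

(** In polar coordinates [Gh] moves a point over [q] by [l] whole turns; since [Gh] commutes with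
    whole turns, [N] steps make [N l] of them. *)
Lemma turn_fixed q : 0 < \det B -> q != p -> G q = q -> exists m : int, k = N%:Z * m.
Proof.
move=> B0 qp Gq; have [w0 w0E] := polarK qp.
have [Ghc GhP] := GhE.
pose g w := G (polar p w) - p.
have pc := @polar_cont R p.
have gc : continuous g by move=> w; cfor; apply: cont_plane; rewrite /g /=; cts; exact: Gc.
have g0 w : g w != 0.
  by rewrite subr_eq0 -[X in _ != X]Gp (inj_eq periodic_inj) polar_neq.
have ga w : has_arg (g w) (Gh w).2 by rewrite /g -GhP; exact: has_arg_polar.
have [s0 /(_ s0 (lexx _))[_ ws]] := winding_far p (@plane_sub_cont G p (@Gc))
  (@near_lin_sub G B p GB) (lt0r_neq0 B0) (winding_lin B0).
(* [G v - p] winds once on large circles because [B] has positive determinant, hence on all circles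
   around [p]. *)
have turn : forall w (z : int), (Gh (w.1, w.2 + 2 * pi * z%:~R)) = ((Gh w).1, (Gh w).2 + 2 * pi * z%:~R).
  move=> w z; apply: plane_eq => /=.
    have := GhP (w.1, w.2 + 2 * pi * z%:~R).
    by rewrite polar_turn -surjective_pairing -GhP => /polar_inj[].
  apply: (@polar_turn_arg R (fun w => (Gh w).2) g _ g0 _ ga s0) => //.
    by move=> v; cts.
  by move=> s t; rewrite /g -[X in t + X]mulr1 (polar_turn _ _ _ 1).
have [e1 e2] : (Gh w0).1 = w0.1 /\ ((Gh w0).2 - w0.2) / (2 * pi) \is a Num.int.
  by apply: (@polar_inj _ p); rewrite GhP w0E.
have /intrP[l lE] := e2; exists l.
have Gw0 : Gh w0 = (w0.1, w0.2 + 2 * pi * l%:~R).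
  apply: plane_eq => //=.
  by rewrite -lE mulrC divfK ?turn_neq0 // addrC subrK.
have it j : iter j Gh w0 = (w0.1, w0.2 + 2 * pi * (j%:Z * l)%:~R).
  elim: j => [|j IH]; first by rewrite mul0r mulr0 addr0 -surjective_pairing.
  rewrite iterS IH turn Gw0; congr pair => /=.
  have -> : j.+1%:Z * l = l + j%:Z * l by rewrite -addn1 PoszD mulrDl mul1r addrC.
  by rewrite intrD; ring.
have := it N; rewrite Ghk => -[] /addrI /(mulfI turn_neq0) /intr_inj.
by [].
Qed.

End PeriodicMap.

Theorem periodic_local_rotation G B P p N (c d : int) H (e : R) :
  continuous G -> G p = p -> (0 < N)%N -> iter N G =1 id -> near_lin G B -> 0 < \det P ->
  (forall v, lin P (lin B v) = rotation (2 * pi * c%:~R / N%:R) (lin P v)) ->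
  0 < e -> H p = 0 ->
  (forall v, v != p -> enorm (v - p) < e -> [/\ {for v, continuous H}, H v != 0 &
     H (G v) = rotation (2 * pi * d%:~R / N%:R) (H v)]) ->
  preserves_orientation_at H p -> exists m : int, c = d + N%:Z * m.
Proof.
move=> Gc Gp N0 GN GB P0 PB e0 Hp He Ho.
have [Gh [k [GhE Ghk]]] := periodic_polar_lift Gc Gp N0 GN.
have [m mE] := turn_infinity Gc N0 GN GB P0 PB GhE Ghk.
have [m' mE'] := turn_local Gc Gp N0 GhE Ghk e0 Hp He Ho.
by exists (m' - m); rewrite mulrBr addrA -mE' mE addrK.
Qed.

Theorem periodic_fixed_unique G B P p q N (c : int) :
  continuous G -> G p = p -> G q = q -> (0 < N)%N -> iter N G =1 id -> near_lin G B ->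
  0 < \det B -> 0 < \det P ->
  (forall v, lin P (lin B v) = rotation (2 * pi * c%:~R / N%:R) (lin P v)) ->
  ~ (exists m : int, c = N%:Z * m) -> q = p.
Proof.
move=> Gc Gp Gq N0 GN GB B0 P0 PB cN; apply/eqP; apply: contra_notT cN => qp.
have [Gh [k [GhE Ghk]]] := periodic_polar_lift Gc Gp N0 GN.
have [m mE] := turn_infinity Gc N0 GN GB P0 PB GhE Ghk.
have [m' mE'] := turn_fixed Gc Gp N0 GN GB GhE Ghk B0 qp Gq.
by exists (m' - m); rewrite mulrBr -mE' mE addrK.
Qed.

End PlaneMaps.

(** * Lifts of torus maps *)

Section TorusLift.
Context {R : realType}.
Implicit Types (u v w k : plane R) (f : torus R -> torus R) (F G : plane R -> plane R).
Implicit Types (A B : 'M[R]_2).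

Definition lattice v : bool := (v.1 \is a Num.int) && (v.2 \is a Num.int).

Lemma latticeN u : lattice u -> lattice (- u).
Proof. by move=> /andP[u1 u2]; apply/andP; split; rewrite /= rpredN. Qed.

Lemma lattice0 : lattice (0 : plane R).
Proof. by rewrite /lattice /= rpred0. Qed.

Lemma lattice_small k : lattice k -> `|k| < 1 -> k = 0.
Proof.
have small (y : R) : `|y| < 1 -> y \is a Num.int -> y = 0.
  move=> y1 /intrP[z zE]; move: y1; rewrite zE -intr_norm (ltr_int R _ 1) => z1.
  by have -> : z = 0 by lia.
move=> /andP[k1 k2] k0; apply: plane_eq; apply: small => //.
  by apply: le_lt_trans k0; exact: norm_fst.
by apply: le_lt_trans k0; exact: norm_snd.
Qed.

Lemma torus_projE u v : (torus_proj u = torus_proj v) <-> lattice (u - v).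
Proof.
have r : reflect (torus_proj u = torus_proj v) (lattice (u - v)) :=
  @eqmodP _ (lattice_equiv R) u v.
by split=> [uv|uv]; [apply/r|move/r: uv].
Qed.

Lemma torus_projK (x : torus R) : exists v, torus_proj v = x.
Proof. by exists (repr x); exact: reprK. Qed.

Lemma torus_proj_cont : continuous (@torus_proj R).
Proof. exact: pi_continuous. Qed.

Lemma torus_proj_shift v k : lattice k -> torus_proj (v + k) = torus_proj v.
Proof. by move=> kZ; apply/torus_projE; rewrite addrC addKr. Qed.

Lemma lattice_const (c : plane R -> plane R) : continuous c -> (forall v, lattice (c v)) ->
  forall u v, c u = c v.
Proof.
move=> cc cZ u v; apply: plane_eq.
  apply: (@int_valued_plane R (fun v => (c v).1)) => w; first by cts.
  by have /andP[] := cZ w.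
apply: (@int_valued_plane R (fun v => (c v).2)) => w; first by cts.
by have /andP[] := cZ w.
Qed.

Definition torus_circle (i : bool) v : plane R := cis (2 * pi * (if i then v.1 else v.2)).

Lemma torus_circle_cont i : continuous (torus_circle i \o (repr : torus R -> plane R)).
Proof.
apply: repr_comp_continuous.
  by case: i => v; rewrite /torus_circle /cis; cts.
move=> u v /eqP/torus_projE /andP[uv1 uv2]; apply/eqP/cis_int.
rewrite -mulrBr mulrC mulrA mulVf ?turn_neq0 // mul1r.
by case: i.
Qed.

Lemma lift_exists f : continuous f -> exists F, continuous F /\
  forall v, torus_proj (F v) = f (torus_proj v).
Proof.
move=> fc.
have H i : exists th : plane R -> R, continuous th /\ forall v,
    (th v / (2 * pi) - (if i then (repr (f (torus_proj v))).1 else (repr (f (torus_proj v))).2))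
      \is a Num.int.
  pose g v := torus_circle i (repr (f (torus_proj v))).
  have gc : continuous g.
    move=> v; apply: (@cont_comp _ _ _ (fun v => f (torus_proj v)) _ v _ (@torus_circle_cont i _)).
    apply: (@cont_comp _ _ _ (@torus_proj R) f v _ (fc _)); exact: torus_proj_cont.
  have g0 v : g v != 0 by exact: cis_neq0.
  have [th [thc tha]] := lift_plane gc g0; exists th; split=> // v.
  have := @has_arg_cis R 1 (2 * pi * (if i then (repr (f (torus_proj v))).1 else (repr (f (torus_proj v))).2)) ler01.
  rewrite scale1r => /(has_arg_uniq (g0 v) (tha v)).
  by rewrite mulrBl [X in _ - X]mulrAC divff ?turn_neq0 // mul1r.
have [[th1 [c1 z1]] [th2 [c2 z2]]] := (H true, H false).
exists (fun v => (th1 v / (2 * pi), th2 v / (2 * pi))); split=> v; first by cts.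
have [w wE] := torus_projK (f (torus_proj v)).
rewrite -[RHS]reprK; apply/torus_projE/andP; split; [exact: z1|exact: z2].
Qed.

Definition integer_mx A := forall i j, A i j \is a Num.int.

Definition torus_lift f F A := [/\ continuous F, integer_mx A,
  forall v, torus_proj (F v) = f (torus_proj v) &
  forall v k, lattice k -> F (v + k) = F v + lin A k].

Lemma integer_mxM A B : integer_mx A -> integer_mx B -> integer_mx (A *m B).
Proof. by move=> AZ BZ i j; rewrite mxE rpred_sum // => l _; rewrite rpredM. Qed.

Lemma integer_mxX A j : integer_mx A -> integer_mx (A ^+ j).
Proof.
move=> AZ; elim: j => [|j IH]; last by rewrite exprS; apply: integer_mxM.
by move=> i l; rewrite expr0 mxE; case: (i == l); rewrite ?rpred1 ?rpred0.
Qed.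

Lemma lattice_lin A k : integer_mx A -> lattice k -> lattice (lin A k).
Proof. by move=> AZ /andP[k1 k2]; apply/andP; split; rewrite /= rpredD // rpredM. Qed.

Lemma additive_int (V : zmodType) (c : int -> V) :
  (forall i j, c (i + j) = c i + c j) -> forall i, c i = c 1 *~ i.
Proof.
move=> cD; have c0 : c 0 = 0 by apply: (addrI (c 0)); rewrite -cD !addr0.
have pos (n : nat) : c n = c 1 *+ n.
  elim: n => [|n IH]; first by rewrite mulr0n.
  by rewrite -addn1 PoszD cD IH mulrnDr.
case=> n; first by rewrite pos pmulrn.
apply/eqP; rewrite NegzE mulrNz -addr_eq0 -pmulrn -pos -cD addNr c0 //.
Qed.

Lemma torus_lift_exists f : continuous f -> exists F A, torus_lift f F A.
Proof.
move=> /lift_exists[F [Fc FE]].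
have cZ v k : lattice k -> lattice (F (v + k) - F v).
  by move=> kZ; apply/torus_projE; rewrite !FE torus_proj_shift.
(* [F (v + k) - F v] is continuous with values in the lattice, so it does not depend on [v]. This
   makes [c] additive, and its values on the two basis vectors are the columns of [A]. *)
pose c k := F (0 + k) - F 0.
have cE v k : lattice k -> F (v + k) = F v + c k.
  move=> kZ; have : F (v + k) - F v = c k.
    apply: (@lattice_const (fun v => F (v + k) - F v)) => [w|w]; last exact: cZ.
    by cfor; apply: cont_plane => /=; cts; apply: cont_plane => /=; cts.
  by move=> <-; rewrite [RHS]addrC subrK.
have cD k l : lattice k -> lattice l -> c (k + l) = c k + c l.
  move=> kZ lZ; rewrite {1}/c addrA cE // (cE 0 k kZ).
  by rewrite -[F 0 + c k + c l]addrA [LHS]addrC addKr.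
pose e1 (i : int) : plane R := (i%:~R, 0); pose e2 (i : int) : plane R := (0, i%:~R).
have e1Z i : lattice (e1 i) by rewrite /lattice /= intr_int rpred0.
have e2Z i : lattice (e2 i) by rewrite /lattice /= intr_int rpred0.
have c1 i : c (e1 i) = c (e1 1) *~ i.
  apply: (@additive_int _ (c \o e1)) => a b /=; rewrite -cD //; congr c.
  by apply: plane_eq; rewrite /= ?addr0 // intrD.
have c2 i : c (e2 i) = c (e2 1) *~ i.
  apply: (@additive_int _ (c \o e2)) => a b /=; rewrite -cD //; congr c.
  by apply: plane_eq; rewrite /= ?addr0 // intrD.
pose A : 'M[R]_2 := \matrix_(i, j)
  let u := if j == 0 then c (e1 1) else c (e2 1) in if i == 0 then u.1 else u.2.
have cc k : lattice k -> lattice (c k) by exact: cZ.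
exists F, A; split=> //.
  move=> i j; rewrite mxE /=.
  have /andP[a1 a2] := cc _ (e1Z 1); have /andP[b1 b2] := cc _ (e2Z 1).
  by case: (j == 0); case: (i == 0).
move=> v k kZ; rewrite cE //; congr (_ + _).
have /andP[/intrP[m mE] /intrP[n nE]] := kZ.
have -> : k = e1 m + e2 n by apply: plane_eq; rewrite /= ?mE ?nE ?addr0 ?add0r.
have int_pair (u : plane R) (z : int) : u *~ z = (u.1 * z%:~R, u.2 * z%:~R).
  have H (g : plane R -> R) : (forall a b, g (a + b) = g a + g b) -> g (u *~ z) = g u * z%:~R.
    move=> gD; rewrite -[u in RHS]mulr1z mulrzr.
    by apply: (@additive_int _ (fun z => g (u *~ z))) => i j; rewrite mulrzDr gD.
  by apply: plane_eq; apply: H.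
by rewrite cD // c1 c2 !int_pair; apply: plane_eq; rewrite /= !mxE /= !addr0 !add0r.
Qed.

Section Lift.
Variables (f : torus R -> torus R) (F : plane R -> plane R) (A : 'M[R]_2).
Hypothesis fF : torus_lift f F A.

Lemma torus_lift_iter j : torus_lift (iter j f) (iter j F) (A ^+ j).
Proof.
have [Fc AZ FE FA] := fF; split; first exact: iter_cont.
- exact: integer_mxX.
- by elim: j => [//|j IH] v /=; rewrite FE IH.
- elim: j => [|j IH] v k kZ /=; first by rewrite expr0 lin1.
  rewrite IH // FA; last by apply: lattice_lin => //; exact: integer_mxX.
  by rewrite exprS -mulmxE lin_mul.
Qed.

Lemma torus_lift_sub c : lattice c -> torus_lift f (fun v => F v - c) A.
Proof.
have [Fc AZ FE FA] := fF; move=> cZ; split=> //.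
- by move=> v; cfor; apply: cont_plane => /=; cts.
- by move=> v; rewrite torus_proj_shift ?FE //; exact: latticeN.
- by move=> v k kZ; rewrite FA // addrAC.
Qed.

Lemma lattice_floor v : exists2 k, lattice k & square 1 (v - k).
Proof.
exists ((Num.floor v.1)%:~R, (Num.floor v.2)%:~R); first by rewrite /lattice /= !intr_int.
have H (x : R) : `|x - (Num.floor x)%:~R| <= 1.
  have /andP[fx xf] := floor_itv x; rewrite ger0_norm ?subr_ge0 // lerBlDl -intrD1.
  exact: ltW.
by split; exact: H.
Qed.

(** [F - A] is invariant under lattice translations, so its bound on one compact square holds on the
    plane. *)
Lemma torus_lift_near_lin : near_lin F A.
Proof.
have [Fc AZ FE FA] := fF.
pose g v := F v - lin A v.
have gk v k : lattice k -> g (v + k) = g v.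
  by move=> kZ; rewrite /g FA // linD opprD addrACA subrr addr0.
have gc : continuous g.
  by have lc := @lin_cont R A; move=> v; cfor; apply: cont_plane; rewrite /g /=; cts.
have := continuous_compact (continuous_subspaceT gc) (@square_compact R 1).
move=> /compact_bounded[C [_ CP]]; exists (C + 1) => v.
have [k kZ vk] := lattice_floor v.
rewrite -[F v - _]/(g v) -(subrK k v) gk //; apply: CP; first by rewrite ltrDl.
by exists (v - k).
Qed.

Lemma lattice_lin_id : (forall k, lattice k -> lin A k = k) -> A = 1%:M.
Proof.
move=> Ak; have l10 : lattice ((1, 0) : plane R) by rewrite /lattice /= rpred1 rpred0.
have l01 : lattice ((0, 1) : plane R) by rewrite /lattice /= rpred1 rpred0.
have := (Ak _ l01, Ak _ l10); rewrite /lin /= !mulr1 !mulr0 !addr0 !add0r => -[[a b] [c d]].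
by apply/matrixP; do 2 apply: ord2P; rewrite !mxE.
Qed.

Lemma torus_lift_id p : f =1 id -> F p = p -> F =1 id /\ A = 1%:M.
Proof.
have [Fc AZ FE FA] := fF; move=> f1 Fp.
have F1 : F =1 id.
  move=> v; apply/eqP; rewrite -subr_eq0; apply/eqP.
  rewrite -(subrr p) -[in RHS]Fp.
  have -> : F p - F p = F p - p by rewrite Fp.
  apply: (@lattice_const (fun v => F v - v)) => [w|w].
    by cfor; apply: cont_plane => /=; cts.
  by apply/torus_projE; rewrite FE f1.
split=> //; apply: lattice_lin_id => k kZ.
by have := FA 0 k kZ; rewrite !F1 !add0r.
Qed.

Lemma torus_lift_inj : injective f -> \det A != 0 -> injective F.
Proof.
have [Fc AZ FE FA] := fF; move=> fi A0 u v uv.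
have uvZ : lattice (u - v) by apply/torus_projE/fi; rewrite -!FE uv.
have := FA v (u - v) uvZ; rewrite [v + _]addrC subrK uv -[X in X = _]addr0 => /addrI/esym Auv.
have := linK (u - v) A0; rewrite Auv lin0 => /esym/eqP; rewrite subr_eq0 => /eqP.
by [].
Qed.

(** The lift in [orientation_preserving] is only local and depends on the point; near [u] it is a
    translate of the global [F]. *)
Lemma near_proj_lift (G : plane R -> plane R) u :
  (\forall v \near u, {for v, continuous G} /\ torus_proj (G v) = f (torus_proj v)) ->
  exists2 e : R, 0 < e & exists c, forall v, enorm (v - u) < e -> G v = F v + c.
Proof.
have [Fc AZ FE FA] := fF; move=> /nbhs_ballP[e /= e0 eG]; exists e => //.
have eG' v : enorm (v - u) < e -> {for v, continuous G} /\ lattice (G v - F v).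
  move=> ve; have [|Gc GE] := eG v.
    by rewrite -ball_normE /= distrC; apply: le_lt_trans ve; exact: norm_le_enorm.
  by split=> //; apply/torus_projE; rewrite FE.
exists (G u - F u) => v ve.
suff <- : G v - F v = G u - F u by rewrite [RHS]addrC subrK.
have seg t : t \in `[0, 1] -> enorm (u + t *: (v - u) - u) < e.
  rewrite in_itv /= => /andP[t0 t1]; rewrite addrC addKr; apply: le_lt_trans ve.
  rewrite -[leRHS]mul1r /enorm (_ : dot _ _ = t ^+ 2 * dot (v - u) (v - u)).
    by rewrite sqrtrM ?sqr_ge0 // sqrtr_sqr ger0_norm // ler_wpM2r // sqrtr_ge0.
  by rewrite /dot /= /GRing.scale /=; ring.
apply: plane_eq.
  apply: (@int_valued_segment R (fun v => (G v - F v).1)) => t /seg /eG'[Gc /andP[]//].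
  by move=> _ _ /=; cts.
apply: (@int_valued_segment R (fun v => (G v - F v).2)) => t /seg /eG'[Gc /andP[]//].
by move=> _ _ /=; cts.
Qed.

Lemma torus_lift_orientation : injective f -> \det A != 0 -> orientation_preserving f ->
  0 < \det A.
Proof.
have [Fc AZ FE FA] := fF; move=> fi A0 fo.
have Fi := torus_lift_inj fi A0.
have [G [Gu Go]] := fo 0; have [e e0 [c GF]] := near_proj_lift Gu.
apply: (orientation_det Fc Fi torus_lift_near_lin A0 (u := 0)).
move: Go; rewrite /preserves_orientation_at => Go.
have re : \forall r \near (0 : R)^'+, r < e by exact: nbhs_right_lt.
have rp : \forall r \near (0 : R)^'+, 0 < r by exact: nbhs_right_gt.
apply: filterS (filterI (filterI rp re) Go) => r [[r0 re'] [rho [th [thc th1 H]]]].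
exists rho, th; split=> // t t01; have [rt GE] := H t t01; split=> //.
have e1 : enorm (0 + r *: cis (2 * pi * t) - 0) < e.
  by rewrite add0r subr0 enorm_cis // ltW.
have e2 : enorm (0 - 0 : plane R) < e by rewrite subrr enorm0.
move: GE; rewrite (GF _ e1) (GF _ e2) => GE; apply: (addIr c).
by rewrite GE addrAC.
Qed.

End Lift.

End TorusLift.

(** * Linear maps of finite order *)

Section FiniteOrder.
Context {R : realType}.
Implicit Types (A B M P O : 'M[R]_2) (u v w : plane R).

Lemma lin_inj M M' : (forall v, lin M v = lin M' v) -> M = M'.
Proof.
move=> MM; have := (MM (0, 1), MM (1, 0)).
rewrite /lin /= !mulr1 !mulr0 !addr0 !add0r => -[[a b] [c d]].
by apply/matrixP; do 2 apply: ord2P.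
Qed.

(** Testing on [(1, 0)], [(0, 1)] and [(1, 1)] shows that the columns are orthonormal; the sign of
    the determinant excludes reflections. *)
Lemma orthogonal_rotation O : (forall v, dot (lin O v) (lin O v) = dot v v) -> 0 < \det O ->
  exists a : R, forall v, lin O v = rotation a v.
Proof.
move=> Ov; rewrite det2 => O0.
have := (Ov (1, 0), Ov (0, 1), Ov (1, 1)); rewrite /dot /lin /= !mulr1 !mulr0 !addr0 !add0r.
set x := O 0 0 in O0 *; set y := O 0 1 in O0 *; set z := O 1 0 in O0 *; set t := O 1 1 in O0 *.
move=> [[e1 e2] e3].
have xy : x * y + z * t = 0 by nra.
have d1 : x * t - y * z = 1.
  have : (x * t - y * z) ^+ 2 = 1.
    have -> : (x * t - y * z) ^+ 2 = (x * x + z * z) * (y * y + t * t) - (x * y + z * t) ^+ 2 by ring.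
    by rewrite e1 e2 xy; ring.
  move/eqP; rewrite sqrf_eq1 => /orP[/eqP//|/eqP d1].
  by move: O0; rewrite d1; lra.
have /eqP : (x - t) ^+ 2 + (y + z) ^+ 2 = 0.
  have -> : (x - t) ^+ 2 + (y + z) ^+ 2 = (x * x + z * z) + (y * y + t * t) - 2 * (x * t - y * z) by ring.
  by rewrite e1 e2 d1; ring.
rewrite paddr_eq0 ?sqr_ge0 // !sqrf_eq0 subr_eq0 addr_eq0 => /andP[/eqP xt /eqP yz].
have [a aE] := has_arg_ex (x, z); exists a => v.
have n1 : enorm (x, z) = 1 by rewrite /enorm /dot /= e1 sqrtr1.
have [xa za] := has_argE aE; rewrite n1 !mul1r /= in xa za.
by apply: plane_eq; rewrite /= -/x -/y -/z -/t -xa -za -?xt ?yz; ring.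
Qed.

Lemma finite_order_conj A n : (0 < n)%N -> A ^+ n = 1%:M -> 0 < \det A ->
  exists P (c : int), 0 < \det P /\
  forall v, lin P (lin A v) = rotation (2 * pi * c%:~R / n%:R) (lin P v).
Proof.
move=> n0 An A0.
pose q u v := \sum_(j < n) dot (lin (A ^+ j) u) (lin (A ^+ j) v).
have qA v : q (lin A v) (lin A v) = q v v.
  pose T j := dot (lin (A ^+ j) v) (lin (A ^+ j) v).
  have -> : q (lin A v) (lin A v) = \sum_(j < n) T j.+1.
    by apply: eq_bigr => j _; rewrite /T exprSr -mulmxE lin_mul.
  by apply: cyclic_sum; rewrite /T An expr0.
pose al := q (1, 0) (1, 0); pose be := q (1, 0) (0, 1); pose ga := q (0, 1) (0, 1).
have qE v : q v v = al * v.1 ^+ 2 + 2 * be * v.1 * v.2 + ga * v.2 ^+ 2.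
  rewrite /q /al /be /ga [2 * _]mulrC -[X in _ = X]addrA -!mulrA !mulr_suml -!big_split /=.
  by apply: eq_bigr => j _; rewrite /dot /=; ring.
have q_ge v : dot v v <= q v v.
  rewrite /q; case: n n0 {An qA q al be ga qE} => // n _.
  by rewrite big_ord_recl expr0 lin1 lerDl sumr_ge0 // => j _; exact: dot_ge0.
have al0 : 0 < al.
  by apply: lt_le_trans (q_ge _); rewrite /dot /= mulr0 addr0 mulr1 ltr01.
have de0 : 0 < al * ga - be ^+ 2.
  (* [(- be, al)] is orthogonal to [(1, 0)] for [q], and [q] takes there the value [al] times the
     Gram determinant. *)
  have := lt_le_trans _ (q_ge (- be, al)); rewrite qE /= => /(_ 0).
  rewrite dot_gt0; last first.
    by apply/eqP => -[_ a0]; move: al0; rewrite a0 ltxx.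
  have -> : al * (- be) ^+ 2 + 2 * be * - be * al + ga * al ^+ 2 = al * (al * ga - be ^+ 2) by ring.
  by rewrite pmulr_rgt0 //; apply.
set de := _ - _ in de0.
pose r := Num.sqrt al; have r0 : 0 < r by rewrite sqrtr_gt0.
have r2 : r ^+ 2 = al by rewrite sqr_sqrtr // ltW.
pose s := Num.sqrt (de / al); have s0 : 0 < s by rewrite sqrtr_gt0 divr_gt0.
have s2 : s ^+ 2 = de / al by rewrite sqr_sqrtr // ltW // divr_gt0.
(* The Cholesky factor of the Gram matrix of [q]: it carries [q] to the standard inner product. *)
pose P : 'M[R]_2 := \matrix_(i, j)
  if i == 0 then (if j == 0 then r else be / r) else (if j == 0 then 0 else s).
have P0 : 0 < \det P by rewrite det2 !mxE /= mulr0 subr0 mulr_gt0.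
have Pq v : dot (lin P v) (lin P v) = q v v.
  rewrite qE /dot /= !mxE /= mul0r add0r.
  have -> : (r * v.1 + be / r * v.2) * (r * v.1 + be / r * v.2) + s * v.2 * (s * v.2) =
    r ^+ 2 * v.1 ^+ 2 + 2 * be * v.1 * v.2 + (be ^+ 2 / r ^+ 2 + s ^+ 2) * v.2 ^+ 2.
    by field; rewrite gt_eqF.
  rewrite r2 s2 /de; field; by rewrite gt_eqF.
have PN : \det P != 0 by rewrite gt_eqF.
pose O := P *m A *m invmx P.
have OP v : lin P (lin A v) = lin O (lin P v).
  by rewrite /O !lin_mul linK.
have [||a aE] := @orthogonal_rotation O.
- move=> v; rewrite /O !lin_mul Pq qA -Pq linKV //.
- by rewrite /O !det_mulmx det_inv mulrAC mulfV // mul1r.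
have it j v : lin P (lin (A ^+ j) v) = rotation (j%:R * a) (lin P v).
  elim: j => [|j IH]; first by rewrite expr0 lin1 mul0r rotation0.
  rewrite exprS -mulmxE lin_mul OP aE IH rotationD; congr rotation.
  by rewrite -[j.+1%:R]natr1; ring.
have nR : n%:R != 0 :> R by rewrite pnatr_eq0 -lt0n.
have /intrP[c cE] : (n%:R * a - 0) / (2 * pi) \is a Num.int.
  apply: cis_inj; have := it n (lin (invmx P) (1, 0)).
  rewrite An lin1 linKV // /rotation /cis /= !mulr1 !mulr0 subr0 addr0 cos0 sin0.
  by case=> <- <-.
exists P, c; split=> // v; rewrite OP aE; congr rotation.
by rewrite -cE subr0 [2 * pi * _]mulrC divfK ?turn_neq0 // mulrAC mulfV // mul1r.
Qed.

Lemma conj_det_tr A P (a : R) : \det P != 0 ->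
  (forall v, lin P (lin A v) = rotation a (lin P v)) ->
  \det A = 1 /\ \tr A = 2 * cos a.
Proof.
move=> P0 PA; have AE : A = invmx P *m (rotmx a *m P).
  by apply: lin_inj => v; rewrite !lin_mul -rotationE -PA linK.
split.
  rewrite AE !det_mulmx det_inv mulrCA mulVf // mulr1 det2 !mxE /=.
  by rewrite mulNr opprK -!expr2 cos2Dsin2.
rewrite AE mxtrace_mulC -mulmxA mulmxV ?unitmxE ?unitfE // mulmx1.
by rewrite /mxtrace sum2 !mxE /=; ring.
Qed.

End FiniteOrder.

(** * Periodic homeomorphisms of the torus *)

Section TorusPeriodic.
Context {R : realType}.
Implicit Types (u v w k : plane R) (x y : torus R).
Variables (f : torus R -> torus R) (n : nat) (F : plane R -> plane R) (A P : 'M[R]_2) (c : int).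
Hypotheses (n0 : (0 < n)%N) (fn : iter n f =1 id) (fF : torus_lift f F A).
Hypothesis P0 : 0 < \det P.
Hypothesis PA : forall v, lin P (lin A v) = rotation (2 * pi * c%:~R / n%:R) (lin P v).

Lemma iter_inj : injective f.
Proof. by move=> x y xy; rewrite -(fn x) -(fn y) -(prednK n0) !iterSr xy. Qed.

Lemma iter_lattice j v : iter j f (torus_proj v) = torus_proj v <-> lattice (iter j F v - v).
Proof.
have [_ _ FE _] := torus_lift_iter fF j.
by rewrite -FE; exact: torus_projE.
Qed.

Lemma iter_mul_id j l : (n %| l * j)%N -> iter l (iter j f) =1 id.
Proof.
move=> /dvdnP[q qE] x; rewrite -iterM qE.
by elim: q {qE} => [//|q IH]; rewrite mulSn iterD IH fn.
Qed.

Lemma conj_iter j v : lin P (lin (A ^+ j) v) = rotation (2 * pi * (c * j%:Z)%:~R / n%:R) (lin P v).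
Proof.
elim: j => [|j IH]; first by rewrite expr0 lin1 mulr0 mulr0 mul0r rotation0.
rewrite exprS -mulmxE lin_mul PA IH rotationD; congr rotation.
have -> : c * j.+1%:Z = c + c * j%:Z by rewrite -addn1 PoszD; ring.
by rewrite intrD; ring.
Qed.

Lemma det_iter j : \det (A ^+ j) = 1.
Proof. by have [] := conj_det_tr (lt0r_neq0 P0) (conj_iter j). Qed.

(** [G^l] lifts [f^(l j)], which is the identity, and it fixes [p]; such a lift is the identity. *)
Lemma fixed_lift j l p k : (n %| l * j)%N -> lattice k -> iter j F p = p + k ->
  let G v := iter j F v - k in
  [/\ torus_lift (iter j f) G (A ^+ j), G p = p & iter l G =1 id].
Proof.
move=> nlj kZ Fp G.
have fG : torus_lift (iter j f) G (A ^+ j) by apply: torus_lift_sub => //; exact: torus_lift_iter.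
have Gp : G p = p by rewrite /G Fp addrK.
split=> //; have := torus_lift_iter fG l => fGl.
have Glp : iter l G p = p by elim: (l) => [//|i IH]; rewrite iterS IH.
by have [] := torus_lift_id fGl (iter_mul_id nlj) Glp.
Qed.

(** The lift of [f^m] fixing a point over [x] has linear part [A^m], a rotation by [c m / n = c / l]
    turns up to conjugacy, while the chart shows [d / l] turns. *)
Lemma local_rotation_angle x m (d : nat) : (m %| n)%N -> (0 < m)%N ->
  iter m f x = x -> locally_rotation f x m d (n %/ m) ->
  exists z : int, c = d%:Z + (n %/ m)%N%:Z * z.
Proof.
move=> mn m0 fx [D [h [r [[[Do Dx] r0] [g [hc gc Dh gD]] ho hx hrot]]]].
have [p px] := torus_projK x.
set l := (n %/ m)%N.
have nlm : n = (l * m)%N by rewrite divnK.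
have l0 : (0 < l)%N by rewrite divn_gt0 // dvdn_leq.
have kZ : lattice (iter m F p - p) by apply/iter_lattice; rewrite px.
have [|//|fG Gp Gl] := @fixed_lift m l p _ _ kZ; first by rewrite -nlm.
  by rewrite addrC subrK.
set G := fun v => _ in fG Gp Gl.
have [Gc _ GE _] := fG.
pose H v := h (torus_proj v).
have hcx y : D y -> {for y, continuous h}.
  by move=> Dy; move: hc; rewrite continuous_open_subspace // => hc'; apply: hc'; exact: mem_set.
(* On this disk the chart is defined and [p] is the only point over [x], so [H] vanishes nowhere
   else. *)
have [e e0 eP] : exists2 e : R, 0 < e & forall v, enorm (v - p) < e ->
    D (torus_proj v) /\ (lattice (v - p) -> v = p).
  have : \forall v \near p, D (torus_proj v).
    by apply: torus_proj_cont; rewrite px; exact: open_nbhs_nbhs.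
  move=> /nbhs_ballP[e /= e0 eD]; exists (Num.min e 1); first by rewrite lt_min e0 ltr01.
  move=> v; rewrite lt_min => /andP[ve v1]; split.
    by apply: eD; rewrite -ball_normE /= distrC; apply: le_lt_trans ve; exact: norm_le_enorm.
  have {}v1 := le_lt_trans (norm_le_enorm _) v1.
  move=> vpZ; apply/eqP; rewrite -subr_eq0; apply/eqP; exact: lattice_small.
have PB v : lin P (lin (A ^+ m) v) = rotation (2 * pi * c%:~R / l%:R) (lin P v).
  rewrite conj_iter; congr rotation; rewrite intrM nlm natrM.
  move: (2 * pi) => t; field; rewrite !pnatr_eq0.
  by rewrite -!lt0n m0 l0.
apply: (@periodic_local_rotation R G (A ^+ m) P p l c d%:Z H e) => //.
- exact: torus_lift_near_lin fG.
- by rewrite /H px.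
- move=> v vp ve; have [Dv vZ] := eP v ve; split.
  + apply: (@cont_comp _ _ _ (@torus_proj R) h v); first exact: torus_proj_cont.
    exact: hcx.
  + apply: contra_neq vp => hv; apply: vZ; apply/torus_projE.
    have [_ e1] := Dh _ Dv; have [_ e2] := Dh _ Dx.
    by rewrite px -e1 -e2 hx -[h _]/(H v) hv.
  + by rewrite /H GE; have [_ ->] := hrot _ Dv.
- by apply: ho; rewrite px.
Qed.

Lemma conj_angle_cos j : (forall z : int, c * j%:Z <> n%:Z * z) ->
  cos (2 * pi * (c * j%:Z)%:~R / n%:R) < 1 :> R.
Proof.
move=> cj; rewrite lt_neqAle cos_le1 andbT; apply/eqP => cos1.
set a := _ / _ in cos1.
have s0 : sin a = 0 by apply: cos1sin0; rewrite cos1 normr1.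
have /intrP[z zE] : (a - 0) / (2 * pi) \is a Num.int.
  by apply: cis_inj; rewrite /cis cos1 s0 cos0 sin0.
apply: (cj z); apply/eqP; rewrite -(eqr_int R) !intrM -zE subr0 /a intrM.
have nR : n%:R != 0 :> R by rewrite pnatr_eq0 -lt0n.
have tN := @turn_neq0 R; apply/eqP; move: (2 * pi) tN => t tN.
by field; rewrite nR tN.
Qed.

Lemma lift_fixed j k : (forall z : int, c * j%:Z <> n%:Z * z) ->
  exists v, iter j F v = v + k.
Proof.
move=> cj; have [d1 t1] := conj_det_tr (lt0r_neq0 P0) (conj_iter j).
(* For a matrix [B] of order 2, [det (B - 1) = det B - tr B + 1]; here this is [2 - 2 cos], positive
   because the angle is not a whole number of turns. *)
have M0 : 0 < \det (A ^+ j - 1%:M).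
  rewrite (_ : \det _ = \det (A ^+ j) - \tr (A ^+ j) + 1).
    by rewrite d1 t1; have := conj_angle_cos cj; lra.
  by rewrite !det2 /mxtrace sum2 !mxE /=; ring.
have [Fc _ _ _] := torus_lift_iter fF j.
have [||v vE] := @near_lin_zero R (fun v => iter j F v - v - k) (A ^+ j - 1%:M) _ _ M0.
- by move=> v; cfor; apply: cont_plane => /=; cts.
- have := near_lin_sub k (torus_lift_near_lin (torus_lift_iter fF j)).
  by apply: bounded_map_eq => v; rewrite lin_subM lin1; apply: plane_eq => /=; ring.
exists v; apply/eqP; rewrite -subr_eq0 opprD addrA; exact/eqP.
Qed.

Lemma lift_fixed_unique j k u v : (forall z : int, c * j%:Z <> n%:Z * z) -> lattice k ->
  iter j F u = u + k -> iter j F v = v + k -> u = v.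
Proof.
move=> cj kZ Fu Fv.
have [fG Gu Gn] := @fixed_lift j n u k (dvdn_mulr _ (dvdnn n)) kZ Fu.
have [Gc _ _ _] := fG.
have B0 : 0 < \det (A ^+ j) by rewrite det_iter.
apply/esym; apply: (periodic_fixed_unique Gc Gu _ n0 Gn (torus_lift_near_lin fG) B0 P0 (conj_iter j)).
  by rewrite Fv addrK.
by move=> [z zE]; exact: (cj z).
Qed.

End TorusPeriodic.

(** * Index of the image lattice *)

Section LatticeIndex.
Context {R : realType}.
Implicit Types (k : plane R) (M : 'M[R]_2).

(** [q] presents the quotient of [Z^2] by [M Z^2] as a finite type, so the index is a cardinal and
    no quotient group is formed. *)
Definition lattice_index M (m : nat) := exists (Q : finType) (q : plane R -> Q),
  [/\ #|Q| = m, forall z, exists2 k, lattice k & q k = z &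
   forall k k', lattice k -> lattice k' ->
     (q k = q k' <-> exists2 l, lattice l & k - k' = lin M l)].

Lemma Fp_int_eq0 p (z : int) : prime p -> (z%:~R = 0 :> 'F_p) <-> exists w : int, z = w * p%:Z.
Proof.
move=> pp; have pz := dvdz_pcharf (pchar_Fp pp) z; split.
  by move=> z0; have /dvdzP[w ->] : (p%:Z %| z)%Z; [rewrite pz; apply/eqP|exists w].
by move=> [w wE]; apply/eqP; move: pz; rewrite wE dvdz_mull // => /esym.
Qed.

(** By the adjugate, [(x, y)] is in the image iff [D] divides both [d x - b y] and [a y - c x].
    Modulo [p] these two forms are proportional, so the first one decides when it is nonzero. *)
Lemma prime_det_image (a b c d D : int) p (x y : int) : prime p ->
  a * d - b * c = D -> (D = p%:Z) \/ (D = - p%:Z) ->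
  (d%:~R != 0 :> 'F_p) || (b%:~R != 0 :> 'F_p) ->
  ((d * x - b * y)%:~R = 0 :> 'F_p) <->
  exists l1 l2 : int, x = a * l1 + b * l2 /\ y = c * l1 + d * l2.
Proof.
move=> pp DE Dp db.
have D0 : D%:~R = 0 :> 'F_p.
  by apply/Fp_int_eq0 => //; case: Dp => ->; [exists 1|exists (-1)]; ring.
split; last first.
  move=> [l1 [l2 [-> ->]]].
  have -> : d * (a * l1 + b * l2) - b * (c * l1 + d * l2) = (a * d - b * c) * l1 by ring.
  by rewrite DE intrM D0 mul0r.
move=> l0; pose s := a * y - c * x.
have s0 : s%:~R = 0 :> 'F_p.
  have bs : b%:~R * s%:~R = 0 :> 'F_p.
    rewrite -intrM (_ : b * s = D * x - a * (d * x - b * y)); last by rewrite /s -DE; ring.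
    by rewrite intrD intrM D0 mul0r add0r intrN [X in - X]intrM l0 mulr0 oppr0.
  have ds : d%:~R * s%:~R = 0 :> 'F_p.
    rewrite -intrM (_ : d * s = D * y - c * (d * x - b * y)); last by rewrite /s -DE; ring.
    by rewrite intrD intrM D0 mul0r add0r intrN [X in - X]intrM l0 mulr0 oppr0.
  move/eqP: bs; move/eqP: ds; rewrite !mulf_eq0.
  by case/orP: db => /negbTE -> /=; [move=> /eqP -> |move=> _ /eqP ->].
have /(Fp_int_eq0 _ pp)[u uE] := l0; have /(Fp_int_eq0 _ pp)[v vE] := s0.
have p0 : p%:Z != 0 by have := prime_gt0 pp; lia.
have [e [e2 eD]] : exists e : int, e * e = 1 /\ D = e * p%:Z.
  by case: Dp => ->; [exists 1|exists (-1)]; split => //; ring.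
exists (e * u), (e * v).
have H1 : a * (d * x - b * y) + b * s = D * x by rewrite /s -DE; ring.
have H2 : c * (d * x - b * y) + d * s = D * y by rewrite /s -DE; ring.
rewrite uE vE eD in H1; rewrite uE vE eD in H2.
have e0 : e != 0 by apply: contra_eq_neq e2 => ->.
split; apply: (mulfI p0); apply: (mulfI e0); rewrite mulrA -?H1 -?H2.
  transitivity ((e * e) * (a * (u * p%:Z) + b * (v * p%:Z))); last by ring.
  by rewrite e2 mul1r.
transitivity ((e * e) * (c * (u * p%:Z) + d * (v * p%:Z))); last by ring.
by rewrite e2 mul1r.
Qed.

Definition ivec (x y : int) : plane R := (x%:~R, y%:~R).

Lemma lattice_ivec x y : lattice (ivec x y).
Proof. by rewrite /lattice /= !intr_int. Qed.

Lemma lattice_floorK k : lattice k -> k = ivec (Num.floor k.1) (Num.floor k.2).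
Proof.
by move=> /andP[/floorK k1 /floorK k2]; apply: plane_eq; rewrite /= ?k1 ?k2.
Qed.

Lemma ivec_inj x y x' y' : ivec x y = ivec x' y' -> x = x' /\ y = y'.
Proof. by case=> /intr_inj -> /intr_inj ->. Qed.

Definition imx (a b c d : int) : 'M[R]_2 := \matrix_(i, j)
  (if i == 0 then (if j == 0 then a else b) else (if j == 0 then c else d))%:~R.

Lemma imxP M : integer_mx M -> exists a b c d, M = imx a b c d.
Proof.
move=> MZ; have /intrP[a aE] := MZ 0 0; have /intrP[b bE] := MZ 0 1.
have /intrP[c cE] := MZ 1 0; have /intrP[d dE] := MZ 1 1.
by exists a, b, c, d; apply/matrixP; do 2 apply: ord2P; rewrite !mxE.
Qed.

Lemma lin_imx a b c d x y : lin (imx a b c d) (ivec x y) = ivec (a * x + b * y) (c * x + d * y).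
Proof. by apply: plane_eq; rewrite /= !mxE /= intrD !intrM. Qed.

Lemma det_imx a b c d : \det (imx a b c d) = (a * d - b * c)%:~R.
Proof. by rewrite det2 !mxE /= intrB !intrM. Qed.

Lemma lattice_index_intro (a b c d : int) (m : nat) (Q : finType) (q : int -> int -> Q) :
  #|Q| = m -> (forall z, exists x y, q x y = z) ->
  (forall x y x' y', q x y = q x' y' <->
     exists l1 l2 : int, x - x' = a * l1 + b * l2 /\ y - y' = c * l1 + d * l2) ->
  lattice_index (imx a b c d) m.
Proof.
move=> Qm qs qE; exists Q, (fun k => q (Num.floor k.1) (Num.floor k.2)); split=> //.
  move=> z; have [x [y xy]] := qs z; exists (ivec x y); first exact: lattice_ivec.
  by rewrite /= !intrKfloor.
move=> k k' kZ k'Z; have kE := lattice_floorK kZ; have k'E := lattice_floorK k'Z.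
set x := Num.floor k.1 in kE *; set y := Num.floor k.2 in kE *.
set x' := Num.floor k'.1 in k'E *; set y' := Num.floor k'.2 in k'E *.
have kk : k - k' = ivec (x - x') (y - y') by rewrite kE k'E; apply: plane_eq; rewrite /= intrB.
split.
  move=> /qE[l1 [l2 [e1 e2]]]; exists (ivec l1 l2); first exact: lattice_ivec.
  by rewrite kk lin_imx -e1 -e2.
move=> [l lZ]; rewrite (lattice_floorK lZ) kk lin_imx => /ivec_inj[e1 e2].
by apply/qE; exists (Num.floor l.1), (Num.floor l.2).
Qed.

(** The matrix does not vanish modulo [p], or [p^2] would divide its determinant; so one of its
    columns gives a nonzero linear form to ['F_p], whose kernel on [Z^2] is the image. *)
Lemma lattice_index_prime M p : integer_mx M -> prime p -> \det M = p%:R -> lattice_index M p.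
Proof.
move=> /imxP[a [b [c [d ->]]]] pp; rewrite det_imx -[p%:R]/(p%:Z%:~R) => /intr_inj detM.
have pp1 := prime_gt1 pp.
have surj (u v : int) : (u%:~R != 0 :> 'F_p) || (v%:~R != 0 :> 'F_p) ->
    forall z : 'F_p, exists x y : int, (u * x - v * y)%:~R = z :> 'F_p.
  move=> uv z; have [u0|u0] := boolP (u%:~R == 0 :> 'F_p); last first.
    exists ((z / u%:~R : 'F_p) : nat)%:Z, 0.
    by rewrite mulr0 subr0 intrM -[X in _ * X]/((_ : nat)%:R) natr_Zp mulrC divfK.
  move: uv; rewrite u0 /= => v0; exists 0, (- ((z / v%:~R : 'F_p) : nat)%:Z).
  by rewrite mulr0 sub0r mulrN opprK intrM -[X in _ * X]/((_ : nat)%:R) natr_Zp mulrC divfK.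
have key (r s t u D : int) : r * u - s * t = D -> (D = p%:Z) \/ (D = - p%:Z) ->
    (u%:~R != 0 :> 'F_p) || (s%:~R != 0 :> 'F_p) ->
    forall x y x' y', ((u * x - s * y)%:~R = (u * x' - s * y')%:~R :> 'F_p) <->
    exists l1 l2 : int, x - x' = r * l1 + s * l2 /\ y - y' = t * l1 + u * l2.
  move=> DE Dp us x y x' y'; rewrite -(prime_det_image (x - x') (y - y') pp DE Dp us).
  have -> : u * (x - x') - s * (y - y') = (u * x - s * y) - (u * x' - s * y') by ring.
  move: (u * x - s * y) (u * x' - s * y') => m1 m2.
  by rewrite intrB; split=> [->|/eqP]; rewrite ?subrr // subr_eq0 => /eqP.
have [db|] := boolP ((d%:~R != 0 :> 'F_p) || (b%:~R != 0 :> 'F_p)).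
  apply: (@lattice_index_intro a b c d p 'F_p (fun x y => (d * x - b * y)%:~R)).
  - exact: card_Fp.
  - exact: surj.
  - by apply: key detM _ db; left.
rewrite negb_or !negbK => /andP[/eqP/(Fp_int_eq0 _ pp)[d' dE] /eqP/(Fp_int_eq0 _ pp)[b' bE]].
have ca : (c%:~R != 0 :> 'F_p) || (a%:~R != 0 :> 'F_p).
  rewrite -negb_and; apply/negP => /andP[/eqP/(Fp_int_eq0 _ pp)[c' cE] /eqP/(Fp_int_eq0 _ pp)[a' aE]].
  move: detM; rewrite aE bE cE dE.
  have -> : a' * p%:Z * (d' * p%:Z) - b' * p%:Z * (c' * p%:Z) = (p%:Z * (a' * d' - b' * c')) * p%:Z by ring.
  rewrite -[RHS]mul1r => /mulIf.
  have p0 : p%:Z != 0 by lia.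
  by move=> /(_ p0) => /(congr1 absz); rewrite abszM /= => /eqP; rewrite muln_eq1; lia.
have detM' : d * a - c * b = p%:Z by rewrite -detM; ring.
apply: (@lattice_index_intro a b c d p 'F_p (fun x y => (a * y - c * x)%:~R)).
- exact: card_Fp.
- by move=> z; have [x [y xy]] := surj _ _ (etrans (orbC _ _) ca) z; exists y, x.
- move=> x y x' y'; rewrite (key d c b a p%:Z detM' (or_introl erefl) (etrans (orbC _ _) ca)).
  by split=> -[l1 [l2 [e1 e2]]]; exists l2, l1; rewrite e1 e2; split; ring.
Qed.

Lemma lattice_index1 M : integer_mx M -> \det M = 1 -> lattice_index M 1.
Proof.
move=> /imxP[a [b [c [d ->]]]]; rewrite det_imx -[1]/(1%:~R) => /intr_inj detM.
apply: (@lattice_index_intro a b c d 1 unit (fun _ _ => tt)); first exact: card_unit.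
  by case; exists 0, 0.
move=> x y x' y'; split=> // _.
exists (d * (x - x') - b * (y - y')), (a * (y - y') - c * (x - x')).
by split; rewrite -[LHS]mul1r -detM; ring.
Qed.

(** This quotient is not cyclic, so a single linear form cannot present it; both coordinates are
    reduced modulo 2. *)
Lemma lattice_index_opp2 : lattice_index ((- 1%:M) - 1%:M) 4.
Proof.
have -> : (- 1%:M) - 1%:M = imx (- 2) 0 0 (- 2).
  by apply/matrixP; do 2 apply: ord2P; rewrite !mxE /=; ring.
apply: (@lattice_index_intro _ _ _ _ 4 ('F_2 * 'F_2)%type (fun x y => (x%:~R, y%:~R))).
- by rewrite card_prod !card_Fp.
- move=> [u v]; exists (u : nat)%:Z, (v : nat)%:Z.
  by congr pair; rewrite -[X in X = _]/((_ : nat)%:R) natr_Zp.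
- have H (x x' : int) : (x%:~R = x'%:~R :> 'F_2) <-> exists l, x - x' = - 2 * l.
    have := @Fp_int_eq0 2 (x - x') isT; rewrite intrB => Hx; split.
      by move=> xx; have [|w wE] := Hx.1; [rewrite xx subrr|exists (- w); rewrite wE; ring].
    move=> [l lE]; apply/eqP; rewrite -subr_eq0; apply/eqP/Hx.2.
    by exists (- l); rewrite lE; ring.
  move=> x y x' y'; split.
    by case=> /H[l1 e1] /H[l2 e2]; exists l1, l2; rewrite e1 e2; split; ring.
  move=> [l1 [l2 [e1 e2]]]; congr pair; apply/H.
    by exists l1; rewrite e1; ring.
  by exists l2; rewrite e2; ring.
Qed.

End LatticeIndex.

(** * Counting periodic points *)

Section Periods.
Context {T : Type}.
Implicit Types (f : T -> T) (x y : T).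

Lemma least_period f x j : (0 < j)%N -> iter j f x = x ->
  exists2 m, (m <= j)%N & point_period f x m.
Proof.
move=> j0 fx.
have ex : exists m, (0 < m)%N && `[< iter m f x = x >].
  by exists j; rewrite j0 /=; exact/asboolP.
have [m /andP[m0 /asboolP fm] mmin] := find_ex_minn ex.
exists m; first by apply: mmin; rewrite j0 /=; exact/asboolP.
split=> // i /andP[i0 im] fi; move: im; rewrite ltnNge => /negP; apply.
by apply: mmin; rewrite i0 /=; exact/asboolP.
Qed.

Lemma period_dvd f x m j : point_period f x m -> (iter j f x = x <-> (m %| j)%N).
Proof.
move=> [m0 fm mmin].
have itm q : iter (q * m) f x = x.
  by elim: q => [//|q IH]; rewrite mulSn iterD IH.
split; last by move=> /dvdnP[q ->]; exact: itm.
rewrite {1}(divn_eq j m) addnC iterD itm => fr.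
rewrite /dvdn; case: (posnP (j %% m)%N) => [//|r0].
by case: (mmin _ _ fr); rewrite r0 ltn_mod.
Qed.

Lemma point_period_iter f x m b : injective f -> point_period f x m -> point_period f (iter b f x) m.
Proof.
move=> fi [m0 fm mmin].
have bi : injective (iter b f) by elim: b => [//|b IH] u v /= /fi /IH.
split=> //; first by rewrite -iterD addnC iterD fm.
by move=> j jm; rewrite -iterD addnC iterD => /bi; exact: mmin.
Qed.

Lemma orbit_of_iter f x m y : point_period f x m -> orbit_of f x y ->
  exists2 b, (b < m)%N & y = iter b f x.
Proof.
move=> [m0 fm mmin] [j ->]; exists (j %% m)%N; first by rewrite ltn_mod.
rewrite {1}(divn_eq j m) addnC iterD; congr iter.
by elim: (j %/ m)%N => [//|q IH]; rewrite mulSn iterD IH.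
Qed.

End Periods.

Lemma card_bij (S Q : finType) (h : S -> Q) : injective h -> (forall z, exists s, h s = z) ->
  #|S| = #|Q|.
Proof.
move=> hi hs; rewrite -(card_codom hi); apply: eq_card => z.
by have [s <-] := hs z; rewrite codom_f.
Qed.

Section Counting.
Context {R : realType}.
Variables (f : torus R -> torus R) (n : nat) (F : plane R -> plane R) (A P : 'M[R]_2) (c : int).
Hypotheses (n0 : (0 < n)%N) (fn : iter n f =1 id) (fF : torus_lift f F A).
Hypothesis P0 : 0 < \det P.
Hypothesis PA : forall v, lin P (lin A v) = rotation (2 * pi * c%:~R / n%:R) (lin P v).
Variables (N : nat) (xs : 'I_N -> torus R) (ns : 'I_N -> nat).
Hypothesis xsP : forall i, point_period f (xs i) (ns i).
Hypothesis orbits : forall y, Bbar n f y -> exists! i, orbit_of f (xs i) y.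

(** The sum is the number of fixed points of [f^j], since an orbit consists of such points exactly
    when its period divides [j]. *)
Lemma count_fixed j m : (0 < j < n)%N -> (forall z : int, c * j%:Z <> n%:Z * z) ->
  lattice_index (A ^+ j - 1%:M) m ->
  (\sum_(i < N) (if ns i %| j then ns i else 0) = m)%N.
Proof.
move=> /andP[j0 jn] cj [Q [q [Qm qs qE]]].
have fi := iter_inj n0 fn.
have [_ _ FE Fk] := torus_lift_iter fF j.
pose g i := if (ns i %| j)%N then ns i else 0%N.
have jl v := iter_lattice fF j v.
have [lft lftE] : exists lft : torus R -> plane R, forall x, torus_proj (lft x) = x.
  by exists repr => x; exact: reprK.
(* An element of [S] names a fixed point of [f^j] by its orbit and its position there; orbits of
   other periods contribute an empty type. *)
pose S := {i : 'I_N & 'I_(g i)}.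
pose pt (s : S) : torus R := iter (tagged s) f (xs (tag s)).
have ptj s : iter j f (pt s) = pt s /\ (ns (tag s) %| j)%N.
  case: s => i b; rewrite /pt /=; move: b; rewrite /g; case: ifP => [ij b|_ []//].
  by split=> //; apply/(period_dvd j (point_period_iter b fi (xsP i))).
have BB y : iter j f y = y -> Bbar n f y.
  by move=> /(least_period j0)[m' m'j ym]; exists m' => //; exact: leq_ltn_trans jn.
pose dsp v := iter j F v - v.
have dspZ s : lattice (dsp (lft (pt s))).
  by apply/jl; rewrite lftE; have [] := ptj s.
(* If the displacements differ by [(A^j - 1) l], then [u] and [v + l] have the same displacement and
   so coincide. *)
have key u v : lattice (dsp u) -> lattice (dsp v) ->
    (q (dsp u) = q (dsp v) <-> torus_proj u = torus_proj v).
  move=> uZ vZ; rewrite (qE _ _ uZ vZ); split.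
    move=> [l lZ]; rewrite lin_subM lin1 => e.
    have -> : u = v + l; last by rewrite torus_proj_shift.
    apply: (lift_fixed_unique n0 fn fF P0 PA cj uZ); first by rewrite /dsp addrC subrK.
    rewrite Fk //; apply/eqP; rewrite -subr_eq0; apply/eqP.
    have -> : dsp u = dsp v + (lin (A ^+ j) l - l) by rewrite -e addrC subrK.
    by rewrite /dsp; apply: plane_eq => /=; ring.
  move=> /torus_projE uvZ; exists (u - v) => //.
  have -> : u = v + (u - v) by rewrite addrC subrK.
  rewrite /dsp Fk // lin_subM lin1 [v + (u - v)]addrC subrK.
  by apply: plane_eq => /=; ring.
have -> : (\sum_(i < N) g i = #|{: S}|)%N.
  rewrite card_tagged sumnE big_map big_enum /=.
  by apply: eq_bigr => i _; rewrite card_ord.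
rewrite -Qm; apply: (@card_bij _ _ (fun s => q (dsp (lft (pt s))))).
  move=> s s' /(key _ _ (dspZ s) (dspZ s')); rewrite !lftE => ss.
  have [i is1 is2] : exists2 i, i = tag s & i = tag s'.
    have [i [_ iu]] := orbits (BB _ (ptj s).1); exists i; apply: iu.
      by exists (tagged s : nat).
    by exists (tagged s' : nat); rewrite ss.
  have [_ pj] := ptj s.
  move: ss pj is1 is2; rewrite /pt; case: s => i1 b1; case: s' => i2 b2 /= ss pj e1 e2.
  move: b2 ss; rewrite -e2 => b2 {e2}; move: b1 pj; rewrite -e1 => b1 pj {e1} ss.
  congr existT; apply/val_inj/eqP => /=.
  have lt (b : 'I_(g i)) : (b < ns i)%N by case: b => b /=; rewrite /g pj.
  have [_ _ mmin] := xsP i.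
  have bi b : injective (iter b f) by elim: b => [//|b IH] u v /= /fi /IH.
  have no (b b' : 'I_(g i)) : (b < b')%N -> iter b f (xs i) = iter b' f (xs i) -> False.
    move=> bb; rewrite -(subnKC (ltnW bb)) iterD => /bi /esym; apply: mmin.
    by rewrite subn_gt0 bb /=; apply: leq_ltn_trans (lt b'); exact: leq_subr.
  by case: ltngtP => // bb; [case: (no _ _ bb)|case: (no _ _ bb)].
(* Surjectivity: any [k] is the displacement of some [v], and the point below [v] lies on a listed
   orbit. *)
move=> z; have [k kZ kz] := qs z.
have [v vE] := lift_fixed n0 fF P0 PA k cj.
have dv : dsp v = k by rewrite /dsp vE addrC addKr.
have vj : iter j f (torus_proj v) = torus_proj v by apply/jl; rewrite -/(dsp v) dv.
have [i [iv _]] := orbits (BB _ vj).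
have [b bn vb] := orbit_of_iter (xsP i) iv.
have ij : (ns i %| j)%N.
  by apply/(period_dvd j (point_period_iter b fi (xsP i))); rewrite -vb.
have bg : (b < g i)%N by rewrite /g ij.
exists (existT (fun i => 'I_(g i)) i (Ordinal bg)).
rewrite -kz -dv; apply/key; first exact: dspZ.
  by rewrite dv.
by rewrite lftE vb.
Qed.

End Counting.

(** * The admissible orders *)

Section Traces.
Context {R : realType}.
Implicit Types A : 'M[R]_2.

Lemma cayley2 A : A ^+ 2 = \tr A *: A - \det A *: 1%:M.
Proof.
rewrite expr2 -mulmxE det2 /mxtrace sum2.
by apply/matrixP; do 2 apply: ord2P; rewrite !mxE !sum2 /=; ring.
Qed.

Lemma mxtrace1 : \tr (1%:M : 'M[R]_2) = 2.
Proof. by rewrite mxtrace_scalar. Qed.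

Lemma exprSS A j : \det A = 1 -> A ^+ j.+2 = \tr A *: A ^+ j.+1 - A ^+ j.
Proof.
move=> d1; rewrite !exprS mulrA -[A * A]expr2 cayley2 d1 scale1r mulrBl -scalerAl.
by rewrite [1%:M * _]mul1r.
Qed.

Lemma tr_exprSS A j : \det A = 1 -> \tr (A ^+ j.+2) = \tr A * \tr (A ^+ j.+1) - \tr (A ^+ j).
Proof. by move=> /(exprSS j) ->; rewrite mxtraceD mxtraceZ (raddfN (@mxtrace R 2)). Qed.

Lemma det_sub1 A : \det A = 1 -> \det (A - 1%:M) = 2 - \tr A.
Proof. by rewrite !det2 /mxtrace sum2 !mxE /= => d1; move: d1; set a := A 0 0; lra. Qed.

(** By Cayley-Hamilton the traces of the powers obey a recurrence governed by [tr A]. The trace is 2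
    at exponent [n] and at no smaller positive one, so each value of [t] determines [n]. *)
Lemma finite_order_cases A n (t : int) : (1 < n)%N -> \det A = 1 -> \tr A = t%:~R -> A ^+ n = 1 ->
  (forall j, (0 < j < n)%N -> \tr (A ^+ j) != 2) -> (-2 <= t <= 2) -> (t = -2 -> A = - 1) ->
  [\/ n = 2%N /\ A = - 1, n = 3%N /\ \tr A = -1, n = 4%N /\ \tr A = 0 | n = 6%N /\ \tr A = 1].
Proof.
move=> n1 d1 trA An Aj t2 tm2.
have T j := tr_exprSS j d1.
have T0 : \tr (A ^+ 0) = 2 by rewrite expr0 mxtrace1.
have T1 : \tr (A ^+ 1) = \tr A by rewrite expr1.
have T2 : \tr (A ^+ 2) = \tr A * \tr A - 2 by rewrite T T0 T1.
have T3 := T 1%N; have T4 := T 2%N; have T5 := T 3%N; have T6 := T 4%N.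
rewrite T1 T2 in T3; rewrite T2 T3 in T4; rewrite T3 T4 in T5; rewrite T4 T5 in T6.
have Tn : \tr (A ^+ n) = 2 by rewrite An mxtrace1.
have up j : (0 < j)%N -> \tr (A ^+ j) = 2 -> (n <= j)%N.
  by move=> j0 Tj; rewrite leqNgt; apply/negP => jn; have := Aj j; rewrite j0 jn Tj eqxx => /(_ isT).
have : t = -2 \/ t = -1 \/ t = 0 \/ t = 1 \/ t = 2 by lia.
case=> [tE|[tE|[tE|tE]]]; rewrite ?tE in trA.
- have A1 := tm2 tE; constructor 1; split=> //; apply/eqP; rewrite eqn_leq n1 andbT.
  by apply: up => //; rewrite T2 trA; ring.
- constructor 2; rewrite trA; split; last by [].
  have n3 : (n <= 3)%N by apply: up => //; rewrite T3 trA; ring.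
  by case: n n1 n3 Tn {An Aj up} => [|[|[|[|//]]]] // _ _; rewrite T2 trA => T'; exfalso; lra.
- constructor 3; rewrite trA; split; last by [].
  have n4 : (n <= 4)%N by apply: up => //; rewrite T4 trA; ring.
  by case: n n1 n4 Tn {An Aj up} => [|[|[|[|[|//]]]]] // _ _; rewrite ?T2 ?T3 trA => T'; exfalso; lra.
- case: tE => tE; rewrite tE in trA.
    constructor 4; rewrite trA; split; last by [].
    have n6 : (n <= 6)%N by apply: up => //; rewrite T6 trA; ring.
    by case: n n1 n6 Tn {An Aj up} => [|[|[|[|[|[|[|//]]]]]]] // _ _; rewrite ?T2 ?T3 ?T4 ?T5 trA => T'; exfalso; lra.
  by have := Aj 1%N; rewrite n1 T1 trA eqxx => /(_ isT).
Qed.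

End Traces.

Lemma cat_nseq_nseq (T : Type) a b (e : T) : nseq a e ++ nseq b e = nseq (a + b) e.
Proof. by rewrite nseqD. Qed.

Lemma perm_three (T : eqType) (L : seq T) e1 e2 e3 :
  {in L, forall x, [\/ x = e1, x = e2 | x = e3]} ->
  exists a b c, perm_eq L (nseq a e1 ++ nseq b e2 ++ nseq c e3).
Proof.
elim: L => [|x L IH] H; first by exists 0%N, 0%N, 0%N.
have [y yL|a [b [c p]]] := IH; first by apply: H; rewrite in_cons yL orbT.
have [->|->|->] := H x (mem_head _ _).
- by exists a.+1, b, c; rewrite /= perm_cons.
- exists a, b.+1, c; rewrite /= -cat1s perm_sym -[e2 :: _ ++ _]cat1s perm_catCA /= perm_cons.
  by rewrite perm_sym.
- exists a, b, c.+1; rewrite catA /= -cat1s perm_sym -[e3 :: nseq c e3]cat1s perm_catCA /= perm_cons.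
  by rewrite -catA perm_sym.
Qed.

Lemma sum_three (T : eqType) (L : seq T) e1 e2 e3 a b c (F : T -> nat) :
  perm_eq L (nseq a e1 ++ nseq b e2 ++ nseq c e3) ->
  (\sum_(x <- L) F x = a * F e1 + b * F e2 + c * F e3)%N.
Proof.
move=> p; rewrite (perm_big _ p) !big_cat /= addnA.
have H k e : (\sum_(x <- nseq k e) F x = k * F e)%N.
  by elim: k => [|k IH]; rewrite /= ?big_nil // big_cons IH mulSn.
by rewrite !H.
Qed.

(** What is known of a pair [(n_i, d_i)] once the linear part rotates by [d0 / n] turns: [d_i]
    inverts [d0] modulo [n / n_i]. *)
Definition orbit_entry (n d0 : nat) (x : nat * nat) : bool :=
  [&& (x.1 %| n)%N, (0 < x.1 < n)%N, (0 < x.2 < n %/ x.1)%N &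
      (x.2 * d0 == 1 %[mod n %/ x.1])%N].

(** By [count_fixed], the number of fixed points of the [j]-th power. *)
Definition fixed_sum (j : nat) (L : seq (nat * nat)) : nat :=
  (\sum_(x <- L) if (x.1 %| j)%N then x.1 else 0)%N.

(** For each period the congruence admits only one [d], so only the multiplicities of the periods
    remain, and the numbers of fixed points give these. *)
Lemma orbit_entries_cases n d0 (L : seq (nat * nat)) : (0 < d0 < n)%N -> coprime d0 n ->
  {in L, forall x, orbit_entry n d0 x} ->
  [\/ n = 2 /\ fixed_sum 1 L = 4, n = 3 /\ fixed_sum 1 L = 3,
      [/\ n = 4, fixed_sum 1 L = 2 & fixed_sum 2 L = 4] |
      [/\ n = 6, fixed_sum 1 L = 1, fixed_sum 2 L = 3 & fixed_sum 3 L = 4] ]%N ->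
  exists i : 'I_7, same_characteristic (Characteristic n 1 L) (tnth kappas i).
Proof.
move=> dn cd LH.
have pick (i : nat) (i7 : (i < 7)%N) k : k = tnth kappas (Ordinal i7) ->
    same_characteristic (Characteristic n 1 L) k ->
    exists i : 'I_7, same_characteristic (Characteristic n 1 L) (tnth kappas i).
  by move=> -> H; exists (Ordinal i7).
(* When fewer than three pairs are admissible, an entry is repeated. *)
have three e1 e2 e3 : (forall x, orbit_entry n d0 x -> [\/ x = e1, x = e2 | x = e3]) ->
    exists a b c, perm_eq L (nseq a e1 ++ nseq b e2 ++ nseq c e3).
  by move=> H; apply: perm_three => x /LH/H.
case=> [[nE s1]|[nE s1]|[nE s1 s2]|[nE s1 s2 s3]]; subst n.
- have d1 : d0 = 1%N by lia.
  subst d0; have [|a [b [c p]]] := three (1, 1)%N (1, 1)%N (1, 1)%N.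
    by move=> [[|[|u]] [|[|v]]] /and4P[] /=; try lia; constructor 1.
  have := s1; rewrite /fixed_sum (sum_three _ p) /= !muln1 => abc.
  apply: (pick 0%N isT _ erefl); split=> //=; apply: perm_trans p _.
  by rewrite !cat_nseq_nseq addnA abc.
(* Every unit modulo 3, 4 or 6 is its own inverse, so a fixed point has [d = d0]. *)
- have [|a [b [c p]]] := three (1, d0)%N (1, d0)%N (1, d0)%N.
    move=> [[|[|[|u]]] v] /and4P[] /=; try lia; rewrite divn1 => _ _ v3 vd; constructor 1.
    by move: d0 v dn v3 vd {cd LH three pick} => [|[|[|d0]]] [|[|[|v]]] //=; lia.
  have := s1; rewrite /fixed_sum (sum_three _ p) /= !muln1 => abc.
  rewrite !cat_nseq_nseq addnA abc in p.
  case: d0 dn {cd LH three} p => [|[|[|d0]]] //= _ p.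
    by apply: (pick 1%N isT _ erefl).
  by apply: (pick 2%N isT _ erefl).
- have [|a [b [c p]]] := three (2, 1)%N (1, d0)%N (1, d0)%N.
    move=> [u v] /and4P[] /= u4 un vn vd.
    have : u = 1%N \/ u = 2%N.
      by case: u u4 un {vn vd} => [|[|[|[|u]]]] //=; [left|right].
    case=> uE; subst u; [constructor 2|constructor 1].
      rewrite divn1 in vn vd.
      by move: d0 v dn cd vn vd {LH three pick} => [|[|[|[|d0]]]] [|[|[|[|v]]]] //=; lia.
    by case: v vn {vd} => [|[|v]] //=; lia.
  have := s1; rewrite /fixed_sum (sum_three _ p) /= !muln1 !muln0 add0n => bc.
  have := s2; rewrite /fixed_sum (sum_three _ p) /= !muln1 => abc.
  have aE : a = 1%N by lia.
  rewrite cat_nseq_nseq bc aE in p.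
  case: d0 dn cd {LH three} p => [|[|[|[|d0]]]] //= _ _ p.
    by apply: (pick 5%N isT _ erefl).
  by apply: (pick 6%N isT _ erefl).
(* Period 2 has lambda 3, where the inverse of [d0] is [d0 %% 3]; period 3 has lambda 2, which
   forces 1. *)
- have [|a [b [c p]]] := three (3, 1)%N (2, d0 %% 3)%N (1, d0)%N.
    move=> [u v] /and4P[] /= u6 un vn vd.
    have : u = 1%N \/ u = 2%N \/ u = 3%N.
      by case: u u6 un {vn vd} => [|[|[|[|[|[|u]]]]]] //=; [left|right; left|right; right].
    case=> [uE|[uE|uE]]; subst u; [constructor 3|constructor 2|constructor 1].
    + rewrite divn1 in vn vd.
      by move: d0 v dn cd vn vd {LH three pick} => [|[|[|[|[|[|d0]]]]]] [|[|[|[|[|[|v]]]]]] //=; lia.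
    + by move: d0 v dn cd vn vd {LH three pick} => [|[|[|[|[|[|d0]]]]]] [|[|[|v]]] //=; lia.
    + by case: v vn {vd} => [|[|v]] //=; lia.
  have := s1; rewrite /fixed_sum (sum_three _ p) /= !muln1 !muln0 !add0n => cE.
  have := s2; rewrite /fixed_sum (sum_three _ p) /= !muln1 !muln0 !add0n => bE.
  have := s3; rewrite /fixed_sum (sum_three _ p) /= !muln1 !muln0 !addn0 => aE.
  have [a1 b1] : a = 1%N /\ b = 1%N by lia.
  rewrite a1 b1 cE in p.
  case: d0 dn cd {LH three} p => [|[|[|[|[|[|d0]]]]]] //= _ _ p.
    by apply: (pick 3%N isT _ erefl).
  by apply: (pick 4%N isT _ erefl).
Qed.

Section Forward.
Context {R : realType}.

Lemma periodic_torus_lift (f : torus R -> torus R) n : continuous f -> orientation_preserving f ->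
  (0 < n)%N -> iter n f =1 id -> exists F (A : 'M[R]_2),
  [/\ torus_lift f F A, A ^+ n = 1%:M & 0 < \det A].
Proof.
move=> fc fo n0 fn; have [F [A fF]] := torus_lift_exists fc; exists F, A.
have fFn := torus_lift_iter fF n.
have kZ : lattice (iter n F 0 - 0) by apply/(iter_lattice fF); rewrite fn.
have An : A ^+ n = 1%:M.
  have [//|_ ->//] := torus_lift_id (torus_lift_sub fFn kZ) (p := 0) fn.
  by rewrite subr0 subrr.
have A0 : \det A != 0.
  apply/eqP => A0; have /eqP : \det (A ^+ n) = 0.
    by rewrite -(prednK n0) exprS -mulmxE det_mulmx A0 mul0r.
  by rewrite An det1 oner_eq0.
split=> //; apply: (torus_lift_orientation fF _ A0 fo).
exact: iter_inj n0 fn.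
Qed.

Lemma periodic_characteristic (f : torus R -> torus R) n kappa : homeomorphism f ->
  orientation_preserving f -> periodic_of_period n f -> Bbar n f !=set0 ->
  complete_characteristic n f kappa ->
  exists i : 'I_7, same_characteristic kappa (tnth kappas i).
Proof.
move=> [_ [fc _ _ _]] fo [n0 fn nmin] [x0 x0B] [kn kg [xs [xsB orb inv]]].
have [F [A [fF An A0]]] := periodic_torus_lift fc fo n0 fn.
have [P [c [P0 PA]]] := finite_order_conj n0 An A0.
have fi := iter_inj n0 fn.
set L := orbit_data kappa in xs xsB orb inv *.
pose ns i := (tnth (in_tuple L) i).1.
have per i : point_period f (tnth xs i) (ns i) by have [] := inv i.
have nsn i : (ns i %| n)%N by apply/(period_dvd n (per i)).
have ns_lt i : (0 < ns i < n)%N.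
  have [ns0 _ _] := per i; rewrite ns0 /=.
  have [m mn [m0 fm _]] := xsB i; apply: leq_ltn_trans mn.
  by rewrite dvdn_leq //; apply/(period_dvd m (per i)).
have cdelta i (d : nat) : locally_rotation f (tnth xs i) (ns i) d (n %/ ns i) ->
    exists z : int, c = d%:Z + (n %/ ns i)%N%:Z * z.
  have [ns0 fx _] := per i.
  exact: (local_rotation_angle n0 fn fF P0 PA (nsn i) ns0 fx).
have nl i : n%:Z = (n %/ ns i)%N%:Z * (ns i)%:Z by rewrite -PoszM divnK.
(* At a point of [Bbar], [c] is congruent to a nonzero delta modulo lambda, a divisor of [n]; so [c]
   is not a multiple of [n]. *)
have c1 (z : int) : c * 1%:Z <> n%:Z * z.
  have [i _] := orb _ x0B; have [_ _ [d [dl _ /cdelta[w cE] _]]] := inv i.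
  rewrite mulr1 (nl i) cE; set l := (n %/ ns i)%N in dl *; move=> /eqP.
  rewrite -subr_eq0 -mulrA -addrA -mulrBr => /eqP; set q := w - _ => dq.
  have : (l%:Z %| d%:Z)%Z by apply/dvdzP; exists (- q); lia.
  by rewrite dvdzE /= => /dvdn_leq; lia.
have n1 : (1 < n)%N by have [i _] := orb _ x0B; have := ns_lt i; lia.
(* Thus [F] itself has a fixed point. The point below has period 1, so its lambda is [n] and its
   delta is a unit [d0] congruent to [c] modulo [n]. *)
have [v vE] := lift_fixed n0 fF P0 PA 0 c1.
have fy : f (torus_proj v) = torus_proj v.
  by apply/(iter_lattice fF 1); rewrite vE addr0 subrr lattice0.
have yper : point_period f (torus_proj v) 1.
  by split=> // j; lia.
have [d0 [d0n d0c [z0 cE]]] : exists d0 : nat, [/\ (0 < d0 < n)%N, coprime d0 n &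
    exists z0 : int, c = d0%:Z + n%:Z * z0].
  have [i [iy _]] : exists! i, orbit_of f (tnth xs i) (torus_proj v) by apply: orb; exists 1%N.
  have [b _ yb] := orbit_of_iter (per i) iy.
  have ns1 : ns i = 1%N.
    apply/eqP; rewrite -dvdn1; apply/(period_dvd 1 (point_period_iter b fi (per i))).
    by rewrite -yb.
  have [_ _ [d [dl dc /cdelta dr _]]] := inv i; rewrite -/(ns i) in dl dc.
  by rewrite ns1 divn1 in dl dc dr; exists d.
(* As [d0] is a unit modulo [n], no power [A^j] with [0 < j < n] is a trivial rotation, and
   [count_fixed] is available for all these [j]. *)
have cj j : (0 < j < n)%N -> forall z : int, c * j%:Z <> n%:Z * z.
  move=> jn z e; have : (n%:Z %| (d0 * j)%N%:Z)%Z.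
    apply/dvdzP; exists (z - z0 * j%:Z); rewrite PoszM mulrBl [z * _]mulrC -e cE; ring.
  rewrite dvdzE => nj; have : (n %| d0 * j)%N by exact: nj.
  by rewrite Gauss_dvdr 1?coprime_sym // => /dvdn_leq; lia.
have [dA tA] := conj_det_tr (lt0r_neq0 P0) PA.
have detj := det_iter P0 PA.
have trj j : (0 < j < n)%N -> \tr (A ^+ j) < 2.
  move=> jn; have [_ ->] := conj_det_tr (lt0r_neq0 P0) (conj_iter PA j).
  by rewrite -[X in _ < X]mulr1 ltr_pM2l //; apply: conj_angle_cos => //; exact: cj.
have [_ AZ _ _] := fF.
have [t tE] : exists t : int, \tr A = t%:~R.
  by apply/intrP; rewrite /mxtrace sum2 rpredD.
have LE : {in L, forall x, orbit_entry n d0 x}.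
  move=> x /(nthP (0, 0)%N)[i iL xE].
  have {xE} <- : tnth (in_tuple L) (Ordinal iL) = x by rewrite (tnth_nth (0, 0)%N).
  set i' := Ordinal iL; rewrite /orbit_entry -/(ns i') nsn ns_lt.
  have [_ dl [d [dl' _ /cdelta[w cE'] dd]]] := inv i'.
  rewrite -/(ns i') in dl dl' dd; rewrite dl /=.
  (* Both are congruent to [c] modulo lambda. *)
  have dd0 : d0 = d %[mod n %/ ns i'].
    have e : d0%:Z = (w - (ns i')%:Z * z0) * (n %/ ns i')%N%:Z + d%:Z.
      have := cE'; rewrite cE (nl i') => /eqP; rewrite addrC -subr_eq => /eqP <-; ring.
    have : (d0%:Z %% (n %/ ns i')%N%:Z)%Z = (d%:Z %% (n %/ ns i')%N%:Z)%Z by rewrite e modzMDl.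
    by rewrite !modz_nat => -[].
  by apply/eqP; rewrite -modnMmr dd0 modnMmr.
have sums j m : (0 < j < n)%N -> lattice_index (A ^+ j - 1%:M) m -> fixed_sum j L = m.
  move=> jn Ij.
  rewrite -(count_fixed n0 fn fF P0 PA per orb jn (cj j jn) Ij) /fixed_sum big_tnth.
  by apply: eq_bigr.
have intj j : integer_mx (A ^+ j - 1%:M).
  by move=> a b; rewrite !mxE rpredB //; [exact: integer_mxX|case: (_ == _); rewrite ?rpred1 ?rpred0].
have prime_sum j p : (0 < j < n)%N -> prime p -> \tr (A ^+ j) = 2 - p%:R -> fixed_sum j L = p.
  move=> jn pp tr; apply: sums jn _; apply: lattice_index_prime => //.
  by rewrite (det_sub1 (detj j)) tr; ring.
have := orbit_entries_cases d0n d0c LE.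
have -> : Characteristic n 1 L = kappa by rewrite -kn -kg /L; case: (kappa).
apply.
have T2 : \tr (A ^+ 2) = \tr A * \tr A - 2 by rewrite (tr_exprSS 0 dA) expr0 mxtrace1 expr1.
have [||||[nE A1]|[nE t1]|[nE t1]|[nE t1]] := @finite_order_cases R A n t n1 dA tE.
- by rewrite An.
- by move=> j /trj; case: ltgtP.
(* The integer trace is twice a cosine; the extreme value -2 means the angle pi, hence [A = -1]. *)
- have := cos_geN1 (2 * pi * c%:~R / n%:R : R); have := cos_le1 (2 * pi * c%:~R / n%:R : R).
  rewrite tE in tA; move=> H1 H2; apply/andP; split; rewrite -(ler_int R); lra.
- move=> t2; rewrite t2 in tE; have cosN1 : cos (2 * pi * c%:~R / n%:R) = -1 :> R by lra.
  have s0 : sin (2 * pi * c%:~R / n%:R) = 0 :> R by apply: cos1sin0; rewrite cosN1 normrN normr1.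
  apply: lin_inj => u; apply: (can_inj (fun v => linK v (lt0r_neq0 P0))).
  rewrite PA; apply: plane_eq; rewrite /= cosN1 s0 !mxE /=; ring.
- constructor 1; split=> //; apply: sums; first by rewrite nE.
  by rewrite expr1 A1; exact: lattice_index_opp2.
- constructor 2; split=> //; apply: prime_sum; [by rewrite nE|by []|].
  by rewrite expr1 t1; ring.
- constructor 3; split=> //.
    by apply: prime_sum; [rewrite nE| |rewrite expr1 t1; ring].
  apply: sums; first by rewrite nE.
  (* Trace 0 gives [A^2 = -1] by Cayley-Hamilton, so [A^2 - 1] is the matrix -2. *)
  by rewrite cayley2 t1 dA scale0r scale1r sub0r; exact: lattice_index_opp2.
- constructor 4; split=> //.
  + apply: sums; first by rewrite nE.
    by apply: lattice_index1 => //; rewrite (det_sub1 (detj _)) expr1 t1; ring.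
  + by apply: prime_sum; [rewrite nE| |rewrite T2 t1; ring].
  + apply: sums; first by rewrite nE.
    have -> : A ^+ 3 = - 1%:M; last exact: lattice_index_opp2.
    rewrite (exprSS 1 dA) (exprSS 0 dA) expr0 expr1 t1 !scale1r.
    by rewrite addrAC subrr add0r.
Qed.

End Forward.

(** * Linear torus maps *)

Section LinearTorusMap.
Context {R : realType}.
Implicit Types (u v w k p : plane R) (x y : torus R) (A P M : 'M[R]_2).

(** The projection is open, because the saturation of an open set is a union of lattice translates
    of it. *)
Lemma torus_proj_nbhs v (W : set (plane R)) : nbhs v W ->
  nbhs (torus_proj v) (@torus_proj R @` W).
Proof.
rewrite nbhsE => -[U [Uo Uv] UW].
rewrite nbhsE; exists (@torus_proj R @` U); last exact: image_subset.
split; last by exists v.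
rewrite /open /= /quotient_open openE => u /= [w Uw wu].
have kZ : lattice (w - u) by apply/torus_projE.
have : nbhs u ((fun z => z + (w - u)) @^-1` U).
  have shc : {for u, continuous (fun z : plane R => z + (w - u))}.
    by apply: cont_plane => /=; cts.
  by apply: shc; rewrite addrC subrK; exact: open_nbhs_nbhs.
apply: filterS => z Uz; exists (z + (w - u)) => //.
exact: torus_proj_shift.
Qed.

Lemma lin_orientation (G : plane R -> plane R) M u c (e : R) : 0 < \det M -> 0 < e ->
  (forall v, enorm (v - u) < e -> G v = lin M v + c) -> preserves_orientation_at G u.
Proof.
move=> M0 e0 GE; rewrite /preserves_orientation_at.
have re : \forall r \near (0 : R)^'+, r < e by exact: nbhs_right_lt.
have rp : \forall r \near (0 : R)^'+, 0 < r by exact: nbhs_right_gt.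
apply: filterS (filterI rp re) => r [r0 r1].
have GEr t : G (u + r *: cis t) = G u + r *: lin M (cis t).
  rewrite !GE; first by rewrite linD linZ addrAC.
    by rewrite subrr enorm0.
  by rewrite addrC addKr enorm_cis // ltW.
apply: (@winding_winds_once R (fun t => G (u + r *: cis t)) (G u)).
  move=> t; rewrite GEr -subr_eq0 addrC addKr scaler_eq0 negb_or gt_eqF //=.
  by apply: lin_neq0; [rewrite gt_eqF|exact: cis_neq0].
under eq_fun do rewrite GEr addrC addKr.
by apply: winding_scale => //; exact: winding_lin.
Qed.

Lemma enorm_rotation (a : R) v : enorm (rotation a v) = enorm v.
Proof.
congr Num.sqrt; rewrite /dot /=.
have := cos2Dsin2 a; set s := sin a; set t := cos a => st.
transitivity ((t ^+ 2 + s ^+ 2) * (v.1 * v.1 + v.2 * v.2)); first by ring.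
by rewrite st mul1r.
Qed.

(* Locked, so that unification never unfolds a composite of torus maps. *)
Definition torus_map A x : torus R := locked (torus_proj (lin A (repr x))).

Lemma torus_mapE A v : integer_mx A -> torus_map A (torus_proj v) = torus_proj (lin A v).
Proof.
move=> AZ; rewrite /torus_map -lock; apply/torus_projE; rewrite -linB; apply: lattice_lin => //.
by apply/torus_projE; exact: reprK.
Qed.

Lemma torus_map_lift A : integer_mx A -> torus_lift (torus_map A) (lin A) A.
Proof.
move=> AZ; split=> //; first exact: lin_cont.
  by move=> v; rewrite torus_mapE.
by move=> v k _; rewrite linD.
Qed.

Lemma torus_map_cont A : integer_mx A -> continuous (torus_map A).
Proof.
move=> AZ; apply/quotient_continuous.
rewrite (_ : _ \o _ = @torus_proj R \o lin A); last by apply/funext => v; exact: torus_mapE.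
move=> v; apply: (@cont_comp _ _ _ (lin A) (@torus_proj R) v (@lin_cont R A v)).
exact: torus_proj_cont.
Qed.

Lemma torus_map_iter A j : integer_mx A -> iter j (torus_map A) =1 torus_map (A ^+ j).
Proof.
move=> AZ x; have [v <-] := torus_projK x; rewrite torus_mapE; last exact: integer_mxX.
elim: j => [|j IH]; first by rewrite expr0 lin1.
by rewrite iterS IH torus_mapE // exprS -mulmxE lin_mul.
Qed.

Section FiniteOrderMap.
Variables (A P : 'M[R]_2) (n d : nat).
Hypotheses (AZ : integer_mx A) (n0 : (0 < n)%N) (An : A ^+ n = 1%:M) (P0 : 0 < \det P).
Hypotheses (PA : forall v, lin P (lin A v) = rotation (2 * pi * d%:Z%:~R / n%:R) (lin P v)).
Hypothesis dn : coprime d n.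

Let f := torus_map A.

Lemma torus_map_order : iter n f =1 id.
Proof.
move=> x; rewrite torus_map_iter // An /torus_map -lock lin1; exact: reprK.
Qed.

Lemma torus_map_homeo : homeomorphism f.
Proof.
have An1 : integer_mx (A ^+ n.-1) by exact: integer_mxX.
exists (torus_map (A ^+ n.-1)); split; try exact: torus_map_cont.
  by move=> x; rewrite -torus_map_iter // -iterSr prednK // torus_map_order.
by move=> x; rewrite -torus_map_iter // -iterS prednK // torus_map_order.
Qed.

Lemma torus_map_orientation : orientation_preserving f.
Proof.
have [dA _] := conj_det_tr (lt0r_neq0 P0) PA.
move=> u; exists (lin A); split.
  apply: (@filterE _ (nbhs u) _) => v; split; first exact: lin_cont.
  by rewrite /f torus_mapE.
by apply: (@lin_orientation _ A u 0 1) => //; [rewrite dA|move=> v _; rewrite addr0].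
Qed.

Lemma torus_map_periodic : periodic_of_period n f.
Proof.
split; [by []|exact: torus_map_order|move=> m mn fm].
have L := torus_lift_iter (torus_map_lift AZ) m.
have [|_ A1] := torus_lift_id (p := 0) L fm.
  by elim: (m) => [//|i IH]; rewrite iterS IH lin0.
have := conj_angle_cos (R := R) n0 (j := m) (c := d%:Z).
have [_ ] := conj_det_tr (lt0r_neq0 P0) (conj_iter PA m).
rewrite A1 mxtrace1 => e1 c1; have : (2 : R) < 2; last by rewrite ltxx.
rewrite {1}e1 -[X in _ < X]mulr1 ltr_pM2l //; apply: c1 => z e.
have : (n%:Z %| (d * m)%N%:Z)%Z by apply/dvdzP; exists z; rewrite PoszM e mulrC.
rewrite dvdzE => nj; have : (n %| d * m)%N by exact: nj.
by rewrite Gauss_dvdr 1?coprime_sym // => /dvdn_leq; lia.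
Qed.

(** The chart inverts [torus_proj] on an ellipse [U] around [p] and then applies [v |-> P (v - p)],
    which makes [U] a disk and [A^m] a rotation. *)
Lemma torus_map_local_rotation p m : (m %| n)%N -> (0 < m)%N ->
  iter m f (torus_proj p) = torus_proj p ->
  locally_rotation f (torus_proj p) m (d %% (n %/ m)) (n %/ m).
Proof.
move=> mn m0 fp; set l := (n %/ m)%N; have nlm : n = (l * m)%N by rewrite divnK.
have l0 : (0 < l)%N by rewrite divn_gt0 // dvdn_leq.
have PN := lt0r_neq0 P0.
have [K K0 KP] := lin_bound (invmx P).
(* With this radius [U] stays within sup distance 1/2 of [p], so no two of its points differ by a
   nonzero lattice vector. *)
pose r := (2 * K)^-1; have r0 : 0 < r by rewrite invr_gt0 mulr_gt0.
pose U := [set v | enorm (lin P (v - p)) < r].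
have small v : enorm (lin P v) < r -> `|v| < 1 / 2.
  move=> vr; rewrite -(linK v PN); apply: le_lt_trans (KP _) _.
  have -> : 1 / 2 = K * r by rewrite /r; field; rewrite gt_eqF.
  by rewrite ltr_pM2l //; apply: le_lt_trans vr; exact: norm_le_enorm.
have Ulat v v' : U v -> U v' -> torus_proj v = torus_proj v' -> v = v'.
  move=> /small vU /small v'U /torus_projE vv; apply/eqP; rewrite -subr_eq0; apply/eqP.
  apply: lattice_small => //.
  rewrite (_ : v - v' = (v - p) - (v' - p)); last by rewrite opprB addrA subrK.
  by apply: le_lt_trans (ler_normB _ _) _; lra.
have lPc : continuous (fun v => lin P (v - p)).
  by have lc := @lin_cont R P; move=> v; cfor; apply: cont_plane => /=; cts.
have Uo v : U v -> nbhs v U.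
  move=> vU; have : {for v, continuous (fun v => enorm (lin P (v - p)))}.
    by apply: cont_enorm; exact: lPc.
  by move=> /cvgr_lt/(_ r vU).
pose D := @torus_proj R @` U.
pose h y := xget (0 : plane R) [set z | exists v, [/\ U v, torus_proj v = y & z = lin P (v - p)]].
have hE v : U v -> h (torus_proj v) = lin P (v - p).
  move=> vU; rewrite /h; case: xgetP => [z _ [v' [v'U v'v ->]]|/(_ (lin P (v - p)))].
    by rewrite (Ulat _ _ v'U vU v'v).
  by case; exists v.
have Dopen : open D.
  rewrite openE => y [v vU <-]; exact: torus_proj_nbhs (Uo v vU).
have pU : U p by rewrite /U /= subrr lin0 enorm0.
have diskE z : disk r z <-> enorm z < r.
  rewrite -(@ltr_pXn2r R 2 isT (enorm z) r (enorm_ge0 z) (ltW r0)).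
  by rewrite enormE /dot -!expr2.
pose g z := torus_proj (p + lin (invmx P) z).
have PK z : lin P (p + lin (invmx P) z - p) = z by rewrite addrC addKr linKV.
(* [2 pi d m / n = 2 pi d / l], and the quotient of [d] by [l] contributes whole turns only. *)
have AmE v : lin P (lin (A ^+ m) v) = rotation (2 * pi * (d %% l)%N%:R / l%:R) (lin P v).
  rewrite (conj_iter PA) -[in RHS](rotation_int (d %/ l)%N%:Z (lin P v)) rotationD; congr rotation.
  have dE : (d%:Z)%:~R = (d %/ l)%N%:R * l%:R + (d %% l)%N%:R :> R.
    by rewrite -natrM -natrD -divn_eq.
  rewrite intrM dE nlm natrM -[((d %/ l)%N%:Z)%:~R]/((d %/ l)%N%:R) -[(m%:Z)%:~R]/(m%:R).
  move: (2 * pi) (d %/ l)%N%:R (d %% l)%N%:R => t a b.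
  by field; rewrite !pnatr_eq0 -!lt0n m0 l0.
exists D, h, r; split.
- by split=> //; split=> //; exists p.
- exists g; split.
  + rewrite continuous_open_subspace // => y /set_mem[v vU <-].
    move=> V; rewrite hE // => Vv; rewrite /= /nbhs /=.
    have : nbhs v (U `&` (fun v => lin P (v - p)) @^-1` V).
      by apply: filterI; [exact: Uo|exact: lPc].
    move=> /torus_proj_nbhs; apply: filterS => y' [w [wU wV] <-].
    by rewrite /preimage /= hE.
  + apply: continuous_subspaceT => z; cfor.
    have lc := @lin_cont R (invmx P).
    apply: (@cont_comp _ _ _ (fun z => p + lin (invmx P) z) (@torus_proj R)).
      by apply: cont_plane => /=; cts.
    exact: torus_proj_cont.
  + move=> y [v vU <-]; rewrite hE //; split; first exact/diskE.
    by rewrite /g linK // addrC subrK.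
  + move=> z /diskE zr; have zU : U (p + lin (invmx P) z) by rewrite /U /= PK.
    by split; [exists (p + lin (invmx P) z)|rewrite /g hE].
(* A point [u] over [D] need not lie in [U]: the chart near it is computed at the lattice translate
   by [v - u]. *)
- move=> u [v vU vu]; have kZ : lattice (u - v) by apply/torus_projE.
  have [e e0 eU] : exists2 e : R, 0 < e & forall w, enorm (w - u) < e -> U (w - (u - v)).
    have /nbhs_ballP[e /= e0 eU] := Uo v vU; exists e => // w wu; apply: eU.
    rewrite -ball_normE /= distrC; apply: le_lt_trans (norm_le_enorm _) _.
    by rewrite opprB addrA addrAC addrK.
  apply: (@lin_orientation _ P u (- lin P (u - v + p)) e) => // w wu.
  rewrite /= -(subrK (u - v) w) torus_proj_shift // hE; last exact: eU.
  by rewrite subrK -linN -linD [in RHS]opprD [in RHS]addrA.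
- by rewrite hE // subrr lin0.
- move=> y [v vU <-]; have kZ : lattice (lin (A ^+ m) p - p).
    by apply/torus_projE; rewrite -torus_mapE -?torus_map_iter //; exact: integer_mxX.
  (* [A^m v] may lie far from [p]; [v'] is its translate by the lattice vector [p - A^m p], which
     brings it back into [U]. *)
  pose v' := p + lin (A ^+ m) (v - p).
  have vE : iter m f (torus_proj v) = torus_proj v'.
    rewrite torus_map_iter // torus_mapE; last exact: integer_mxX.
    apply/torus_projE; rewrite /v' linB.
    by rewrite (_ : _ - _ = lin (A ^+ m) p - p) //; apply: plane_eq => /=; ring.
  have v'E : lin P (v' - p) = rotation (2 * pi * (d %% l)%N%:R / l%:R) (lin P (v - p)).
    by rewrite /v' addrC addKr AmE.
  have v'U : U v' by rewrite /U /= v'E enorm_rotation.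
  by rewrite vE; split; [exists v'|rewrite !hE].
Qed.

End FiniteOrderMap.
End LinearTorusMap.

(** * Realization from a table of orbits *)

Section InversePeriods.
Context {T : Type}.
Variables (f : T -> T) (n : nat).
Hypotheses (n0 : (0 < n)%N) (fn : iter n f =1 id).

Lemma iter_mod_order m x : iter (m * n) f x = x.
Proof. by elim: m => [//|m IH]; rewrite mulSn iterD IH fn. Qed.

(** [iter n.-1 f] is the inverse of [f]. It has the same periods and orbits, so one orbit table
    serves both a matrix and its inverse. *)
Lemma iter_pred m x : iter m (iter n.-1 f) (iter m f x) = x.
Proof.
rewrite -iterM -iterD (_ : (m * n.-1 + m = m * n)%N); first exact: iter_mod_order.
by rewrite addnC -mulnS prednK.
Qed.

Lemma iter_pred_fixed m x : iter m (iter n.-1 f) x = x <-> iter m f x = x.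
Proof.
split=> fx; last by rewrite -{1}fx iter_pred.
rewrite -{1}fx -[in LHS]iterM -iterD (_ : (m + m * n.-1 = m * n)%N); first exact: iter_mod_order.
by rewrite -mulnS prednK.
Qed.

Lemma point_period_pred x m : point_period f x m -> point_period (iter n.-1 f) x m.
Proof.
move=> [m0 fm mmin]; split=> //; first exact/iter_pred_fixed.
by move=> j jm /iter_pred_fixed; exact: mmin.
Qed.

Lemma orbit_of_pred x y : orbit_of f x y -> orbit_of (iter n.-1 f) x y.
Proof.
move=> [a ->]; exists (a * n.-1)%N; rewrite -[in RHS](iter_pred a x) -iterD.
rewrite (_ : (a * n.-1 + a = a * n)%N); last by rewrite addnC -mulnS prednK.
rewrite -[in RHS]iterM (_ : (a * n * n.-1 = a * n.-1 * n)%N); last by rewrite mulnAC.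
by rewrite iter_mod_order.
Qed.

End InversePeriods.

Section Converse.
Context {R : realType}.
Implicit Types (f : torus R -> torus R) (u v : plane R).

(** The last clause keeps listed orbits apart: different periods already separate them, and in the
    tables below only fixed points share a period. *)
Definition orbit_table f n (pts : seq (plane R)) (ns : seq nat) := [/\ size pts = size ns,
  forall j, (j < size ns)%N -> point_period f (torus_proj (nth 0 pts j)) (nth 0%N ns j),
  forall v m, (0 < m < n)%N -> iter m f (torus_proj v) = torus_proj v ->
    exists2 j, (j < size ns)%N & orbit_of f (torus_proj (nth 0 pts j)) (torus_proj v) &
  forall j j', (j < size ns)%N -> (j' < size ns)%N -> j <> j' -> nth 0%N ns j = nth 0%N ns j' ->
    nth 0%N ns j = 1%N /\ torus_proj (nth 0 pts j) <> torus_proj (nth 0 pts j')].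

Lemma orbit_table_pred f n pts ns : (0 < n)%N -> iter n f =1 id ->
  orbit_table f n pts ns -> orbit_table (iter n.-1 f) n pts ns.
Proof.
move=> n0 fn [sz per cov dis]; split=> //.
  by move=> j /per; exact: point_period_pred.
move=> v m mn /(iter_pred_fixed n0 fn)/(cov _ _ mn)[j jn jv]; exists j => //.
exact: orbit_of_pred.
Qed.

Lemma orbit_table_uniq f n pts ns y : injective f -> orbit_table f n pts ns -> Bbar n f y ->
  exists2 j, (j < size ns)%N & orbit_of f (torus_proj (nth 0 pts j)) y /\
    forall j', (j' < size ns)%N -> orbit_of f (torus_proj (nth 0 pts j')) y -> j' = j.
Proof.
move=> fi [sz per cov dis] [m mn [m0 fm _]]; have [v vy] := torus_projK y.
have [||j jn jy] := cov v m; [by rewrite m0|by rewrite vy|].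
rewrite vy in jy; exists j => //; split=> // j' jn' j'y.
apply/eqP/negPn/negP => /eqP jj.
have [b bn yb] := orbit_of_iter (per _ jn) jy.
have [b' bn' yb'] := orbit_of_iter (per _ jn') j'y.
have e : nth 0%N ns j = nth 0%N ns j'.
  have [p1 p2] := (point_period_iter b fi (per _ jn), point_period_iter b' fi (per _ jn')).
  rewrite -yb in p1; rewrite -yb' in p2.
  have [_ f1 _] := p1; have [_ f2 _] := p2.
  by apply/eqP; rewrite eqn_dvd; apply/andP; split; [apply/(period_dvd _ p1)|apply/(period_dvd _ p2)].
have [n1 np] := dis _ _ jn jn' (fun h => jj (esym h)) e.
apply: np; move: bn bn' yb yb'; rewrite -e n1 !ltnS !leqn0 => /eqP -> /eqP -> /= <- <-.
by [].
Qed.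

Lemma table_characteristic (A P : 'M[R]_2) n d pts ndl kappa :
  integer_mx A -> (0 < n)%N -> A ^+ n = 1%:M -> 0 < \det P ->
  (forall v, lin P (lin A v) = rotation (2 * pi * d%:Z%:~R / n%:R) (lin P v)) -> coprime d n ->
  orbit_table (torus_map A) n pts (map fst ndl) -> all (orbit_entry n d) ndl ->
  same_characteristic kappa (Characteristic n 1 ndl) ->
  complete_characteristic n (torus_map A) kappa.
Proof.
move=> AZ n0 An P0 PA dn tab nd_ok [kn kg kp]; split=> //.
have fn := torus_map_order AZ An; have fi := iter_inj n0 fn.
have [sz per cov _] := tab; rewrite size_map in sz per cov.
set L := orbit_data kappa in kp *; rewrite /= in kp.
(* [Is] is the permutation of the table positions that brings [ndl] into the order chosen by
   [kappa]. *)
have /(perm_iotaP (0, 0)%N)[Is IsP LE] := kp.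
have szI : size Is = size L by rewrite LE size_map.
have nI (i : 'I_(size L)) : (nth 0%N Is i < size ndl)%N.
  have : nth 0%N Is i \in Is by rewrite mem_nth // szI.
  by rewrite (perm_mem IsP) mem_iota.
have xsz : size [seq (torus_proj (nth 0 pts j) : torus R) | j <- Is] == size L by rewrite size_map szI.
exists (Tuple xsz).
have xsE i : tnth (Tuple xsz) i = torus_proj (nth 0 pts (nth 0%N Is i)).
  by rewrite (tnth_nth (torus_proj 0)) /= (nth_map 0%N) // szI.
have ndE i : tnth (in_tuple L) i = nth (0, 0)%N ndl (nth 0%N Is i).
  by rewrite (tnth_nth (0, 0)%N) /= {1}LE (nth_map 0%N) // szI.
have nsE (i : 'I_(size L)) : nth 0%N (map fst ndl) (nth 0%N Is i) = (tnth (in_tuple L) i).1.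
  by rewrite ndE (nth_map (0, 0)%N).
have per' i : point_period (torus_map A) (tnth (Tuple xsz) i) (tnth (in_tuple L) i).1.
  by rewrite xsE -nsE; exact: per.
have ok i : orbit_entry n d (tnth (in_tuple L) i).
  by rewrite ndE; apply: (allP nd_ok); exact: mem_nth.
split.
- by move=> i; exists (tnth (in_tuple L) i).1; [case/and4P: (ok i) => _ /andP[]|exact: per'].
- move=> y yB; have [j jn [jy jU]] := orbit_table_uniq fi tab yB.
  rewrite size_map in jn jU.
  have jI : j \in Is by rewrite (perm_mem IsP) mem_iota.
  have iL : (index j Is < size L)%N by rewrite -szI index_mem.
  exists (Ordinal iL); split; first by rewrite xsE /= nth_index.
  move=> i'; rewrite xsE => /(jU _ (nI i')) e; apply/val_inj => /=.
  by rewrite -e index_uniq // ?szI // (perm_uniq IsP) iota_uniq.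
- move=> i; have /and4P[mn /andP[m0 mlt] dl /eqP dd] := ok i.
  set x := tnth (in_tuple L) i in mn m0 mlt dl dd *; set l := (n %/ x.1)%N in dl dd *.
  have ln : (l %| n)%N by rewrite /l dvdn_divLR // dvdn_mulr.
  have l1 : (1 < l)%N by lia.
  have cl : coprime (d %% l) l by rewrite coprime_modl; apply: coprime_dvdr dn.
  split=> //.
  exists (d %% l)%N; split=> //.
  + rewrite ltn_mod; apply/andP; split; last by lia.
    by rewrite lt0n; apply/eqP => dl0; move: cl; rewrite dl0 /coprime gcd0n; lia.
  + rewrite xsE; apply: (torus_map_local_rotation AZ n0 P0 PA) => //.
    by have [_ + _] := per' i; rewrite xsE.
  + by rewrite modnMmr.
Qed.

(** The exponents 1 and [n - 1] give [A] and its inverse. They are the only units modulo 3, 4 and 6,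
    whence the pairs of characteristics with equal periods. *)
Lemma table_realization (A P : 'M[R]_2) n pts ns :
  integer_mx A -> (1 < n)%N -> A ^+ n = 1%:M -> 0 < \det P ->
  (forall v, lin P (lin A v) = rotation (2 * pi * 1%:Z%:~R / n%:R) (lin P v)) ->
  orbit_table (torus_map A) n pts ns -> (0 < size ns)%N ->
  forall k ndl kappa, k = 1%N \/ k = n.-1 -> map fst ndl = ns -> all (orbit_entry n k) ndl ->
  same_characteristic kappa (Characteristic n 1 ndl) ->
  exists (f : torus R -> torus R) (n : nat),
      [/\ homeomorphism f, orientation_preserving f, periodic_of_period n f,
          Bbar n f !=set0 & complete_characteristic n f kappa].
Proof.
move=> AZ n1 An P0 PA tab ns0 k ndl kappa kE nsE ok kk.
have n0 := ltnW n1.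
have kn : coprime k n.
  case: kE => ->; first exact: coprime1n.
  by rewrite -{2}(prednK n0) coprimenS.
have AkZ := integer_mxX k AZ.
have Akn : (A ^+ k) ^+ n = 1%:M by rewrite exprAC An expr1n.
have PAk v : lin P (lin (A ^+ k) v) = rotation (2 * pi * k%:Z%:~R / n%:R) (lin P v).
  by rewrite (conj_iter PA) mul1r.
have tabk : orbit_table (torus_map (A ^+ k)) n pts ns.
  case: kE => ->; first by rewrite expr1.
  rewrite (_ : torus_map _ = iter n.-1 (torus_map A)).
    by apply: orbit_table_pred => //; exact: torus_map_order.
  by apply/funext => x; rewrite torus_map_iter.
exists (torus_map (A ^+ k)), n; split.
- exact: torus_map_homeo AkZ n0 Akn.
- exact: torus_map_orientation AkZ P0 PAk.
- exact: torus_map_periodic AkZ n0 Akn P0 PAk kn.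
- have [_ per _ _] := tabk; exists (torus_proj (nth 0 pts 0%N)); exists (nth 0%N ns 0%N); last exact: per.
  have : all (fun x => x < n)%N ns.
    by rewrite -nsE all_map; apply: sub_all ok => -[u w] /and4P[_ /andP[_ un] _ _].
  by move/allP; apply; exact: mem_nth.
- by apply: (table_characteristic AkZ n0 Akn P0 PAk kn (pts := pts) _ ok kk); rewrite nsE.
Qed.

End Converse.

(** * Companion matrices *)

Section Tables.
Context {R : realType}.
Implicit Types (u v : plane R).

Lemma proj_eq u v (i j : int) : u.1 = v.1 + i%:~R -> u.2 = v.2 + j%:~R ->
  torus_proj u = torus_proj v.
Proof.
move=> u1 u2; apply/torus_projE; apply/andP; split; rewrite /= ?u1 ?u2 addrC addKr; exact: intr_int.
Qed.

Lemma frac_not_int (x : R) (b : nat) (q : int) : x * b%:R = q%:~R -> ~~ (b%:Z %| q)%Z ->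
  x \isn't a Num.int.
Proof.
move=> xE; apply: contra => /intrP[z zE]; apply/dvdzP; exists z.
by apply/eqP; rewrite -(eqr_int R) -xE zE intrM.
Qed.

Lemma proj_neq1 u v (b : nat) (q : int) : (u.1 - v.1) * b%:R = q%:~R -> ~~ (b%:Z %| q)%Z ->
  torus_proj u <> torus_proj v.
Proof. by move=> e bq /torus_projE/andP[uv _]; move: (frac_not_int e bq); rewrite uv. Qed.

Lemma proj_neq2 u v (b : nat) (q : int) : (u.2 - v.2) * b%:R = q%:~R -> ~~ (b%:Z %| q)%Z ->
  torus_proj u <> torus_proj v.
Proof. by move=> e bq /torus_projE/andP[_ uv]; move: (frac_not_int e bq); rewrite uv. Qed.

Lemma half_int (x : R) : x * 2 \is a Num.int -> exists q : int, x = q%:~R \/ x = 1 / 2 + q%:~R.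
Proof.
move=> /intrP[z zE]; have : exists q : int, z = 2 * q \/ z = 1 + 2 * q.
  by exists (z %/ 2)%Z; have := divz_eq z 2; have := modz_ge0 z (isT : 2 != 0 :> int);
     have := ltz_mod z (isT : 2 != 0 :> int); lia.
case=> q [e|e]; exists q; [left|right]; move: zE; rewrite e ?intrD intrM; lra.
Qed.

Lemma third_int (x : R) : x * 3 \is a Num.int ->
  exists q : int, [\/ x = q%:~R, x = 1 / 3 + q%:~R | x = 2 / 3 + q%:~R].
Proof.
move=> /intrP[z zE]; have : exists q : int, z = 3 * q \/ z = 1 + 3 * q \/ z = 2 + 3 * q.
  by exists (z %/ 3)%Z; have := divz_eq z 3; have := modz_ge0 z (isT : 3 != 0 :> int);
     have := ltz_mod z (isT : 3 != 0 :> int); lia.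
case=> q [e|[e|e]]; exists q; [constructor 1|constructor 2|constructor 3];
  move: zE; rewrite e ?intrD intrM; lra.
Qed.

(** Multiplication by a root [zeta] of [X^2 - t X + 1], in the basis [1, zeta]. *)
Definition companion (t : int) : 'M[R]_2 := imx 0 (-1) 1 t.

Lemma imx_int a b c d : integer_mx (imx a b c d : 'M[R]_2).
Proof. by move=> i j; rewrite mxE intr_int. Qed.

Lemma imx_map a b c d (x y : R) : torus_map (imx a b c d) (torus_proj (x, y)) =
  torus_proj (a%:~R * x + b%:~R * y, c%:~R * x + d%:~R * y).
Proof. by rewrite torus_mapE; [rewrite /lin !mxE|exact: imx_int]. Qed.

Lemma companion_conj (t : int) n : (1 < n)%N -> 2 * cos (2 * pi / n%:R) = t%:~R :> R ->
  0 < sin (2 * pi / n%:R) :> R ->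
  exists2 P : 'M[R]_2, 0 < \det P & forall v, lin P (lin (companion t) v) =
    rotation (2 * pi * 1%:Z%:~R / n%:R) (lin P v).
Proof.
move=> n1; rewrite mulr1; set c := cos _; set s := sin _ => ct s0.
have cs : c ^+ 2 + s ^+ 2 = 1 by exact: cos2Dsin2.
(* This sends [(x, y)] to [x + y zeta] in the complex plane, where [zeta = exp (2 pi i / n)]. *)
exists (\matrix_(i, j) if i == 0 then (if j == 0 then 1 else c) else (if j == 0 then 0 else s)).
  by rewrite det2 !mxE /= mul1r mulr0 subr0.
move=> [x y]; apply: plane_eq; rewrite /= !mxE /= -/c -/s -ct.
  apply/eqP; rewrite -subr_eq0; apply/eqP.
  by transitivity ((c ^+ 2 + s ^+ 2 - 1) * y); [ring|rewrite cs subrr mul0r].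
ring.
Qed.

Lemma trig3 : [/\ 2 * cos (2 * pi / 3%:R) = (-1)%:~R :> R & 0 < sin (2 * pi / 3%:R) :> R].
Proof.
set a := 2 * pi / 3%:R.
have a3 : a *+ 2 + a = pi *+ 2 by rewrite -mulrSr -[a *+ 3]mulr_natr divfK ?pnatr_eq0 // mulr_natl.
have a0 : 0 < a < pi.
  rewrite divr_gt0 ?turn_gt0 //= ltr_pdivrMr ?ltr0n // mulrC ltr_pM2l ?pi_gt0 //.
  by rewrite ltr_nat.
have s0 : 0 < sin a by exact: sin_gt0_pi.
split=> //.
have : sin (a *+ 2 + a) = 0 by rewrite a3 sin2pi.
have : cos (a *+ 2 + a) = 1 by rewrite a3 cos2pi.
rewrite (cosD (a *+ 2) a) (sinD (a *+ 2) a) cos_mulr2n sin_mulr2n.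
have := cos2Dsin2 a; move: s0; set c := cos a; set s := sin a => s0 cs e1 e2.
(* From [sin (3 a) = 0] the cosine is 1/2 or -1/2; the value 1/2 would give [cos (3 a) = -1] instead
   of 1. *)
have /eqP : s * (4 * c ^+ 2 - 1) = 0 by rewrite -e2; ring.
rewrite mulf_eq0 gt_eqF //= => /eqP c4.
have : (2 * c - 1) * (2 * c + 1) = 0 by rewrite -[RHS]c4; ring.
move/eqP; rewrite mulf_eq0 => /orP[/eqP c1|/eqP c1]; last by rewrite mulrNz; lra.
have cE : c = 1 / 2 by lra.
have ss : s ^+ 2 = 3 / 4 by move: cs; rewrite cE; lra.
exfalso; move: e1; rewrite cE.
have -> : ((1 / 2) ^+ 2 *+ 2 - 1) * (1 / 2) - (1 / 2 * s) *+ 2 * s = - 1 / 4 - s ^+ 2 by field.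
by rewrite ss; lra.
Qed.

Lemma trig6 : [/\ 2 * cos (2 * pi / 6%:R) = 1%:~R :> R & 0 < sin (2 * pi / 6%:R) :> R].
Proof.
have [c3 s3] := trig3.
have aE : 2 * pi / 6%:R = pi - 2 * pi / 3%:R :> R by move: (@pi R) => p; field.
rewrite aE cosB sinB cospi sinpi !mul0r addr0 add0r mulN1r mulN1r opprK; split=> //.
by rewrite mulrN c3 mulrNz opprK.
Qed.

Lemma trig4 : [/\ 2 * cos (2 * pi / 4%:R) = 0%:~R :> R & 0 < sin (2 * pi / 4%:R) :> R].
Proof.
have -> : 2 * pi / 4%:R = pi / 2 :> R by move: (@pi R) => p; field.
by rewrite cos_pihalf sin_pihalf mulr0.
Qed.

Lemma companion_det t : \det (companion t) = 1.
Proof. by rewrite det_imx mul0r sub0r mulN1r opprK. Qed.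

Lemma companion_tr t : \tr (companion t) = t%:~R.
Proof. by rewrite /mxtrace sum2 !mxE /= add0r. Qed.

End Tables.

Section ConcreteTables.
Context {R : realType}.
Local Notation h := (1 / 2 : R).
Local Notation proj := (@torus_proj R).

Ltac map_eq i j := rewrite ?/companion ?iterS /= ?imx_map; apply: (@proj_eq R _ _ i j) => /=; by field.

Lemma lattice_eq (u v : plane R) : lattice u -> v.1 = u.1 -> v.2 = u.2 -> lattice v.
Proof. by move=> uZ v1 v2; rewrite (plane_eq v1 v2). Qed.

Lemma half_lattice (x y : R) : lattice ((x * 2, y * 2) : plane R) ->
  [\/ proj (x, y) = proj (0, 0), proj (x, y) = proj (h, 0),
      proj (x, y) = proj (0, h) | proj (x, y) = proj (h, h)].
Proof.
move=> /andP[/half_int[p xE] /half_int[q yE]].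
case: xE => xE; case: yE => yE;
  [constructor 1|constructor 3|constructor 2|constructor 4];
  by apply: (@proj_eq R _ _ p q); rewrite /= ?add0r.
Qed.

Lemma halves_neq : [/\ proj (0, 0) <> proj (h, 0), proj (0, 0) <> proj (0, h),
  proj (0, 0) <> proj (h, h) & [/\ proj (h, 0) <> proj (0, h),
  proj (h, 0) <> proj (h, h) & proj (0, h) <> proj (h, h)]].
Proof.
by split; [apply: (@proj_neq1 R _ _ 2 (-1))|apply: (@proj_neq2 R _ _ 2 (-1))|
  apply: (@proj_neq1 R _ _ 2 (-1))|split; [apply: (@proj_neq1 R _ _ 2 1)|
  apply: (@proj_neq2 R _ _ 2 (-1))|apply: (@proj_neq1 R _ _ 2 (-1))]] => //=; by field.
Qed.

Lemma fixed_period1 (T : Type) (f : T -> T) x : f x = x -> point_period f x 1.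
Proof. by move=> fx; split=> // j; case: j => [|[|j]]. Qed.

Lemma table2 : orbit_table (torus_map (imx (-1) 0 0 (-1) : 'M[R]_2)) 2
  [:: (0, 0); (h, 0); (0, h); (h, h)] [:: 1; 1; 1; 1]%N.
Proof.
have [n1 n2 n3 [n4 n5 n6]] := halves_neq.
split=> //.
- case=> [|[|[|[|//]]]] _ /=; apply: fixed_period1.
  + map_eq (0 : int) (0 : int).
  + map_eq (-1 : int) (0 : int).
  + map_eq (0 : int) (-1 : int).
  + map_eq (-1 : int) (-1 : int).
- move=> [x y] [|[|//]] // _; rewrite /= imx_map => /esym/torus_projE H.
  have {}H : lattice ((x * 2, y * 2) : plane R).
    by apply: lattice_eq H _ _ => /=; ring.
  by case: (half_lattice H) => ->; [exists 0%N|exists 1%N|exists 2%N|exists 3%N] => //; exists 0%N.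
- case=> [|[|[|[|//]]]] [|[|[|[|//]]]] //= _ _ _ _; split=> //; exact/nesym.
Qed.

Lemma table3 : orbit_table (torus_map (@companion R (-1))) 3
  [:: (0, 0); (2 / 3, 1 / 3); (1 / 3, 2 / 3)] [:: 1; 1; 1]%N.
Proof.
have n1 : proj (0, 0) <> proj (2 / 3, 1 / 3) by apply: (@proj_neq2 R _ _ 3 (-1)) => //=; by field.
have n2 : proj (0, 0) <> proj (1 / 3, 2 / 3) by apply: (@proj_neq1 R _ _ 3 (-1)) => //=; by field.
have n3 : proj (2 / 3, 1 / 3) <> proj (1 / 3, 2 / 3) by apply: (@proj_neq1 R _ _ 3 1) => //=; by field.
have f3 : iter 3 (torus_map (@companion R (-1))) =1 @id (torus R).
  move=> z; have [[x y] <-] := torus_projK z; map_eq (0 : int) (0 : int).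
split=> //.
- case=> [|[|[|//]]] _ /=; apply: fixed_period1.
  + map_eq (0 : int) (0 : int).
  + map_eq (-1 : int) (0 : int).
  + map_eq (-1 : int) (-1 : int).
- move=> v m m3 fm.
  (* The cube is the identity, so a point fixed by the square is fixed. *)
  have {m m3 fm} : torus_map (@companion R (-1)) (proj v) = proj v.
    case: m m3 fm => [|[|[|//]]] // _ fm; have := f3 (proj v); rewrite iterS fm //.
  case: v => x y; rewrite /companion imx_map => /torus_projE/andP[/= i1 i2].
  (* The two integrality conditions add up to [-3 y]; so [y] is a third of an integer, and it
     determines [x] modulo 1. *)
  have [q yE] : exists q : int, [\/ y = q%:~R, y = 1 / 3 + q%:~R | y = 2 / 3 + q%:~R].
    apply: third_int; set a := _ + _ in i1; set b := _ + _ in i2.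
    rewrite (_ : _ * _ = - (a + b)); first by rewrite rpredN rpredD.
    by rewrite /a /b; ring.
  have [p xE] : exists p : int, x = - y + p%:~R.
    by move/intrP: i1 => [p pE]; exists (- p); rewrite mulrNz -pE; ring.
  by case: yE => yE; [exists 0%N|exists 1%N|exists 2%N] => //; exists 0%N => /=;
    [apply: (@proj_eq R _ _ (p - q) q)|apply: (@proj_eq R _ _ (p - q - 1) q)|
     apply: (@proj_eq R _ _ (p - q - 1) q)]; rewrite /= ?xE ?yE ?intrB; try field.
- case=> [|[|[|//]]] [|[|[|//]]] //= _ _ _ _; split=> //; exact/nesym.
Qed.

Lemma table4 : orbit_table (torus_map (@companion R 0)) 4
  [:: (h, 0); (0, 0); (h, h)] [:: 2; 1; 1]%N.
Proof.
have [n1 n2 n3 [n4 n5 n6]] := halves_neq.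
have f0 : torus_map (@companion R 0) (proj (h, 0)) = proj (0, h) by map_eq (0 : int) (0 : int).
have f4 : iter 4 (torus_map (@companion R 0)) =1 @id (torus R).
  move=> z; have [[x y] <-] := torus_projK z; map_eq (0 : int) (0 : int).
split=> //.
- case=> [|[|[|//]]] _ /=.
  + split=> //; first by map_eq (-1 : int) (0 : int).
    by case=> [|[|j]] //= _; rewrite f0; exact: nesym.
  + by apply: fixed_period1; map_eq (0 : int) (0 : int).
  + by apply: fixed_period1; map_eq (-1 : int) (0 : int).
- move=> v m m4 fm.
  (* The square is -1, whose fixed points are the half-lattice points; points fixed by the first or
     third power are among them. *)
  have {m m4 fm} : iter 2 (torus_map (@companion R 0)) (proj v) = proj v.
    case: m m4 fm => [|[|[|[|//]]]] // _ fm; first by rewrite iterS fm.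
    have f1 : torus_map (@companion R 0) (proj v) = proj v by have := f4 (proj v); rewrite iterS fm.
    by rewrite /= f1.
  case: v => x y; rewrite /companion /= !imx_map => /esym/torus_projE H.
  have {}H : lattice ((x * 2, y * 2) : plane R).
    by apply: lattice_eq H _ _ => /=; ring.
  case: (half_lattice H) => ->.
  + by exists 1%N => //; exists 0%N.
  + by exists 0%N => //; exists 0%N.
  + by exists 0%N => //; exists 1%N; rewrite /= f0.
  + by exists 2%N => //; exists 0%N.
- by case=> [|[|[|//]]] [|[|[|//]]] //= _ _ _ _; split=> //; exact/nesym.
Qed.

Lemma table6 : orbit_table (torus_map (@companion R 1)) 6
  [:: (h, 0); (1 / 3, 1 / 3); (0, 0)] [:: 3; 2; 1]%N.
Proof.
have [n1 n2 n3 [n4 n5 n6]] := halves_neq.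
have n7 : proj (2 / 3, 2 / 3) <> proj (1 / 3, 1 / 3).
  by apply: (@proj_neq1 R _ _ 3 1) => //=; by field.
set f := torus_map (@companion R 1).
have f1 : f (proj (h, 0)) = proj (0, h) by rewrite /f; map_eq (0 : int) (0 : int).
have f2 : f (proj (0, h)) = proj (h, h) by rewrite /f; map_eq (-1 : int) (0 : int).
have f3 : f (proj (1 / 3, 1 / 3)) = proj (2 / 3, 2 / 3) by rewrite /f; map_eq (-1 : int) (0 : int).
have f6 : iter 6 f =1 @id (torus R).
  move=> z; have [[x y] <-] := torus_projK z; rewrite /f; map_eq (0 : int) (0 : int).
split=> //.
- case=> [|[|[|//]]] _ /=.
  + split=> //; first by rewrite /= f1 f2 /f; map_eq (-1 : int) (1 : int).
    by case=> [|[|[|j]]] //= _; rewrite f1 ?f2; exact: nesym.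
  + split=> //; first by rewrite /= f3 /f; map_eq (-1 : int) (1 : int).
    by case=> [|[|j]] //= _; rewrite f3.
  + by apply: fixed_period1; rewrite /f; map_eq (0 : int) (0 : int).
- move=> v m m6 fm.
  (* As the sixth power is the identity, exponents 4 and 5 reduce to 2 and 1. The cube is -1, with
     half-lattice points fixed; the square has order 3, and its fixed points have coordinates in
     thirds. *)
  have {m m6 fm} : iter 2 f (proj v) = proj v \/ iter 3 f (proj v) = proj v.
    case: m m6 fm => [|[|[|[|[|[|//]]]]]] // _ fm; [left|by left|by right|left|left].
    - by rewrite iterS fm.
    - by have := f6 (proj v); rewrite (iterD 2 4) fm.
    - have e : f (proj v) = proj v by have := f6 (proj v); rewrite iterS fm.
      by rewrite /= e e.
  case: v => x y; case; rewrite /= /f /companion !imx_map -/(companion 1) -/f.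
    move=> /torus_projE/andP[/= i1 i2].
    have [q xE] : exists q : int, [\/ x = q%:~R, x = 1 / 3 + q%:~R | x = 2 / 3 + q%:~R].
      apply: third_int.
      set a := _ + _ in i1; set b := _ + _ in i2.
      rewrite (_ : _ * _ = b - a); first by rewrite rpredB.
      by rewrite /a /b; ring.
    have [p yE] : exists p : int, y = x + p%:~R.
      by move/intrP: i2 => [p pE]; exists (- p); rewrite mulrNz -pE; ring.
    case: xE => xE.
    + exists 2%N => //; exists 0%N => /=.
      by apply: (@proj_eq R _ _ q (q + p)); rewrite /= ?yE ?xE ?intrD; ring.
    + exists 1%N => //; exists 0%N => /=.
      by apply: (@proj_eq R _ _ q (q + p)); rewrite /= ?yE ?xE ?intrD; ring.
    + exists 1%N => //; exists 1%N; rewrite /= f3.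
      by apply: (@proj_eq R _ _ q (q + p)); rewrite /= ?yE ?xE ?intrD; ring.
  move=> /esym/torus_projE H.
  have {}H : lattice ((x * 2, y * 2) : plane R).
    by apply: lattice_eq H _ _ => /=; ring.
  case: (half_lattice H) => ->.
  + by exists 2%N => //; exists 0%N.
  + by exists 0%N => //; exists 0%N.
  + by exists 0%N => //; exists 1%N; rewrite /= f1.
  + by exists 0%N => //; exists 2%N; rewrite /= f1 f2.
- by case=> [|[|[|//]]] [|[|[|//]]] //= _ _ _.
Qed.

End ConcreteTables.

Section Realizations.
Context {R : realType}.

Lemma companion_step (t : int) j :
  companion t ^+ j.+2 = t%:~R *: companion t ^+ j.+1 - companion t ^+ j :> 'M[R]_2.
Proof. by rewrite exprSS ?companion_det // companion_tr. Qed.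

Lemma companion3 : companion (-1) ^+ 3 = 1%:M :> 'M[R]_2.
Proof.
by rewrite 2!companion_step expr1 expr0 mulrNz !scaleN1r opprB opprK addrK.
Qed.

Lemma companion4 : companion 0 ^+ 4 = 1%:M :> 'M[R]_2.
Proof.
by rewrite companion_step scale0r sub0r companion_step scale0r sub0r opprK expr0.
Qed.

Lemma companion6 : companion 1 ^+ 6 = 1%:M :> 'M[R]_2.
Proof.
have c3 : companion 1 ^+ 3 = - 1%:M :> 'M[R]_2.
  by rewrite 2!companion_step expr1 expr0 !scale1r addrAC subrr add0r.
by rewrite (exprD _ 3 3) c3 mulNr mulrN opprK [_ * _]mulr1.
Qed.

Lemma kappas_realized (kappa : characteristic) (i : 'I_7) :
  same_characteristic kappa (tnth kappas i) ->
  exists (f : torus R -> torus R) (n : nat),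
      [/\ homeomorphism f, orientation_preserving f, periodic_of_period n f,
          Bbar n f !=set0 & complete_characteristic n f kappa].
Proof.
have [P3 d3 c3] : exists2 P : 'M[R]_2, 0 < \det P & forall v, lin P (lin (companion (-1)) v) =
    rotation (2 * pi * 1%:Z%:~R / 3%:R) (lin P v).
  by have [t3 s3] := @trig3 R; apply: companion_conj.
have [P4 d4 c4] : exists2 P : 'M[R]_2, 0 < \det P & forall v, lin P (lin (companion 0) v) =
    rotation (2 * pi * 1%:Z%:~R / 4%:R) (lin P v).
  by have [t4 s4] := @trig4 R; apply: companion_conj.
have [P6 d6 c6] : exists2 P : 'M[R]_2, 0 < \det P & forall v, lin P (lin (companion 1) v) =
    rotation (2 * pi * 1%:Z%:~R / 6%:R) (lin P v).
  by have [t6 s6] := @trig6 R; apply: companion_conj.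
have K3 := table_realization (imx_int _ _ _ _) (isT : (1 < 3)%N) companion3 d3 c3 table3 isT.
have K4 := table_realization (imx_int _ _ _ _) (isT : (1 < 4)%N) companion4 d4 c4 table4 isT.
have K6 := table_realization (imx_int _ _ _ _) (isT : (1 < 6)%N) companion6 d6 c6 table6 isT.
case: i => [[|[|[|[|[|[|[|//]]]]]]] i7].
- apply: (@table_realization R (imx (-1) 0 0 (-1)) 1%:M 2 _ _ _ isT _ _ _ table2 isT 1%N) => //.
  + exact: imx_int.
  + by apply/matrixP; do 2 apply: ord2P; rewrite expr2 !mxE !sum2 !mxE /=; ring.
  + by rewrite det1.
  + move=> v; rewrite !lin1 mulr1 mulrAC divff ?pnatr_eq0 // mul1r.
    by apply: plane_eq; rewrite /= cospi sinpi !mxE /=; ring.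
  + by left.
- by apply: (K3 1%N) => //; left.
- by apply: (K3 2%N) => //; right.
- by apply: (K6 1%N) => //; left.
- by apply: (K6 5%N) => //; right.
- by apply: (K4 1%N) => //; left.
- by apply: (K4 3%N) => //; right.
Qed.

End Realizations.

Lemma kappas_distinct (kappa : characteristic) (i j : 'I_7) :
  same_characteristic kappa (tnth kappas i) -> same_characteristic kappa (tnth kappas j) -> i = j.
Proof.
move=> [ni _ permi] [nj _ permj].
have pij : perm_eq (orbit_data (tnth kappas i)) (orbit_data (tnth kappas j)).
  by rewrite -(permPl permi).
rewrite nj in ni; move: ni pij; clear permi permj nj.
(* Distinct indices differ in [n] or in the multiset of pairs, and both comparisons are decided by
   computation. *)
by case: i => [[|[|[|[|[|[|[|//]]]]]]] i7]; case: j => [[|[|[|[|[|[|[|//]]]]]]] j7] //= _ _;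
  apply: val_inj.
Qed.

Theorem theorem1p1 (R : realType) (kappa : characteristic) :
  (exists (f : torus R -> torus R) (n : nat),
      [/\ homeomorphism f, orientation_preserving f, periodic_of_period n f,
          Bbar n f !=set0 & complete_characteristic n f kappa])
  <->
  (exists! i : 'I_7, same_characteristic kappa (tnth kappas i)).
Proof.
split=> [[f [n [fh fo fp fB fk]]]|[i [ki _]]]; last exact: kappas_realized ki.
have [i ki] := periodic_characteristic fh fo fp fB fk.
by exists i; split=> // j; exact: kappas_distinct ki.
Qed.
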